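(* Let $\Theta:\mathbb{D}\to M_n$ be a purely contractive analytic function. Then $$X_\Theta V_\Theta=V_\Theta Y_\Theta^*\Big(\mathbf 1-(\mathbf 1_n-\Theta(0))\sum_{i=1}^n(\cdot,b_i^-)_\Theta\,b_i^-\Big),$$ i.e. for all $f\in H^2_\Theta$, $X_\Theta V_\Theta f=V_\Theta Y_\Theta^*\big(f-\sum_{i=1}^n(f,b_i^-)_\Theta\,g_i\big)$, where $g_i$ is the constant function with value $(\mathbf 1_n-\Theta(0))e_i$.
   Context: $\mathbb{D}$ is the open unit disc, $\mathbb{T}$ the unit circle, $M_n$ the complex $n\times n$ matrices, $\mathbf 1_n$ the identity matrix, $(\cdot,\cdot)$ the inner product of $\mathbb{C}^n$, $\{e_i\}_{i=1}^n$ a fixed orthonormal basis. Purely contractive means $\|\Theta(z)\|\le1$ on $\mathbb{D}$ and $\|\Theta(0)\|<1$. $\Omega_\Theta$ is the unique positive $M_n$-valued Borel measure on $\mathbb{T}$ with $\mathrm{Re}\big[(\mathbf 1+\Theta(z))(\mathbf 1-\Theta(z))^{-1}\big]=\mathrm{Re}\int_{\mathbb{T}}\frac{\zeta+z}{\zeta-z}\Omega_\Theta(d\zeta)$, $z\in\mathbb{D}$. $L^2_\Theta$ is the Hilbert space of $\mathbb{C}^n$-valued functions on $\mathbb{T}$ with inner product $(f,g)_\Theta=\int_{\mathbb{T}}(\Omega_\Theta(d\zeta)f(\zeta),g(\zeta))$; $H^2_\Theta$ is the closure of the $\mathbb{C}^n$-valued polynomials in it; $b_i^-$ is the constant function $e_i$;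 $Z_\Theta$ is multiplication by $\zeta$ on $L^2_\Theta$; $Y_\Theta=Z_\Theta|_{H^2_\Theta}$ (an operator on $H^2_\Theta$), with adjoint $Y_\Theta^*$ on $H^2_\Theta$. $K^2_\Theta$ is the de Branges–Rovnyak space: the range of $(\mathbf 1-T_\Theta T_\Theta^* )^{1/2}$ on $H^2_n(\mathbb{D})$ (the $\mathbb{C}^n$-valued Hardy space, $T_\Theta$ multiplication by $\Theta$) with the inner product making $(\mathbf 1-T_\Theta T_\Theta^* )^{1/2}$ a co-isometry onto its range. $S$ is the shift (multiplication by $z$) on $H^2_n(\mathbb{D})$ and $X_\Theta=S^*|_{K^2_\Theta}$. $V_\Theta:H^2_\Theta\to K^2_\Theta$ is the unitary map $(V_\Theta f)(z)=(\mathbf 1-\Theta(z))\int_{\mathbb{T}}\frac{1}{1-\overline\zeta z}\Omega_\Theta(d\zeta)f(\zeta)$. *)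

(* Defs.v *)
From HB Require Import structures.
From mathcomp Require Import all_boot all_order all_algebra.
From mathcomp Require Import all_classical all_reals all_analysis.
From mathcomp Require Import complex.

Set Implicit Arguments.
Unset Strict Implicit.
Unset Printing Implicit Defensive.

Import Order.TTheory GRing.Theory Num.Theory.
Import numFieldNormedType.Exports.

Local Open Scope classical_set_scope.
Local Open Scope ring_scope.

(* The library puts the modulus topology on abstract numeric fields only;
   [R[i]] has to be given it explicitly. *)
HB.instance Definition _ (R : realType) :=
  NormedModule.copy R[i] (R[i] : numClosedFieldType)^o.
HB.instance Definition _ (R : realType) := Num.ClosedField.on R[i].

Section complex_linear_algebra.
Context {R : realType}.
Local Notation C := R[i].

(* Linear in the first argument. *)
Definition dotc {n} (u v : 'cV[C]_n) : C := \sum_(i < n) u i 0 * (v i 0)^*.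

Definition cvnorm {n} (v : 'cV[C]_n) : R := Num.sqrt (complex.Re (dotc v v)).

Definition opnorm {n} (A : 'M[C]_n) : R :=
  sup [set cvnorm (A *m v) | v in [set v | cvnorm v <= 1]].

Definition adjmx {n} (A : 'M[C]_n) : 'M[C]_n := (map_mx Num.conj A)^T.

Definition Re_mx {n} (A : 'M[C]_n) : 'M[C]_n := 2^-1 *: (A + adjmx A).

Definition psdmx {n} (A : 'M[C]_n) : Prop :=
  forall v : 'cV[C]_n, 0 <= dotc (A *m v) v.

Definition orthonormal_basis {n} (e : 'I_n -> 'cV[C]_n) : Prop :=
  forall i j, dotc (e i) (e j) = (i == j)%:R.

End complex_linear_algebra.

Section disc_and_circle.
Variable R : realType.

Definition disc : Type := set_type [set z : R[i] | `|z| < 1].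

Definition circle : Type := set_type [set z : R[i] | `|z| = 1].

Lemma disc0_subproof : (0 : R[i]) \in [set z : R[i] | `|z| < 1].
Proof. by rewrite inE /= normr0. Qed.

Definition disc0 : disc := exist _ 0 disc0_subproof.

Lemma circle1_subproof : (1 : R[i]) \in [set z : R[i] | `|z| = 1].
Proof. by rewrite inE /= normr1. Qed.

HB.instance Definition _ :=
  Choice.copy circle (set_type [set z : R[i] | `|z| = 1]).
HB.instance Definition _ := isPointed.Build circle (exist _ 1 circle1_subproof).
HB.instance Definition _ :=
  Topological.copy circle (set_type [set z : R[i] | `|z| = 1]).

Definition circle_open : set (set circle) := open.

Definition borel_circle := g_sigma_algebraType circle_open.
HB.instance Definition _ := Measurable.on borel_circle.

Definition dval (z : disc) : R[i] := set_val z.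
Definition cval (z : borel_circle) : R[i] := set_val (z : circle).

End disc_and_circle.

Arguments disc0 {R}.

(* Positive M_n-valued measures.  As for scalar measures in the library, the
   value on a non-measurable set is irrelevant but is still asked to be
   positive. *)
Record mxmeasure d (T : measurableType d) (R : realType) (n : nat) := MxMeasure {
  mxmeas :> set T -> 'M[R[i]]_n ;
  mxmeas0 : mxmeas set0 = 0 ;
  mxmeas_psd : forall A, psdmx (mxmeas A) ;
  mxmeas_sigma_additive : forall F : (set T)^nat,
    (forall k, measurable (F k)) -> trivIset setT F ->
    measurable (\bigcup_k F k) ->
    (fun m => \sum_(0 <= k < m) mxmeas (F k)) @ \oo
      --> mxmeas (\bigcup_k F k) }.

Lemma cvg_complex_Re (R : realType) (u : nat -> R[i]) (l : R[i]) :
  u @ \oo --> l -> (fun m => complex.Re (u m)) @ \oo --> complex.Re l.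
Proof.
move=> /cvgrPdist_lt ul; apply/cvgrPdist_lt => e e0.
have := ul (e%:C)%C; rewrite ltcR => /(_ e0).
apply: filterS => m; rewrite -raddfB /=.
case: (l - u m) => a b; rewrite normc_def ltcR /=; apply: le_lt_trans.
by rewrite -sqrtr_sqr ler_wsqrtr// lerDl sqr_ge0.
Qed.

Lemma cvg_complex_Im (R : realType) (u : nat -> R[i]) (l : R[i]) :
  u @ \oo --> l -> (fun m => complex.Im (u m)) @ \oo --> complex.Im l.
Proof.
move=> /cvgrPdist_lt ul; apply/cvgrPdist_lt => e e0.
have := ul (e%:C)%C; rewrite ltcR => /(_ e0).
apply: filterS => m; rewrite -raddfB /=.
case: (l - u m) => a b; rewrite normc_def ltcR /=; apply: le_lt_trans.
by rewrite -sqrtr_sqr ler_wsqrtr// lerDr sqr_ge0.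
Qed.

Lemma mxtrace_psd_ge0 (R : realType) n (A : 'M[R[i]]_n) :
  psdmx A -> 0 <= complex.Re (\tr A).
Proof.
move=> A0; rewrite /mxtrace raddf_sum; apply: sumr_ge0 => i _ /=.
have := A0 (delta_mx i 0); rewrite /dotc (bigD1 i)//= big1 => [|j ji]; last first.
  by rewrite [in X in _ * X]mxE (negbTE ji)/= conjC0 mulr0.
rewrite addr0 [in X in _ * X]mxE !eqxx conjC1 mulr1 -colE mxE lecE /=.
by case/andP.
Qed.

Section trace_and_entries.
Context d (T : measurableType d) (R : realType) (n : nat).
Variable Om : mxmeasure T R n.

Definition trace_measure (A : set T) : \bar R := (complex.Re (\tr (Om A)))%:E.
Definition entry_Re (i j : 'I_n) (A : set T) : \bar R :=
  (complex.Re (Om A i j))%:E.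
Definition entry_Im (i j : 'I_n) (A : set T) : \bar R :=
  (complex.Im (Om A i j))%:E.

Let sigma_additive_lin (phi : 'M[R[i]]_n -> R) :
  (forall A B, phi (A + B) = phi A + phi B) -> phi 0 = 0 ->
  (forall (u : nat -> 'M[R[i]]_n) (l : 'M[R[i]]_n), u @ \oo --> l ->
    (fun m => phi (u m)) @ \oo --> phi l) ->
  semi_sigma_additive (fun A => (phi (Om A))%:E).
Proof.
move=> phiD phi0 phi_cont F mF tF mUF.
under eq_fun do rewrite sumEFin -(big_morph phi phiD phi0).
by apply: cvg_EFin; [exact: nearW|
  apply: phi_cont; exact: mxmeas_sigma_additive].
Qed.

Let cvg_entry (u : nat -> 'M[R[i]]_n) (l : 'M[R[i]]_n) i j :
  u @ \oo --> l -> (fun m => u m i j) @ \oo --> l i j.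
Proof.
move=> ul; apply: (@cvg_comp _ _ _ u (fun M : 'M[R[i]]_n => M i j) _ (nbhs l)).
  exact: ul.
exact: (@coord_continuous R[i] n n i j l).
Qed.

Let entry_Re0 i j : entry_Re i j set0 = 0%E.
Proof. by rewrite /entry_Re mxmeas0 mxE. Qed.

Let entry_Re_fin i j (A : set T) : measurable A -> entry_Re i j A \is a fin_num.
Proof. by []. Qed.

Let entry_Re_sigma i j : semi_sigma_additive (entry_Re i j).
Proof.
apply: (@sigma_additive_lin (fun A => complex.Re (A i j))) => [A B||u l ul].
- by rewrite mxE raddfD.
- by rewrite mxE.
- by apply: cvg_complex_Re; exact: cvg_entry.
Qed.

HB.instance Definition _ i j := isCharge.Build _ _ _ (entry_Re i j)
  (entry_Re0 i j) (@entry_Re_fin i j) (@entry_Re_sigma i j).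

Let entry_Im0 i j : entry_Im i j set0 = 0%E.
Proof. by rewrite /entry_Im mxmeas0 mxE. Qed.

Let entry_Im_fin i j (A : set T) : measurable A -> entry_Im i j A \is a fin_num.
Proof. by []. Qed.

Let entry_Im_sigma i j : semi_sigma_additive (entry_Im i j).
Proof.
apply: (@sigma_additive_lin (fun A => complex.Im (A i j))) => [A B||u l ul].
- by rewrite mxE raddfD.
- by rewrite mxE.
- by apply: cvg_complex_Im; exact: cvg_entry.
Qed.

HB.instance Definition _ i j := isCharge.Build _ _ _ (entry_Im i j)
  (entry_Im0 i j) (@entry_Im_fin i j) (@entry_Im_sigma i j).

Let trace_measure0 : trace_measure set0 = 0%E.
Proof. by rewrite /trace_measure mxmeas0 mxtrace0. Qed.

Let trace_measure_ge0 A : (0 <= trace_measure A)%E.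
Proof. by rewrite lee_fin; apply: mxtrace_psd_ge0; exact: mxmeas_psd. Qed.

Let trace_measure_sigma : semi_sigma_additive trace_measure.
Proof.
apply: (@sigma_additive_lin (fun A => complex.Re (\tr A))) => [A B||u l ul].
- by rewrite mxtraceD raddfD.
- by rewrite mxtrace0.
- rewrite /mxtrace raddf_sum /=; under eq_fun do rewrite raddf_sum /=.
  by apply: cvg_big => [|i _]; [exact: add_continuous|
    apply: cvg_complex_Re; exact: cvg_entry].
Qed.

HB.instance Definition _ := isMeasure.Build _ _ _ trace_measure
  trace_measure0 trace_measure_ge0 trace_measure_sigma.

Let trace_measure_fin : fin_num_fun trace_measure.
Proof. by []. Qed.

HB.instance Definition _ :=
  Measure_isFinite.Build _ _ _ trace_measure trace_measure_fin.

(* Integrals against a matrix measure are taken through its density with respect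
   to its trace; every entry is absolutely continuous with respect to the trace
   because |Om(A) i j| <= tr Om(A), so no junk value of Radon_Nikodym arises.
   Entrywise integration would not do: for f in L2space the products
   Om_ij(dt) f_j(t) conj(f_i(t)) need not be integrable one by one. *)
Definition mxdensity (t : T) : 'M[R[i]]_n :=
  \matrix_(i, j) Complex
    (fine (Radon_Nikodym (entry_Re i j) trace_measure t))
    (fine (Radon_Nikodym (entry_Im i j) trace_measure t)).

End trace_and_entries.

Section matrix_integration.
Context d (T : measurableType d) (R : realType) (n : nat).
Local Notation C := R[i].

Definition Cintegral (mu : {measure set T -> \bar R}) (h : T -> C) : C :=
  Complex (\int[mu]_t complex.Re (h t)) (\int[mu]_t complex.Im (h t)).

(* int Om(dt) G(t), for G with values in vectors or in matrices. *)
Definition mxintegral (Om : mxmeasure T R n) p (G : T -> 'M[C]_(n, p)) :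
    'M[C]_(n, p) :=
  \matrix_(i, j) Cintegral (trace_measure Om)
    (fun t => (mxdensity Om t *m G t) i j).

(* int (Om(dt) f(t), g(t)) *)
Definition L2dot (Om : mxmeasure T R n) (f g : T -> 'cV[C]_n) : C :=
  Cintegral (trace_measure Om) (fun t => dotc (mxdensity Om t *m f t) (g t)).

Definition L2norm (Om : mxmeasure T R n) (f : T -> 'cV[C]_n) : R :=
  Num.sqrt (complex.Re (L2dot Om f f)).

Definition cvmeasurable (f : T -> 'cV[C]_n) : Prop :=
  forall i, measurable_fun setT (fun t => complex.Re (f t i 0)) /\
            measurable_fun setT (fun t => complex.Im (f t i 0)).

(* Functions rather than classes: f and g represent the same vector when
   L2norm Om (f - g) = 0. *)
Definition L2space (Om : mxmeasure T R n) : set (T -> 'cV[C]_n) :=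
  [set f | cvmeasurable f /\
    (trace_measure Om).-integrable setT
      (fun t => (complex.Re (dotc (mxdensity Om t *m f t) (f t)))%:E)].

End matrix_integration.

Section hilbert_space_operators.
Context {R : realType} {E : lmodType R[i]}.
(* H is a Hilbert space with inner product ip, up to vectors of norm zero. *)
Variables (H : set E) (ip : E -> E -> R[i]).

(* The adjoint on H of the restriction of A to H; when elements of H are
   representatives of classes, some representative of the adjoint's value. *)
Definition adjoint (A : E -> E) (h : E) : E :=
  xget 0 [set g | H g /\ forall u, H u -> ip (A u) h = ip u g].

Definition is_psqrt (B D : E -> E) : Prop :=
  [/\ forall u, H u -> H (D u),
      forall (a : R[i]) u v, H u -> H v -> D (a *: u + v) = a *: D u + D v,
      forall u v, H u -> H v -> ip (D u) v = ip u (D v),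
      forall u, H u -> 0 <= ip (D u) u &
      forall u, H u -> D (D u) = B u].

(* The positive square root; a symmetric operator defined on all of a Hilbert
   space is automatically bounded. *)
Definition psqrt (B : E -> E) : E -> E := xget (idfun : E -> E) [set D | is_psqrt B D].

End hilbert_space_operators.

Section hardy_space.
Context {R : realType} {n : nat}.
Local Notation C := R[i].

Definition power_series_on_disc {p q} (a : nat -> 'M[C]_(p, q))
    (F : disc R -> 'M[C]_(p, q)) : Prop :=
  forall z, series (fun k => dval z ^+ k *: a k) @ \oo --> F z.

(* On a disc, analyticity amounts to a power series expansion at the centre. *)
Definition analytic {p q} (F : disc R -> 'M[C]_(p, q)) : Prop :=
  exists a, power_series_on_disc a F.

Definition hardy : set (disc R -> 'cV[C]_n) :=
  [set f | exists a, power_series_on_disc a f /\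
                     cvgn (series (fun k => cvnorm (a k) ^+ 2))].

Definition taylor_coef (f : disc R -> 'cV[C]_n) : nat -> 'cV[C]_n :=
  xget (fun=> 0) [set a | power_series_on_disc a f].

Definition hardy_dot (f g : disc R -> 'cV[C]_n) : C :=
  limn (series (fun k => dotc (taylor_coef f k) (taylor_coef g k))).

Definition shift (f : disc R -> 'cV[C]_n) : disc R -> 'cV[C]_n :=
  fun z => dval z *: f z.

Definition shift_adj : (disc R -> 'cV[C]_n) -> (disc R -> 'cV[C]_n) :=
  adjoint hardy hardy_dot shift.

End hardy_space.

Section de_Branges_Rovnyak.
Context {R : realType} {n : nat}.
Local Notation C := R[i].
Variable Theta : disc R -> 'M[C]_n.

Definition purely_contractive : Prop :=
  (forall z, opnorm (Theta z) <= 1) /\ opnorm (Theta disc0) < 1.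

Definition Tmul (u : disc R -> 'cV[C]_n) : disc R -> 'cV[C]_n :=
  fun z => Theta z *m u z.

Definition Tmul_adj : (disc R -> 'cV[C]_n) -> (disc R -> 'cV[C]_n) :=
  adjoint hardy hardy_dot Tmul.

Definition dBR_root : (disc R -> 'cV[C]_n) -> (disc R -> 'cV[C]_n) :=
  psqrt hardy hardy_dot (fun u => u - Tmul (Tmul_adj u)).

(* The range of the square root of 1 - T T^* on the Hardy space. *)
Definition dBR : set (disc R -> 'cV[C]_n) := dBR_root @` hardy.

(* S^* restricted to dBR; junk value 0 off dBR. *)
Definition Xop : (disc R -> 'cV[C]_n) -> (disc R -> 'cV[C]_n) :=
  patch (fun=> 0) dBR shift_adj.

End de_Branges_Rovnyak.

Section L2_Theta.
Context {R : realType} {n : nat}.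
Local Notation C := R[i].
Local Notation vfun := (borel_circle R -> 'cV[C]_n).
Variable Om : mxmeasure (borel_circle R) R n.

Definition vpolynomial : set vfun :=
  [set p | exists m (a : nat -> 'cV[C]_n),
             p = fun zeta => \sum_(k < m) cval zeta ^+ k *: a k].

Definition H2space : set vfun :=
  [set f | L2space Om f /\ forall eps : R, 0 < eps ->
             exists2 p, vpolynomial p & L2norm Om (f - p) < eps].

Definition Zop (f : vfun) : vfun := fun zeta => cval zeta *: f zeta.

(* Y^*, on H2space, where Y is the restriction of Zop to H2space. *)
Definition Yadj : vfun -> vfun := adjoint H2space (L2dot Om) Zop.

(* This identity determines Om on Borel sets. *)
Definition is_herglotz_measure (Theta : disc R -> 'M[C]_n) : Prop :=
  forall z : disc R,
    Re_mx ((1%:M + Theta z) *m invmx (1%:M - Theta z)) =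
    Re_mx (mxintegral Om (fun zeta =>
             ((cval zeta + dval z) / (cval zeta - dval z))%:M)).

Definition Vop (Theta : disc R -> 'M[C]_n) (f : vfun) : disc R -> 'cV[C]_n :=
  fun z => (1%:M - Theta z) *m
    mxintegral Om (fun zeta => (1 - (cval zeta)^* * dval z)^-1 *: f zeta).

End L2_Theta.

(* Main.v *)
(* Put A = 1 - Theta, let A_k be its Taylor coefficients, M_k the k-th moment
   int conj(zeta)^k Om(dzeta) and F_k(f) = int conj(zeta)^k Om(dzeta) f(zeta).
   Expanding 1/(1 - conj(zeta) z), the Taylor coefficients of V f are the Cauchy
   product A * F(f).  With P_0 = M_0, P_k = 2 M_k and G = A * P, the Herglotz
   identity conjugated by A(z), which is invertible, becomes
     G_j A_k^* + A_j G_k^* = 2 (delta_j0 delta_k0 - Theta_j Theta_k^* ),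
   because a series in z^j conj(z)^k vanishing on the disc has zero coefficients.
   - Summed against finite sequences u, the identity says that the polynomial
     q = sum_j zeta^j (T_A^* u)_j has |q|^2 = |u|^2 - |T_Theta^* u|^2, whereas
     (u, V f) = (q, f).  Cauchy-Schwarz then bounds |(u, V f)|^2 by
     |f|^2 ((1 - T T^* ) u, u), i.e. V f is in the range of (1 - T T^* )^(1/2).
   - The entries (k+1, 0) and (0, 0) give (sum_(j <= k) A_j M_(k+1-j)) A_0 =
     - A_(k+1), and this is the equality of the k-th Taylor coefficients of both
     sides of the theorem, as F_k(Y^* h) = F_(k+1)(h).
   Elements of L2space are functions and not classes, hence semi-inner products
   that are complete only up to vectors of norm zero. *)
Require Import Defs.
From HB Require Import structures.
From mathcomp Require Import all_boot all_order all_algebra.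
From mathcomp Require Import all_classical all_reals all_analysis.
From mathcomp Require Import measurable_realfun complex.
From mathcomp Require Import separable cyclic cyclotomic.
From mathcomp Require Import ring lra zify.

Set Implicit Arguments.
Unset Strict Implicit.
Unset Printing Implicit Defensive.
Import Order.TTheory GRing.Theory Num.Theory.
Import numFieldNormedType.Exports.
Local Open Scope classical_set_scope.
Local Open Scope ring_scope.

(** * Complex limits *)

(** [adjoint] and [psqrt] choose their value by [xget], so nothing is known of them before existence
    is proved. Hence the Riesz theorem on complete spaces, and a square root of 1 - T T^* built from
    the power series of 1 - sqrt (1 - x). Membership in the range is then proved for whichever root
    was chosen. Three facts stand behind the steps named above. That multiplication by [Theta]
    contracts the Hardy space follows from pointwise contractivity, averaged over roots of unity on
    circles of radius r < 1. That 1 - Theta(z) is invertible at every z, although the strict bound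
    is assumed at 0 only, is transported from z to 0 by a Szego kernel fixed by T^*. That L^2 of
    [Omega] is complete is the delicate one: the density of [Omega] may be degenerate, so the values
    of a Cauchy sequence need not converge pointwise; only their images under the density do, and a
    preimage of the limit has to be chosen measurably. *)

Section complex_sequences.
Context {R : realType}.
Implicit Types (u v : nat -> R[i]) (l z : R[i]).

Lemma normc_le_ReIm z : `|z| <= (`|complex.Re z| + `|complex.Im z|)%:C%C.
Proof.
case: z => a b; rewrite normc_def lecR /=.
rewrite -[leRHS]ger0_norm ?addr_ge0// -sqrtr_sqr ler_wsqrtr//.
by rewrite sqrrD !real_normK ?num_real// -addrA lerD2l addrC lerDl mulrn_wge0// mulr_ge0.
Qed.

Lemma norm_sqrD2 (a b : R[i]) : `|a + b| ^+ 2 <= 2 * `|a| ^+ 2 + 2 * `|b| ^+ 2.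
Proof.
have e (x : R) : 2 * x%:C%C = (2 * x)%:C%C by rewrite rmorphM/= rmorph_nat.
rewrite -!add_Re2_Im2 !e -[leRHS](rmorphD (real_complex R)) lecR.
have -> : complex.Re (a + b) = complex.Re a + complex.Re b by rewrite raddfD.
have -> : complex.Im (a + b) = complex.Im a + complex.Im b by rewrite raddfD.
have := sqr_ge0 (complex.Re a - complex.Re b).
have := sqr_ge0 (complex.Im a - complex.Im b); nra.
Qed.

Lemma cvg_complex u l : (fun k => complex.Re (u k)) @ \oo --> complex.Re l ->
  (fun k => complex.Im (u k)) @ \oo --> complex.Im l -> u @ \oo --> l.
Proof.
move=> /cvgrPdist_lt hr /cvgrPdist_lt hi; apply/cvgrPdist_lt => -[e f].
rewrite ltcE /= => /andP[/eqP -> e0].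
have e2 : 0 < e / 2 by rewrite divr_gt0.
near=> k.
apply: (le_lt_trans (normc_le_ReIm _)); rewrite ltcR (splitr e) !raddfB /=.
by apply: ltrD; near: k; [exact: hr|exact: hi].
Unshelve. all: by end_near. Qed.

Lemma complex_squeeze u l (b : nat -> R) :
  (\forall k \near \oo, `|u k - l| <= (b k)%:C%C) -> b @ \oo --> (0 : R) -> u @ \oo --> l.
Proof.
move=> ub /cvgrPdist_lt b0; apply/cvgrPdist_lt => -[e f].
rewrite ltcE /= => /andP[/eqP -> e0].
near=> k.
rewrite distrC; apply: (@le_lt_trans _ _ ((b k)%:C%C)); first by near: k.
rewrite ltcR; apply: (le_lt_trans (ler_norm _)); rewrite -normrN -[- b k]add0r.
by near: k; exact: b0.
Unshelve. all: by end_near. Qed.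

Lemma cvg_complex_norm u l (c : R) : u @ \oo --> l ->
  (\forall k \near \oo, `|u k| <= c%:C%C) -> `|l| <= c%:C%C.
Proof.
move=> ul uc; apply/ler_addgt0Pr => -[e f]; rewrite ltcE /= => /andP[/eqP -> e0].
have e0' : 0 < e%:C%C :> R[i] by rewrite ltcR.
move/cvgrPdist_lt: ul => /(_ _ e0') ul.
have [k [h1 h2]] : exists k, `|l - u k| < e%:C%C /\ `|u k| <= c%:C%C.
  near \oo => k; exists k; split; near: k => //.
rewrite -(subrK (u k) l) (le_trans (ler_normD _ _))// addrC lerD// ltW//.
Unshelve. all: by end_near. Qed.

Lemma cvg_complex_uniq u l l' : u @ \oo --> l -> u @ \oo --> l' -> l = l'.
Proof. by move=> h h'; exact: (cvg_unique _ h h'). Qed.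

Lemma series_abs_cvg u (b : nat -> R) : (forall k, `|u k| <= (b k)%:C%C) ->
  cvgn (series b) -> cvgn (series u).
Proof.
move=> ub cb.
have Rb k : `|complex.Re (u k)| <= b k.
  by rewrite -lecR (le_trans _ (ub k))// normc_ge_Re.
have Ib k : `|complex.Im (u k)| <= b k.
  rewrite -lecR (le_trans _ (ub k))//; have := normc_ge_Re ((u k) * 'i%C).
  rewrite ReiNIm normrN normrM => /le_trans; apply.
  by rewrite -[leRHS]mulr1 ler_wpM2l// normc_def /= expr0n add0r expr1n sqrtr1.
have aux (w : nat -> R) : (forall k, `|w k| <= b k) -> cvgn (series w).
  move=> wb; apply: normed_cvg; apply: (series_le_cvg _ _ wb cb) => k; first by rewrite normr_ge0.
  exact: le_trans (wb k).
have h1 := aux _ Rb; have h2 := aux _ Ib.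
apply/cvg_ex; exists (limn (series (fun k => complex.Re (u k))) +i* limn (series (fun k => complex.Im (u k))))%C.
apply: cvg_complex => /=.
  by rewrite (_ : (fun k => _) = series (fun k => complex.Re (u k))) //; apply/funext => k; rewrite /series /= raddf_sum.
by rewrite (_ : (fun k => _) = series (fun k => complex.Im (u k))) //; apply/funext => k; rewrite /series /= raddf_sum.
Qed.

(** Every block of [series u] is dominated by the same block of [series b]; letting the upper end of
    the block tend to infinity gives an explicit error after [m] terms. *)
Lemma series_tail_le u (b : nat -> R) (l : R[i]) (c : R) :
  (forall k, `|u k| <= (b k)%:C%C) -> series u @ \oo --> l -> series b @ \oo --> c ->
  forall m, `|l - series u m| <= (c - series b m)%:C%C.
Proof.
move=> ub ul bc m.
have b0 k : 0 <= b k by rewrite -lecR; apply: (le_trans _ (ub k)); exact: normr_ge0.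
apply: (@cvg_complex_norm (fun k => series u k - series u m)).
  exact: (cvgB ul (cvg_cst (series u m))).
exists m => // k /= mk; rewrite sub_series mk.
rewrite (le_trans (ler_norm_sum _ _ _))// (@le_trans _ _ ((\sum_(m <= i < k) b i)%:C%C))//.
  by rewrite raddf_sum ler_sum.
rewrite lecR; have := sub_series b m k; rewrite mk => <-; rewrite lerD2r.
rewrite -(cvg_lim _ bc)//; apply: nondecreasing_cvgn_le; last by apply/cvg_ex; exists c.
by apply/nondecreasing_seqP => i; rewrite seriesS lerDr.
Qed.

End complex_sequences.

(** * Hilbert spaces up to vectors of norm zero *)

Section semi_inner_product.
Context {R : realType} {E : lmodType R[i]} (H : set E) (ip : E -> E -> R[i]).

(** The axioms are restricted to [H] because [hardy_dot] and [L2dot] are default values without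
    algebraic laws outside their spaces. Definiteness is a separate hypothesis wherever it is used:
    it holds for the Hardy space and fails for functions on the circle. *)
Record semi_inner : Prop := SemiInner {
  si0 : H 0;
  siP : forall a u v, H u -> H v -> H (a *: u + v);
  siPl : forall a u v w, H u -> H v -> H w ->
    ip (a *: u + v) w = a * ip u w + ip v w;
  siC : forall u v, H u -> H v -> ip v u = (ip u v)^*;
  si_ge0 : forall u, H u -> 0 <= ip u u }.

Definition sqn u : R := complex.Re (ip u u).

Lemma sqn_def u : sqn u = complex.Re (ip u u). Proof. by []. Qed.

Hypothesis si : semi_inner.

Lemma siZ a u : H u -> H (a *: u).
Proof. by move=> Hu; rewrite -[a *: u]addr0; apply: siP => //; exact: si0. Qed.
Lemma siD u v : H u -> H v -> H (u + v).
Proof. by move=> Hu Hv; rewrite -[u]scale1r; apply: siP. Qed.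
Lemma siN u : H u -> H (- u).
Proof. by rewrite -scaleN1r; exact: siZ. Qed.
Lemma siB u v : H u -> H v -> H (u - v).
Proof. by move=> Hu Hv; apply: siD => //; exact: siN. Qed.
Lemma si_sum (I : Type) (s : seq I) (P : pred I) (F : I -> E) :
  (forall i, H (F i)) -> H (\sum_(i <- s | P i) F i).
Proof. by move=> HF; elim/big_ind : _ => //; [exact: si0|exact: siD]. Qed.

Local Hint Resolve si0 : core.

Lemma ip0l w : H w -> ip 0 w = 0.
Proof.
by move=> Hw; have := siPl si (-1) (si0 si) (si0 si) Hw; rewrite scaler0 addr0 mulN1r addNr.
Qed.
Lemma ipDl u v w : H u -> H v -> H w -> ip (u + v) w = ip u w + ip v w.
Proof. by move=> Hu Hv Hw; rewrite -{1}[u]scale1r siPl// mul1r. Qed.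
Lemma ipZl a u w : H u -> H w -> ip (a *: u) w = a * ip u w.
Proof.
by move=> Hu Hw; rewrite -[a *: u]addr0 siPl// ?ip0l ?addr0//; exact: si0.
Qed.
Lemma ipNl u w : H u -> H w -> ip (- u) w = - ip u w.
Proof. by move=> Hu Hw; rewrite -scaleN1r ipZl// mulN1r. Qed.
Lemma ipBl u v w : H u -> H v -> H w -> ip (u - v) w = ip u w - ip v w.
Proof. by move=> Hu Hv Hw; rewrite ipDl ?ipNl//; exact: siN. Qed.
Lemma ip0r w : H w -> ip w 0 = 0.
Proof. by move=> Hw; rewrite (siC si (si0 si) Hw) ip0l// conjC0. Qed.
Lemma ipDr u v w : H u -> H v -> H w -> ip w (u + v) = ip w u + ip w v.
Proof.
move=> Hu Hv Hw; rewrite (siC si _ Hw) ?ipDl// ?rmorphD/=; last exact: siD.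
by rewrite -!(siC si).
Qed.
Lemma ipZr a u w : H u -> H w -> ip w (a *: u) = a^* * ip w u.
Proof.
move=> Hu Hw; rewrite (siC si _ Hw) ?ipZl// ?rmorphM/=; last exact: siZ.
by rewrite -(siC si).
Qed.
Lemma ipNr u w : H u -> H w -> ip w (- u) = - ip w u.
Proof. by move=> Hu Hw; rewrite -scaleN1r ipZr// rmorphN1 mulN1r. Qed.
Lemma ipBr u v w : H u -> H v -> H w -> ip w (u - v) = ip w u - ip w v.
Proof. by move=> Hu Hv Hw; rewrite ipDr ?ipNr//; exact: siN. Qed.

Lemma ip_suml (I : Type) (s : seq I) (P : pred I) (F : I -> E) w :
  (forall i, H (F i)) -> H w ->
  ip (\sum_(i <- s | P i) F i) w = \sum_(i <- s | P i) ip (F i) w.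
Proof.
move=> HF Hw; elim: s => [|x s IH]; first by rewrite !big_nil ip0l.
rewrite !big_cons; case: ifP => // _; rewrite ipDl ?IH//; exact: si_sum.
Qed.
Lemma ip_sumr (I : Type) (s : seq I) (P : pred I) (F : I -> E) w :
  (forall i, H (F i)) -> H w ->
  ip w (\sum_(i <- s | P i) F i) = \sum_(i <- s | P i) ip w (F i).
Proof.
move=> HF Hw; rewrite (siC si _ Hw) ?ip_suml// ?rmorph_sum/=; last exact: si_sum.
by apply: eq_bigr => i _; rewrite -(siC si).
Qed.

Lemma sqnE u : H u -> (sqn u)%:C%C = ip u u.
Proof. by move=> Hu; rewrite /sqn RRe_real// ger0_real// si_ge0. Qed.

Lemma sqn_ge0 u : H u -> 0 <= sqn u.
Proof. by move=> Hu; rewrite -lecR sqnE//; exact: si_ge0. Qed.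

Lemma sqnDZ u v (t : R[i]) : H u -> H v ->
  ip (u + t *: v) (u + t *: v) =
  ip u u + `|t| ^+ 2 * ip v v + (t^* * ip u v + (t^* * ip u v)^*).
Proof.
move=> Hu Hv; have Htv := siZ t Hv.
rewrite ipDl ?ipDr//; [|exact: siD].
rewrite !ipZl// !ipZr// rmorphM/= conjCK -(siC si Hu Hv) normCK; ring.
Qed.

(** A discriminant argument: t = - s x with s real turns the hypothesis into a - 2 s |x|^2 + s^2
    |x|^2 c >= 0, and s = 1/c concludes when c > 0. It yields both Cauchy-Schwarz and the
    variational inequality at an almost minimiser. *)
Lemma real_quadratic_bound (x : R[i]) (a c : R) : 0 <= a -> 0 <= c ->
  (forall t : R[i], 0 <= a%:C%C + `|t| ^+ 2 * c%:C%C + (t^* * x + (t^* * x)^*)) ->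
  `|x| ^+ 2 <= (a * c)%:C%C.
Proof.
move=> a0 c0 h.
pose y := complex.Re x ^+ 2 + complex.Im x ^+ 2.
have y0 : 0 <= y by rewrite addr_ge0// sqr_ge0.
have xy : `|x| ^+ 2 = y%:C%C by rewrite add_Re2_Im2.
have hs (s : R) : 0 <= a + s ^+ 2 * y * c - 2 * s * y.
  have := h (- s%:C%C * x).
  rewrite rmorphM/= rmorphN/= [(s%:C%C)^*]conjc_real.
  have -> : - s%:C%C * x^* * x = - (s * y)%:C%C.
    by rewrite rmorphM/= -xy normCK; ring.
  rewrite rmorphN/= [((s * y)%:C%C)^*]conjc_real.
  rewrite normrM normrN exprMn xy.
  have -> : `|s%:C%C| ^+ 2 = (s ^+ 2)%:C%C :> R[i].
    by rewrite normc_def /= expr0n addr0 sqrtr_sqr -rmorphXn /= real_normK// num_real.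
  rewrite -!rmorphM/= -rmorphN -!rmorphD/= lecR; congr (_ <= _); ring.
rewrite xy lecR.
have [c00|c00] := eqVneq c 0.
  rewrite c00 mulr0 leNgt; apply/negP => y1.
  (* When c = 0 this value of s makes the quadratic expression equal to -1. *)
  have := hs ((a + 1) / (2 * y)); rewrite c00 mulr0 addr0.
  have -> : 2 * ((a + 1) / (2 * y)) * y = a + 1 by field; rewrite gt_eqF.
  lra.
have cp : 0 < c by rewrite lt_def c00.
have := hs c^-1.
have -> : c^-1 ^+ 2 * y * c = c^-1 * y by field.
move=> hh; have : 0 <= (a - c^-1 * y) * c.
  apply: mulr_ge0 => //; move: hh; lra.
rewrite mulrBl; have -> : c^-1 * y * c = y by field.
lra.
Qed.

Lemma cauchy_schwarz u v : H u -> H v -> `|ip u v| ^+ 2 <= (sqn u * sqn v)%:C%C.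
Proof.
move=> Hu Hv; apply: real_quadratic_bound; rewrite ?sqn_ge0// => t.
by rewrite !sqnE// -sqnDZ//; apply: si_ge0 => //; apply: siD => //; exact: siZ.
Qed.

Lemma cauchy_schwarz_sqrt u v : H u -> H v ->
  `|ip u v| <= (Num.sqrt (sqn u) * Num.sqrt (sqn v))%:C%C.
Proof.
move=> Hu Hv; rewrite -(@ler_pXn2r _ 2)// ?nnegrE//; last first.
  by rewrite ler0c mulr_ge0 ?sqrtr_ge0.
have -> : (Num.sqrt (sqn u) * Num.sqrt (sqn v))%:C%C ^+ 2 = (sqn u * sqn v)%:C%C.
  by rewrite -[LHS](rmorphXn (real_complex R)) exprMn !sqr_sqrtr ?sqn_ge0.
exact: cauchy_schwarz.
Qed.

Lemma sqnD2 u v : H u -> H v -> sqn (u + v) <= 2 * sqn u + 2 * sqn v.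
Proof.
move=> Hu Hv; have h w : H w -> 0 <= complex.Re (ip w w) by exact: sqn_ge0.
have := h _ (siB Hu Hv); rewrite /sqn.
rewrite !ipBl ?ipBr ?ipDl ?ipDr//; try (by apply: siD); try (by apply: siB).
by rewrite !(raddfD, raddfN) /=; lra.
Qed.

Lemma parallelogram u v : H u -> H v ->
  sqn (u + v) + sqn (u - v) = 2 * sqn u + 2 * sqn v.
Proof.
move=> Hu Hv; rewrite /sqn.
rewrite !ipBl ?ipBr ?ipDl ?ipDr//; try (by apply: siD); try (by apply: siB).
by rewrite !(raddfD, raddfN) /=; lra.
Qed.

Lemma sqnZ a u : H u -> (sqn (a *: u))%:C%C = `|a| ^+ 2 * (sqn u)%:C%C.
Proof.
by move=> Hu; rewrite !sqnE ?ipZl ?ipZr ?normCK ?mulrA//; exact: siZ.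
Qed.

Definition linear_on (phi : E -> R[i]) : Prop :=
  forall a u v, H u -> H v -> phi (a *: u + v) = a * phi u + phi v.

(** Take u_m within eps_m of the infimum of J u = |u|^2 - 2 Re (phi u). The parallelogram identity
    at the midpoint of u_m and u_k bounds their distance; perturbing u_m by t v, for all t, bounds
    the error on phi v. The conclusion stops short of a limit because the lemma is also applied to
    the seminorm |D u|, for which Cauchy sequences may have no limit. *)
Lemma approx_riesz (phi : E -> R[i]) (M : R) (eps : nat -> R) :
  linear_on phi -> 0 <= M -> (forall u, H u -> `|phi u| ^+ 2 <= (M * sqn u)%:C%C) ->
  (forall m, 0 < eps m) ->
  exists u : nat -> E, [/\ forall m, H (u m),
    forall m k, sqn (u m - u k) <= 2 * (eps m + eps k) &
    forall m v, H v -> `|ip v (u m) - phi v| ^+ 2 <= (eps m * sqn v)%:C%C].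
Proof.
move=> lphi M0 phiM eps0.
have phi0 : phi 0 = 0.
  by have := lphi (-1) _ _ (si0 si) (si0 si); rewrite scaler0 addr0 mulN1r addNr.
have phiZ a u : H u -> phi (a *: u) = a * phi u.
  by move=> Hu; rewrite -[a *: u]addr0 lphi ?phi0 ?addr0//; exact: si0.
have phiD u v : H u -> H v -> phi (u + v) = phi u + phi v.
  by move=> Hu Hv; rewrite -{1}[u]scale1r lphi// mul1r.
pose J u := sqn u - 2 * complex.Re (phi u).
(* From |phi u|^2 <= M |u|^2 and 4 M |u|^2 <= (M + |u|^2)^2 one gets 2 Re (phi u) <= M + |u|^2. *)
have Jlb u : H u -> - M <= J u.
  move=> Hu; have h : (complex.Re (phi u)) ^+ 2 <= M * sqn u.
    rewrite -lecR (le_trans _ (phiM u Hu))// -add_Re2_Im2 lecR lerDl sqr_ge0 //.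
  have s0 := sqn_ge0 Hu; rewrite /J.
  suff : 2 * complex.Re (phi u) <= M + sqn u by lra.
  have [r0|r0] := leP (complex.Re (phi u)) 0; first lra.
  rewrite -(@ler_pXn2r _ 2)// ?nnegrE; [|lra|lra].
  have := sqr_ge0 (M - sqn u); nra.
pose A := [set J u | u in H].
have hA : has_inf A.
  split; first by exists (J 0); exists 0 => //; exact: si0.
  by exists (- M) => _ [u Hu <-]; exact: Jlb.
have Jinf u : H u -> inf A <= J u.
  by move=> Hu; apply: ge_inf; [case: hA|exists u].
have ex m : exists u, H u /\ J u < inf A + eps m.
  have [_ [u Hu <-] hu] := inf_adherent (eps0 m) hA.
  by exists u.
have [u hu] := choice ex.
have Hu m : H (u m) by case: (hu m).
have Jm m : J (u m) < inf A + eps m by case: (hu m).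
exists u; split=> // [m k|m v Hv].
  have Hd : H (2^-1 *: (u m + u k)) by apply: siZ; exact: siD.
  have := Jinf _ Hd.
  have s2 : sqn (2^-1 *: (u m + u k)) = 4^-1 * sqn (u m + u k).
    apply: complexI; rewrite sqnZ; last exact: siD.
    rewrite normfV normr_nat rmorphM/= fmorphV/= rmorph_nat.
    by congr (_ * _); field.
  have p2 : complex.Re (phi (2^-1 *: (u m + u k))) =
     2^-1 * (complex.Re (phi (u m)) + complex.Re (phi (u k))).
    rewrite phiZ ?phiD//; last exact: siD.
    have -> : (2^-1 : R[i]) = (2^-1)%:C%C by rewrite fmorphV/= rmorph_nat.
    by case: (phi (u m)) (phi (u k)) => [a b] [c d] /=; rewrite mul0r subr0.
  rewrite /J s2 p2; have := parallelogram (Hu m) (Hu k).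
  have := Jm m; have := Jm k; rewrite /J.
  lra.
rewrite -normrN opprB.
rewrite [_ - _](_ : _ = - ((ip v (u m)) - phi v)); last by rewrite opprB.
rewrite normrN -norm_conjC rmorphB/= -(siC si)//.
apply: real_quadratic_bound; [exact: ltW|exact: sqn_ge0|] => t.
have Htv := siZ t Hv.
have := Jinf _ (siD (Hu m) Htv); rewrite /J phiD// phiZ//.
have := Jm m; rewrite /J => h1 h2.
have hc : `|t| ^+ 2 * (sqn v)%:C%C = (sqn (t *: v))%:C%C by rewrite sqnZ.
have hr : t^* * (ip (u m) v - (phi v)^*) + (t^* * (ip (u m) v - (phi v)^*))^* =
  (2 * complex.Re (t^* * ip (u m) v) - 2 * complex.Re (t * phi v))%:C%C.
  rewrite mulrBr rmorphB/= [(t^* * (phi v)^*)^*]rmorphM/= !conjCK.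
  rewrite addrACA -opprD rmorphB/=; congr (_ - _).
  - by rewrite [LHS]addcJ !rmorphM/= rmorph_nat.
  - have -> : t^* * (phi v)^* = (t * phi v)^* by rewrite rmorphM.
    by rewrite addrC [LHS]addcJ !rmorphM/= rmorph_nat.
have h3 : sqn (u m + t *: v) = sqn (u m) + sqn (t *: v) + 2 * complex.Re (t^* * ip (u m) v).
  apply: complexI; rewrite sqnE; last exact: siD.
  rewrite sqnDZ// [X in _ + X]addcJ !rmorphD/= -hc !sqnE// !rmorphM/= rmorph_nat //.
rewrite hc hr -!rmorphD/= lecR; move: h2; rewrite h3 raddfD/=; lra.
Qed.

End semi_inner_product.

Lemma triangle_sum (V : nmodType) (F : nat -> nat -> V) N :
  \sum_(m < N) \sum_(j < m.+1) F j (m - j)%N =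
  \sum_(j < N) \sum_(i < N - j) F j i.
Proof.
elim: N => [|N IH]; first by rewrite !big_ord0.
rewrite big_ord_recr IH /= [RHS]big_ord_recr /= [in LHS]big_ord_recr /=.
rewrite addrA subnn subSnn; congr (_ + _); last by rewrite big_ord1.
rewrite -big_split /=; apply: eq_bigr => j _.
by rewrite subSn ?(ltnW (ltn_ord j))// big_ord_recr.
Qed.

Lemma big_ord_subr (V : zmodType) (F : nat -> V) (m k : nat) : (k <= m)%N ->
  \sum_(i < m) F i - \sum_(i < k) F i = \sum_(k <= i < m) F i.
Proof.
by move=> km; rewrite -!(big_mkord xpredT) (big_cat_nat (leq0n k) km)/= addrAC subrr add0r.
Qed.

(** * The power series of 1 - sqrt (1 - x), up to x = 1 *)

Section sqrt_coefficients.
Variable R : realType.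

(* Taylor coefficients of 1 - sqrt (1 - x); the recursion says that their
   generating function y solves 2 y = x + y ^ 2. *)
Fixpoint sqrt_coef_seq (m : nat) : seq R :=
  if m is m'.+1 then
    let l := sqrt_coef_seq m' in
    rcons l (((m' == 1)%:R + \sum_(j < m'.+1) l`_j * l`_(m' - j)) / 2)
  else [::].

Definition sqrt_coef m : R := (sqrt_coef_seq m.+1)`_m.

Let size_cs m : size (sqrt_coef_seq m) = m.
Proof. by elim: m => //= m IH; rewrite size_rcons IH. Qed.

Let nth_cs m i : (sqrt_coef_seq m)`_i = if (i < m)%N then sqrt_coef i else 0.
Proof.
elim: m => [|m IH]; first by rewrite nth_nil.
rewrite /sqrt_coef ltnS leq_eqVlt; case: eqVneq => [->//|im] /=.
by rewrite nth_rcons size_cs (negbTE im) IH; case: ltngtP im.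
Qed.

Lemma sqrt_coef0 : sqrt_coef 0 = 0.
Proof. by rewrite /sqrt_coef /= big_ord1 /= mul0r addr0 mul0r. Qed.

Lemma sqrt_coefE m : 2 * sqrt_coef m =
  (m == 1)%:R + \sum_(j < m.+1) sqrt_coef j * sqrt_coef (m - j).
Proof.
rewrite {1}/sqrt_coef /= nth_rcons size_cs ltnn eqxx mulrC divfK//.
congr (_ + _); apply: eq_bigr => j _; rewrite !nth_cs.
case: (ltnP j m) => jm; last first.
  have -> : nat_of_ord j = m by apply/eqP; rewrite eqn_leq jm -ltnS ltn_ord.
  by rewrite subnn sqrt_coef0 mul0r mulr0.
case: (posnP j) => [->|j0]; first by rewrite sqrt_coef0 !mul0r.
by rewrite ltn_subrL j0 (leq_ltn_trans _ jm).
Qed.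

Lemma sqrt_coef_ge0 m : 0 <= sqrt_coef m.
Proof.
elim/ltn_ind: m => m IH.
have [->|m0] := posnP m; first by rewrite sqrt_coef0.
have : 0 <= 2 * sqrt_coef m; last by rewrite pmulr_rge0.
rewrite sqrt_coefE; apply: addr_ge0; first by rewrite ler0n.
apply: sumr_ge0 => j _; have [->|j0] := posnP j; first by rewrite sqrt_coef0 mul0r.
have := ltn_ord j; rewrite ltnS leq_eqVlt => /predU1P[->|jm].
  by rewrite subnn sqrt_coef0 mulr0.
by apply: mulr_ge0; apply: IH => //; rewrite ltn_subrL j0.
Qed.

Definition sqrt_psum N := \sum_(k < N) sqrt_coef k.

Lemma sqrt_psum_mono N M : (N <= M)%N -> sqrt_psum N <= sqrt_psum M.
Proof.
move=> /subnK <-; elim: (M - N)%N => // k IH.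
by rewrite addSn /sqrt_psum big_ord_recr /= (le_trans IH)// lerDl sqrt_coef_ge0.
Qed.

Lemma sqrt_psum_ge0 N : 0 <= sqrt_psum N.
Proof. by apply: sumr_ge0 => k _; exact: sqrt_coef_ge0. Qed.

(** This is 2 y = x + y^2 at x = 1, truncated: the recursion is summed over m < N + 2, a range that
    contains m = 1, so the term x contributes exactly 1. *)
Lemma sqrt_psum_triangle N :
  2 * sqrt_psum N.+2 - 1 =
  \sum_(j < N.+2) \sum_(i < N.+2 - j) sqrt_coef j * sqrt_coef i.
Proof.
rewrite -(triangle_sum (fun j i => sqrt_coef j * sqrt_coef i)).
rewrite /sqrt_psum mulr_sumr (eq_bigr _ (fun i _ => sqrt_coefE (nat_of_ord i))).
rewrite big_split /= [X in X + _ - 1](_ : _ = 1) 1?addrC ?addKr //.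
by rewrite !big_ord_recl big1 ?addr0 ?add0r.
Qed.

(** Because the coefficient of index 0 vanishes, the triangle of side N + 2 contributes at most the
    square of side N + 1. Hence 2 s_(N+2) - 1 <= s_(N+1)^2 <= 1 by induction. *)
Lemma sqrt_psum_le1 N : sqrt_psum N <= 1.
Proof.
elim: N => [|N IH]; first by rewrite /sqrt_psum big_ord0.
case: N IH => [|N] IH; first by rewrite /sqrt_psum big_ord1 sqrt_coef0.
suff : 2 * sqrt_psum N.+2 - 1 <= sqrt_psum N.+1 ^+ 2.
  have := sqrt_psum_ge0 N.+1; nra.
rewrite sqrt_psum_triangle big_ord_recr /= subSnn big_ord1 sqrt_coef0 mulr0 addr0.
rewrite expr2 [leRHS]mulr_suml; apply: ler_sum => -[[|j] /= jN] _.
  by rewrite big1 => [|i _]; rewrite sqrt_coef0 mul0r.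
rewrite -mulr_sumr ler_wpM2l ?sqrt_coef_ge0//.
by apply: (@sqrt_psum_mono (N.+2 - j.+1)); rewrite subSS leq_subr.
Qed.

(** The square of side N fits inside the triangle of side 2 N + 2. *)
Lemma sqrt_psum_double N : sqrt_psum N ^+ 2 <= 2 * sqrt_psum (N + N).+2 - 1.
Proof.
rewrite sqrt_psum_triangle expr2.
apply: (@le_trans _ _ (\sum_(j < N) \sum_(i < (N + N).+2 - j) sqrt_coef j * sqrt_coef i)).
  rewrite [leLHS]mulr_suml; apply: ler_sum => j _; rewrite -mulr_sumr ler_wpM2l ?sqrt_coef_ge0//.
  apply: (@sqrt_psum_mono _ ((N + N).+2 - j)).
  by have := ltn_ord j; lia.
rewrite -!(big_mkord xpredT (fun j => \sum_(i < (N + N).+2 - j) sqrt_coef j * sqrt_coef i)).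
rewrite (@big_cat_nat _ _ _ N 0 (N + N).+2)//=; last by lia.
rewrite lerDl; apply: sumr_ge0 => j _; apply: sumr_ge0 => i _.
by apply: mulr_ge0; exact: sqrt_coef_ge0.
Qed.

(** The limit s exists by monotonicity, and [sqrt_psum_double] gives s^2 <= 2 s - 1 in the limit, so
    (s - 1)^2 <= 0. That the coefficients sum to 1 makes 1 - s_N the error bound for the operator
    series. *)
Lemma cvg_sqrt_psum : sqrt_psum @ \oo --> (1 : R).
Proof.
have mono : {homo sqrt_psum : n m / (n <= m)%N >-> n <= m} by move=> n m; exact: sqrt_psum_mono.
have cs : cvgn sqrt_psum.
  apply: nondecreasing_is_cvgn => //; exists 1 => _ [n _ <-]; exact: sqrt_psum_le1.
have /cvg_ex[s hs] := cs.
suff -> : 1 = s by [].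
have sub : (fun N => sqrt_psum (N + N).+2) @ \oo --> s.
  apply: (cvg_comp _ sqrt_psum _ hs).
  move=> P [n _ nP]; exists n => // k /= nk; apply: nP => /=.
  by move: nk; lia.
have h : s ^+ 2 <= 2 * s - 1.
  apply: (@ler_cvg_to _ _ eventually_filter _ (fun N => sqrt_psum N ^+ 2) (fun N => 2 * sqrt_psum (N + N).+2 - 1) (s ^+ 2) (2 * s - 1)).
  - exact: (cvgM hs hs).
  - by apply: cvgB; [apply: cvgM; [exact: cvg_cst|exact: sub]|exact: cvg_cst].
  - by apply: nearW => N; exact: sqrt_psum_double.
have : (s - 1) ^+ 2 <= 0 by lra.
by rewrite real_exprn_even_le0 ?num_real//= subr_eq0 => /eqP ->.
Qed.

End sqrt_coefficients.

(** * The Riesz representation theorem and ranges of square roots *)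

Section riesz.
Context {R : realType} {E : lmodType R[i]} (H : set E) (ip : E -> E -> R[i]).
Hypothesis si : semi_inner H ip.
Local Notation sqn := (sqn ip).

Lemma adjoint_spec (A : E -> E) h :
  (exists2 g, H g & forall u, H u -> ip (A u) h = ip u g) ->
  H (adjoint H ip A h) /\ forall u, H u -> ip (A u) h = ip u (adjoint H ip A h).
Proof.
move=> [g Hg hg].
by apply: (@xgetPex _ 0 [set g | H g /\ forall u, H u -> ip (A u) h = ip u g]); exists g.
Qed.

(* Completeness, up to vectors of norm zero; rapidly converging sequences suffice. *)
Definition fast_complete : Prop := forall u : nat -> E,
  (forall m, H (u m)) -> (forall m, sqn (u m.+1 - u m) <= 4^-1 ^+ m) ->
  exists2 g, H g & (fun m => sqn (g - u m)) @ \oo --> (0 : R).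

Definition representable : Prop := forall (phi : E -> R[i]) (M : R),
  linear_on H phi -> 0 <= M -> (forall u, H u -> `|phi u| ^+ 2 <= (M * sqn u)%:C%C) ->
  exists2 g, H g & forall v, H v -> phi v = ip v g.

Lemma cvg_geo4 : (fun m => 4^-1 ^+ m) @ \oo --> (0 : R).
Proof. by apply: cvg_expr; rewrite ger0_norm ?invr_ge0//; lra. Qed.

Lemma eq_of_sq_cvg0 (x y : R[i]) (b : nat -> R) : (forall m, `|x - y| ^+ 2 <= (b m)%:C%C) ->
  b @ \oo --> (0 : R) -> x = y.
Proof.
move=> h b0; apply/eqP; rewrite -subr_eq0 -normr_eq0 -sqrf_eq0; apply/eqP.
rewrite -add_Re2_Im2 in h *; congr (_%:C)%C.
apply/eqP; rewrite eq_le addr_ge0 ?sqr_ge0// andbT.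
apply: (@ler_cvg_to _ _ eventually_filter _ (cst _) b _ 0 (cvg_cst _) b0).
by apply: nearW => m; rewrite -lecR.
Qed.

Lemma riesz : fast_complete -> representable.
Proof.
move=> cpl phi M lphi M0 phiM.
(* With this factor 2 (eps_(m+1) + eps_m) = (5/16) 4^-m, within the rate required by
   [fast_complete]. *)
pose eps m : R := 8^-1 * 4^-1 ^+ m.
have eps0 m : 0 < eps m by rewrite /eps mulr_gt0 ?exprn_gt0 ?invr_gt0.
have [u [Hu Cu pu]] := approx_riesz si lphi M0 phiM eps0.
have [|g Hg gu] := cpl u Hu.
  move=> m; apply: (le_trans (Cu _ _)); rewrite /eps exprS.
  have : 0 <= 4^-1 ^+ m :> R by rewrite exprn_ge0// invr_ge0.
  lra.
exists g => // v Hv.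
apply: (@eq_of_sq_cvg0 _ _ (fun m => 2 * sqn v * sqn (g - u m) + 2 * sqn v * 8^-1 * 4^-1 ^+ m)).
  move=> m.
  have -> : phi v - ip v g = - (ip v (g - u m) + (ip v (u m) - phi v)).
    by rewrite (ipBr si)//; ring.
  rewrite normrN (le_trans (norm_sqrD2 _ _))// rmorphD/= lerD//.
    by rewrite -mulrA rmorphM/= rmorph_nat ler_pM2l// (cauchy_schwarz si)//; exact: (siB si).
  by rewrite -!mulrA rmorphM/= rmorph_nat ler_pM2l// mulrC (le_trans (pu m v Hv))//.
rewrite -(addr0 0); apply: cvgD.
  by rewrite -(mulr0 (2 * sqn v)); apply: cvgM; [exact: cvg_cst|exact: gu].
by rewrite -(mulr0 (2 * sqn v * 8^-1)); apply: cvgM; [exact: cvg_cst|exact: cvg_geo4].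
Qed.

Lemma semi_inner_comp (D : E -> E) :
  (forall u, H u -> H (D u)) ->
  (forall (a : R[i]) u v, H u -> H v -> D (a *: u + v) = a *: D u + D v) ->
  semi_inner H (fun u v => ip (D u) (D v)).
Proof.
move=> HD lD; split.
- exact: si0 si.
- by move=> a u v; exact: (siP si).
- by move=> a u v w Hu Hv Hw; rewrite lD// (siPl si)//; exact: HD.
- by move=> u v Hu Hv; apply: (siC si); exact: HD.
- by move=> u Hu; apply: (si_ge0 si); exact: HD.
Qed.

(** As (B u, u) = |D u|^2, the functional u -> (u, h) is bounded for the seminorm |D u|. Its
    approximate representers u_m may diverge, but the vectors D u_m are Cauchy for [ip] itself and
    converge to some w; then (v, h) = (D v, w) = (v, D w) for all v, and definiteness gives D w =
    h. *)
Lemma psqrt_range (B D : E -> E) h (c : R) :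
  fast_complete -> (forall u, H u -> sqn u = 0 -> u = 0) ->
  is_psqrt H ip B D -> H h -> 0 <= c ->
  (forall u, H u -> `|ip u h| ^+ 2 <= (c * complex.Re (ip (B u) u))%:C%C) ->
  exists2 w, H w & D w = h.
Proof.
move=> cpl def [HD lD sD _ DB] Hh c0 hB.
have si' := semi_inner_comp HD lD.
have lphi : linear_on H (ip ^~ h) by move=> a u v Hu Hv; rewrite (siPl si).
pose eps m : R := 8^-1 * 4^-1 ^+ m.
have eps0 m : 0 < eps m by rewrite /eps mulr_gt0 ?exprn_gt0 ?invr_gt0.
have [|u [Hu Cu pu]] := approx_riesz si' lphi c0 _ eps0.
  by move=> u Hu; rewrite !sqn_def -sD ?DB ?hB//; exact: HD.
have DBx x y : H x -> H y -> D (x - y) = D x - D y.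
  by move=> Hx Hy; rewrite addrC -scaleN1r lD// scaleN1r addrC.
have [m|m|w Hw wu] := cpl (D \o u); first exact: HD.
  have := Cu m.+1 m; rewrite !sqn_def DBx// => /le_trans; apply.
  rewrite /eps exprS; have : 0 <= 4^-1 ^+ m :> R by rewrite exprn_ge0// invr_ge0.
  lra.
have ipw v : H v -> ip v h = ip v (D w).
  move=> Hv; rewrite -sD//.
  apply: (@eq_of_sq_cvg0 _ _ (fun m => 2 * sqn (D v) * sqn (w - D (u m)) + 2 * sqn (D v) * 8^-1 * 4^-1 ^+ m)).
    move=> m.
    have -> : ip v h - ip (D v) w = - (ip (D v) (w - D (u m)) + (ip (D v) (D (u m)) - ip v h)).
      by rewrite (ipBr si)//; [ring|exact: HD|exact: HD].
    rewrite normrN (le_trans (norm_sqrD2 _ _))// rmorphD/= lerD//.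
      rewrite -mulrA rmorphM/= rmorph_nat ler_pM2l// (cauchy_schwarz si)//; first exact: HD.
      by apply: (siB si) => //; exact: HD.
    by rewrite -!mulrA rmorphM/= rmorph_nat ler_pM2l// mulrC (le_trans (pu m v Hv)).
  rewrite -(addr0 0); apply: cvgD.
    by rewrite -(mulr0 (2 * sqn (D v))); apply: cvgM; [exact: cvg_cst|exact: wu].
  by rewrite -(mulr0 (2 * sqn (D v) * 8^-1)); apply: cvgM; [exact: cvg_cst|exact: cvg_geo4].
exists w => //; apply/eqP; rewrite -subr_eq0; apply/eqP.
have HDw := HD _ Hw.
have Hd : H (D w - h) by exact: (siB si).
by apply: def => //; rewrite !sqn_def (ipBr si)// -ipw// subrr.
Qed.

End riesz.

(** * The square root of 1 - K for a symmetric contraction K *)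

Section positive_square_root.
Context {R : realType} {E : lmodType R[i]} (H : set E) (ip : E -> E -> R[i]).
Hypothesis si : semi_inner H ip.
Local Notation sqn := (sqn ip).
Local Notation nrm u := (Num.sqrt (sqn u)).
Hypothesis definite : forall u, H u -> sqn u = 0 -> u = 0.
Hypothesis rep : representable H ip.
Variable K : E -> E.
Hypothesis HK : forall u, H u -> H (K u).
Hypothesis lK : forall (a : R[i]) u v, H u -> H v -> K (a *: u + v) = a *: K u + K v.
Hypothesis sK : forall u v, H u -> H v -> ip (K u) v = ip u (K v).
Hypothesis cK : forall u, H u -> sqn (K u) <= sqn u.

Local Notation c := (@sqrt_coef R).
Local Notation s := (@sqrt_psum R).
Local Notation Kn k u := (iter k K u).

Let HKn k u : H u -> H (Kn k u).
Proof. by move=> Hu; elim: k => //= k IH; exact: HK. Qed.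

Let lKn k (a : R[i]) u v : H u -> H v -> Kn k (a *: u + v) = a *: Kn k u + Kn k v.
Proof. by move=> Hu Hv; elim: k => //= k ->; rewrite lK//; exact: HKn. Qed.

Let sKn k u v : H u -> H v -> ip (Kn k u) v = ip u (Kn k v).
Proof.
move=> Hu Hv; elim: k v Hv => //= k IH v Hv.
by rewrite sK// ?IH -?iterSr//; [exact: HK|exact: HKn].
Qed.

Let cKn k u : H u -> nrm (Kn k u) <= nrm u.
Proof.
move=> Hu; elim: k => //= k IH; apply: (le_trans _ IH).
by rewrite ler_wsqrtr// cK//; exact: HKn.
Qed.

Lemma in_ip_inj x y : H x -> H y -> (forall v, H v -> ip v x = ip v y) -> x = y.
Proof.
move=> Hx Hy h; apply/eqP; rewrite -subr_eq0; apply/eqP; apply: definite.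
  exact: (siB si).
by rewrite !sqn_def (ipBr si)// ?h ?subrr//; exact: (siB si).
Qed.

(** Partial sums of Y = sum_k c_k K^k, the operator version of 1 - sqrt (1 - x); the root will be 1
    - Y. *)
Let YN N u := \sum_(k < N) (c k)%:C%C *: Kn k u.

Let HYN N u : H u -> H (YN N u).
Proof. by move=> Hu; apply: (si_sum si) => k; apply: (siZ si); exact: HKn. Qed.

Let ip_YN N u v : H u -> H v ->
  ip v (YN N u) = series (fun k => (c k)%:C%C * ip v (Kn k u)) N.
Proof.
move=> Hu Hv; rewrite (ip_sumr si)//; last by move=> k; apply: (siZ si); exact: HKn.
rewrite /series /= big_mkord; apply: eq_bigr => k _.
by rewrite (ipZr si)//; [rewrite [X in X * _]conjc_real|exact: HKn].
Qed.

Let term_le k u v : H u -> H v ->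
  `|(c k)%:C%C * ip v (Kn k u)| <= (c k * (nrm v * nrm u))%:C%C.
Proof.
move=> Hu Hv; rewrite normrM ger0_norm ?ler0c ?sqrt_coef_ge0// rmorphM/=.
rewrite ler_wpM2l ?ler0c ?sqrt_coef_ge0//.
rewrite (le_trans (cauchy_schwarz_sqrt si _ _))//; first exact: HKn.
by rewrite lecR ler_wpM2l// cKn.
Qed.

Let bound_cvg (x : R) : series (fun k => c k * x) @ \oo --> (x : R).
Proof.
rewrite (_ : series _ = fun N => s N * x); last first.
  by apply/funext => N; rewrite /series /= big_mkord -mulr_suml.
by rewrite -[X in _ --> X]mul1r; apply: cvgM; [exact: cvg_sqrt_psum|exact: cvg_cst].
Qed.

Let phi u v : R[i] := limn (series (fun k => (c k)%:C%C * ip v (Kn k u))).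

Let phi_cvg u v : H u -> H v -> (fun N => ip v (YN N u)) @ \oo --> phi u v.
Proof.
move=> Hu Hv; rewrite (_ : (fun _ => _) = series (fun k => (c k)%:C%C * ip v (Kn k u))).
  apply: (series_abs_cvg (fun k => term_le k Hu Hv)).
  by apply/cvg_ex; eexists; exact: (@bound_cvg _).
by apply/funext => N; exact: ip_YN.
Qed.

(** The powers of K are contractions and the coefficients are nonnegative with sum 1, so what
    remains after N terms has total weight 1 - s_N. For N = 0, where s_0 = 0, this is the
    boundedness of [phi u]. *)
Let phi_tail N u v : H u -> H v ->
  `|phi u v - ip v (YN N u)| <= ((1 - s N) * (nrm v * nrm u))%:C%C.
Proof.
move=> Hu Hv; rewrite ip_YN//.
have sE : (fun M => ip v (YN M u)) = series (fun k => (c k)%:C%C * ip v (Kn k u)).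
  by apply/funext => M; exact: ip_YN.
have h := phi_cvg Hu Hv; rewrite sE in h.
apply: le_trans (series_tail_le (fun k => term_le k Hu Hv) h (@bound_cvg (nrm v * nrm u)) N) _.
by rewrite lecR /series /= big_mkord -mulr_suml mulrBl mul1r.
Qed.

(** The premise [H u] stands under the existential so that [choice] returns one operator on all of
    [E]. *)
Let Yex u : exists g, H u -> H g /\ forall v, H v -> phi u v = ip v g.
Proof.
have [Hu|nHu] := pselect (H u); last by exists 0 => /nHu.
have [||v Hv|g Hg hg] := @rep (phi u) (sqn u).
- move=> a v w Hv Hw.
  apply: (cvg_complex_uniq (phi_cvg Hu (siP si a Hv Hw))).
  rewrite (_ : (fun _ => _) = fun N => a * ip v (YN N u) + ip w (YN N u)).
    by apply: cvgD; [apply: cvgM; [exact: cvg_cst|exact: phi_cvg]|exact: phi_cvg].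
  by apply/funext => N; rewrite (siPl si)//; exact: HYN.
- exact: (sqn_ge0 si).
- have := phi_tail 0 Hu Hv.
  rewrite {1}/YN /sqrt_psum !big_ord0 subr0 mul1r (ip0r si)// subr0 => h.
  rewrite (@le_trans _ _ ((nrm v * nrm u)%:C%C ^+ 2))//.
    by rewrite ler_pXn2r// nnegrE (le_trans _ h).
  by rewrite -[leLHS](rmorphXn (real_complex R)) exprMn !sqr_sqrtr ?(sqn_ge0 si)// mulrC.
- by exists g.
Qed.

(** For D = 1 - Y, the equation D^2 = 1 - K amounts to Y^2 = 2 Y - K, the equation of the generating
    function of the coefficients. It is verified weakly, by comparing a sum over a square of indices
    with the sum over the triangle below its antidiagonal. *)
Lemma exists_psqrt : exists D, is_psqrt H ip (fun u => u - K u) D.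
Proof.
have [Y hY] := choice Yex.
have HY u : H u -> H (Y u) by move=> /hY[].
have Ytail N u v : H u -> H v ->
    `|ip v (Y u) - ip v (YN N u)| <= ((1 - s N) * (nrm v * nrm u))%:C%C.
  by move=> Hu Hv; have [_ /(_ v Hv) <-] := hY u Hu; exact: phi_tail.
have s1 N : 0 <= 1 - s N by rewrite subr_ge0 sqrt_psum_le1.
have tail0 (x : R) : (fun N => (1 - s N) * x) @ \oo --> (0 : R).
  rewrite -[X in _ --> X](mul0r x) -[X in X * _](subrr (1 : R)).
  by apply: cvgM; [apply: cvgB; [exact: cvg_cst|exact: cvg_sqrt_psum]|exact: cvg_cst].
have Ycvg u v : H u -> H v -> (fun N => ip v (YN N u)) @ \oo --> ip v (Y u).
  move=> Hu Hv; apply: (complex_squeeze _ (tail0 (nrm v * nrm u))).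
  by apply: nearW => N; rewrite distrC; exact: Ytail.
have Ycvg' u v : H u -> H v -> (fun N => ip (YN N u) v) @ \oo --> ip (Y u) v.
  move=> Hu Hv; apply: (complex_squeeze _ (tail0 (nrm v * nrm u))).
  apply: nearW => N; rewrite distrC -norm_conjC rmorphB/= -!(siC si)//; [exact: Ytail|exact: HYN|exact: HY].
have sYN N u v : H u -> H v -> ip (YN N u) v = ip u (YN N v).
  move=> Hu Hv; rewrite (ip_suml si)//; last by move=> k; apply: (siZ si); exact: HKn.
  rewrite (ip_sumr si)//; last by move=> k; apply: (siZ si); exact: HKn.
  apply: eq_bigr => k _; rewrite (ipZl si)// ?(ipZr si)// ?[X in _ = X * _]conjc_real ?sKn//; exact: HKn.
have sY u v : H u -> H v -> ip (Y u) v = ip u (Y v).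
  move=> Hu Hv; apply: (cvg_complex_uniq (Ycvg' _ _ Hu Hv)).
  have -> : (fun N => ip (YN N u) v) = fun N => ip u (YN N v) by apply/funext => N; exact: sYN.
  exact: Ycvg.
have lY (a : R[i]) u v : H u -> H v -> Y (a *: u + v) = a *: Y u + Y v.
  move=> Hu Hv; have Huv := siP si a Hu Hv; apply: in_ip_inj.
  - exact: HY.
  - by apply: (siP si); exact: HY.
  - move=> w Hw; have HYu := HY _ Hu; have HYv := HY _ Hv; have HYw := HY _ Hw.
    rewrite -sY// (ipDr si (siZ si a Hu) Hv HYw) (ipZr si a Hu HYw).
    by rewrite (ipDr si (siZ si a HYu) HYv Hw) (ipZr si a HYu Hw) !sY.
have HD u : H u -> H (u - Y u) by move=> Hu; apply: (siB si) => //; exact: HY.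
exists (fun u => u - Y u); split => //.
- by move=> a u v Hu Hv; rewrite lY// scalerBr opprD addrACA.
- by move=> u v Hu Hv; rewrite (ipBl si)// ?(ipBr si)// ?sY//; exact: HY.
- move=> u Hu; have HYu := HY u Hu.
  have r : ip (u - Y u) u = (complex.Re (ip (u - Y u) u))%:C%C.
    rewrite RRe_real// CrealE -(siC si)//; last exact: HD.
    by rewrite (ipBl si)// (ipBr si)// sY.
  rewrite r ler0c (ipBl si)// raddfB/= subr_ge0.
  (* The estimate without any term reads |(u, Y u)| <= |u|^2, which is the positivity of 1 - Y. *)
  have := Ytail 0 u u Hu Hu; rewrite {1}/YN /sqrt_psum !big_ord0 subr0 mul1r (ip0r si)// subr0 -sY//.
  rewrite -expr2 sqr_sqrtr ?(sqn_ge0 si)// => h.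
  by rewrite -lecR (le_trans _ h)// (le_trans _ (normc_ge_Re _))// lecR ler_norm.
- move=> u Hu; have HYu := HY u Hu; have HYYu := HY _ HYu.
  have YB : Y (u - Y u) = Y u - Y (Y u) by rewrite addrC -scaleN1r lY// scaleN1r addrC.
  rewrite YB; suff -> : Y (Y u) = 2%:R *: Y u - K u.
    by rewrite scaler_nat mulr2n opprB !addrA subrK addrAC addrK.
  have H2 : H (2%:R *: Y u) := siZ si _ HYu.
  apply: in_ip_inj => // [|v Hv]; first by apply: (siB si) => //; exact: HK.
  rewrite -sY// (ipBr si)//; last exact: HK.
  rewrite (ipZr si)// conjC_nat.
  pose S := nrm v * nrm u.
  have S0 : 0 <= S by rewrite mulr_ge0 ?sqrtr_ge0.
  have HYv := HY v Hv.
  pose t m := ip v (Kn m u).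
  have tS m : `|t m| <= S%:C%C.
    rewrite (le_trans (cauchy_schwarz_sqrt si _ _))//; first exact: HKn.
    by rewrite lecR ler_wpM2l// cKn.
  (* By symmetry of K this is the sum of c_k c_j (v, K^(k+j) u) over the whole square k, j < N. *)
  pose G N := ip (YN N v) (YN N u).
  have GE N : G N = \sum_(k < N) \sum_(j < N) (c k * c j)%:C%C * t (k + j)%N.
    rewrite /G (ip_suml si)//; [|by move=> k; apply: (siZ si); exact: HKn|exact: HYN].
    apply: eq_bigr => k _; rewrite (ipZl si)//; [|exact: HKn|exact: HYN].
    rewrite sKn//; last exact: HYN.
    rewrite [Kn k _](_ : _ = \sum_(j < N) (c j)%:C%C *: Kn (k + j) u); last first.
      rewrite /YN; move: (nat_of_ord k) => {}k; elim: N => [|N IH].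
        rewrite !big_ord0; have := lKn k 1 (si0 si) (si0 si).
        by rewrite !scaler0 addr0 scale1r => /eqP; rewrite -subr_eq subrr => /eqP.
      rewrite !big_ord_recr /= addrC lKn//; [by rewrite IH addrC iterD|exact: HKn|].
      by apply: (si_sum si) => j; apply: (siZ si); exact: HKn.
    rewrite (ip_sumr si)//; last by move=> j; apply: (siZ si); exact: HKn.
    rewrite mulr_sumr; apply: eq_bigr => j _; rewrite (ipZr si)//; last exact: HKn.
    by rewrite [X in _ * (X * _)]conjc_real mulrA rmorphM.
  have GY : G @ \oo --> ip (Y v) (Y u).
    apply: (complex_squeeze _ (tail0 (nrm (Y u) * nrm v + nrm v * nrm u))).
    apply: nearW => N; rewrite distrC.
    have -> : ip (Y v) (Y u) - G N = (ip (Y v) (Y u) - ip (YN N v) (Y u)) + (ip (YN N v) (Y u) - G N) by ring.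
    rewrite (le_trans (ler_normD _ _))// mulrDr rmorphD/= lerD//.
      rewrite -norm_conjC rmorphB/= -!(siC si)//; [exact: Ytail|exact: HYN].
    rewrite /G -(ipBr si)//; [|exact: HYN|exact: HYN].
    have Hd : H (Y u - YN N u) by apply: (siB si) => //; exact: HYN.
    rewrite (ip_suml si)//; last by move=> k; apply: (siZ si); exact: HKn.
    rewrite (le_trans (ler_norm_sum _ _ _))//.
    rewrite (@le_trans _ _ (\sum_(k < N) (c k * ((1 - s N) * S))%:C%C))//.
      apply: ler_sum => k _; rewrite (ipZl si)//; last exact: HKn.
      rewrite normrM ger0_norm ?ler0c ?sqrt_coef_ge0// rmorphM/=.
      rewrite ler_wpM2l ?ler0c ?sqrt_coef_ge0//.
      rewrite (ipBr si)//; [|exact: HYN|exact: HKn].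
      rewrite (le_trans (Ytail N u _ Hu (HKn k Hv)))// lecR ler_wpM2l//.
      by rewrite ler_wpM2r ?sqrtr_ge0// cKn.
    rewrite -rmorph_sum/= lecR -mulr_suml ler_piMl ?sqrt_psum_le1//.
    exact: mulr_ge0.
  apply: (cvg_complex_uniq GY).
  (* By the recursion this is the same sum restricted to the triangle j + i < N, once N >= 2. *)
  pose X N := 2 * ip v (YN N u) - ip v (K u).
  have XY : X @ \oo --> 2 * ip v (Y u) - ip v (K u).
    by apply: cvgB; [apply: cvgM; [exact: cvg_cst|exact: Ycvg]|exact: cvg_cst].
  have XE N : X N.+2 = \sum_(j < N.+2) \sum_(i < N.+2 - j) (c j * c i)%:C%C * t (j + i)%N.
    rewrite -(triangle_sum (fun j i => (c j * c i)%:C%C * t (j + i)%N)).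
    rewrite [RHS](_ : _ = \sum_(m < N.+2) (2 * c m - (m == 1)%:R)%:C%C * t m); last first.
      apply: eq_bigr => m _; rewrite sqrt_coefE [_ + \sum_(_ < _) _]addrC addrK rmorph_sum/= mulr_suml.
      by apply: eq_bigr => j _; rewrite subnKC// -ltnS.
    rewrite /X ip_YN// /series /= big_mkord.
    rewrite mulr_sumr [RHS](eq_bigr (fun m : 'I_N.+2 => 2 * ((c m)%:C%C * t m) - (nat_of_ord m == 1)%:R%:C%C * t m)); last first.
      by move=> m _; rewrite rmorphB/= rmorphM/= rmorph_nat mulrBl mulrA.
    rewrite sumrB; congr (_ - _).
    rewrite !big_ord_recl big1 => [|i _]; last by rewrite /= mul0r.
    by rewrite /= mul0r add0r addr0 mul1r.
  (* The coefficients in the square but outside the triangle sum to s_N^2 - (2 s_N - 1) = (1 -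
     s_N)^2, which is at most 1 - s_N. *)
  have XG : (fun N => G N - X N) @ \oo --> (0 : R[i]).
    apply: (complex_squeeze _ (tail0 S)).
    exists 2 => // -[|[|N]] // _; rewrite subr0 GE XE -sumrB.
    rewrite (le_trans (ler_norm_sum _ _ _))//.
    rewrite (@le_trans _ _ (\sum_(j < N.+2) (S * \sum_(N.+2 - j <= i < N.+2) c j * c i)%:C%C))//.
      apply: ler_sum => j _; rewrite (big_ord_subr (fun i => (c j * c i)%:C%C * t (j + i)%N)) ?leq_subr//.
      rewrite (le_trans (ler_norm_sum _ _ _))// mulr_sumr rmorph_sum/=; apply: ler_sum => i _.
      rewrite normrM ger0_norm ?ler0c ?mulr_ge0 ?sqrt_coef_ge0// [S * _]mulrC [in leRHS]rmorphM/=.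
      by rewrite ler_wpM2l// ler0c mulr_ge0 ?sqrt_coef_ge0.
    rewrite -rmorph_sum/= lecR -mulr_sumr mulrC ler_wpM2r//.
    rewrite (eq_bigr (fun j : 'I_N.+2 => c j * s N.+2 - \sum_(i < N.+2 - j) c j * c i)); last first.
      move=> j _; rewrite -(big_ord_subr (fun i => c j * c i)) ?leq_subr//; congr (_ - _).
      by rewrite /s mulr_sumr.
    rewrite sumrB -mulr_suml -sqrt_psum_triangle -/(s N.+2).
    have := s1 N.+2; have := sqrt_psum_ge0 R N.+2; nra.
  rewrite -[X in _ --> X]addr0 -[X in X @ _](_ : (fun N => X N + (G N - X N)) = G); last first.
    by apply/funext => N; ring.
  exact: (cvgD XY XG).
Qed.

End positive_square_root.

(** * Adjoints of contractions and defect operators *)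

Section adjoint_of_contraction.
Context {R : realType} {E : lmodType R[i]} (H : set E) (ip : E -> E -> R[i]).
Hypothesis si : semi_inner H ip.
Local Notation sqn := (sqn ip).

(** Iterates |a + b|^2 <= 2 |a|^2 + 2 |b|^2, each further step costing a factor 2; hence the weights
    2^i. Keeping the increments general lets the bound be applied pointwise on the circle as well,
    where only their weighted sum is controlled. *)
Lemma sqn_telescope (u : nat -> E) (m l : nat) : (forall k, H (u k)) -> (m <= l)%N ->
  sqn (u l - u m) <= 2 * 2^-1 ^+ m * \sum_(m <= i < l) 2 ^+ i * sqn (u i.+1 - u i).
Proof.
move=> Hu /subnK <-; move: (l - m)%N => k.
elim: k m => [|k IH] m.
  by rewrite add0n subrr !sqn_def (ip0l si (si0 si)) big_geq// mulr0.
have Hd i j : H (u i - u j) by exact: (siB si).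
rewrite addSnnS; have -> : u (k + m.+1)%N - u m = (u m.+1 - u m) + (u (k + m.+1)%N - u m.+1).
  by rewrite [RHS]addrC addrA subrK.
apply: (le_trans (sqnD2 si (Hd _ _) (Hd _ _))).
rewrite big_ltn; last by lia.
have := IH m.+1; set S := (\sum_(_ <= i < _) _); rewrite exprS => h.
have e : 2^-1 ^+ m * 2 ^+ m = 1 :> R by rewrite -exprMn mulVf// expr1n.
have -> : 2 * 2^-1 ^+ m * (2 ^+ m * sqn (u m.+1 - u m) + S) =
    2 * (2^-1 ^+ m * 2 ^+ m) * sqn (u m.+1 - u m) + 2 * 2^-1 ^+ m * S by ring.
rewrite e mulr1 lerD2l; move: h; lra.
Qed.

Lemma sqn_telescope4 (u : nat -> E) (m l : nat) : (forall k, H (u k)) -> (m <= l)%N ->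
  (forall k, sqn (u k.+1 - u k) <= 4^-1 ^+ k) -> sqn (u l - u m) <= 4 * 4^-1 ^+ m.
Proof.
move=> Hu ml h; apply: (le_trans (sqn_telescope Hu ml)).
have e4 k : 4^-1 ^+ k = 2^-1 ^+ k * 2^-1 ^+ k :> R.
  by rewrite -exprMn; congr (_ ^+ _); field.
have e2 k : 2 ^+ k * 2^-1 ^+ k = 1 :> R by rewrite -exprMn mulfV// expr1n.
have h2 k : 0 <= 2^-1 ^+ k :> R by rewrite exprn_ge0// invr_ge0.
rewrite e4; suff : \sum_(m <= i < l) 2 ^+ i * sqn (u i.+1 - u i) <= 2 * 2^-1 ^+ m.
  by move=> hs; have := ler_wpM2l (h2 m) hs; lra.
apply: (@le_trans _ _ (\sum_(m <= i < l) 2^-1 ^+ i)).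
  apply: ler_sum => i _; have -> : 2^-1 ^+ i = 2 ^+ i * 4^-1 ^+ i :> R by rewrite e4 mulrA e2 mul1r.
  by rewrite ler_wpM2l// exprn_ge0.
rewrite -(subnK ml); move: (l - m)%N => k.
suff : \sum_(m <= i < k + m) 2^-1 ^+ i <= 2 * 2^-1 ^+ m - 2 * 2^-1 ^+ (k + m) :> R.
  by have := h2 (k + m)%N; lra.
elim: k => [|k IH]; first by rewrite big_geq// subrr.
by rewrite addSn big_nat_recr ?leq_addl//= exprS; move: IH; lra.
Qed.

Hypothesis definite : forall u, H u -> sqn u = 0 -> u = 0.
Hypothesis rep : representable H ip.
Variable T : E -> E.
Hypothesis HT : forall u, H u -> H (T u).
Hypothesis lT : forall (a : R[i]) u v, H u -> H v -> T (a *: u + v) = a *: T u + T v.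
Hypothesis cT : forall u, H u -> sqn (T u) <= sqn u.
Local Notation T' := (adjoint H ip T).

Lemma adjoint_contraction_spec h : H h ->
  H (T' h) /\ forall u, H u -> ip (T u) h = ip u (T' h).
Proof.
move=> Hh; apply: adjoint_spec.
have [||u Hu|g Hg hg] := @rep (fun u => ip (T u) h) (sqn h).
- by move=> a u v Hu Hv; rewrite lT// (siPl si)//; exact: HT.
- exact: (sqn_ge0 si).
- rewrite (le_trans (cauchy_schwarz si (HT Hu) Hh))// lecR mulrC ler_wpM2l//.
    exact: (sqn_ge0 si).
  exact: cT.
- by exists g.
Qed.

Lemma in_adjoint h : H h -> H (T' h).
Proof. by move=> /adjoint_contraction_spec[]. Qed.

Lemma adjointE u h : H u -> H h -> ip (T u) h = ip u (T' h).
Proof. by move=> Hu /adjoint_contraction_spec[_]; apply. Qed.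

Lemma adjointEr u h : H u -> H h -> ip h (T u) = ip (T' h) u.
Proof.
move=> Hu Hh; rewrite (siC si (HT Hu) Hh) adjointE// -(siC si)//; exact: in_adjoint.
Qed.

Lemma adjoint_linear (a : R[i]) u v : H u -> H v -> T' (a *: u + v) = a *: T' u + T' v.
Proof.
move=> Hu Hv; have Huv := siP si a Hu Hv.
apply: (in_ip_inj si definite); first exact: in_adjoint.
  by apply: (siP si); exact: in_adjoint.
move=> w Hw; have HTw := HT Hw; rewrite -adjointE//.
rewrite (ipDr si (siZ si a Hu) Hv HTw) (ipZr si a Hu HTw).
have Hu' := in_adjoint Hu; have Hv' := in_adjoint Hv.
by rewrite (ipDr si (siZ si a Hu') Hv' Hw) (ipZr si a Hu' Hw) !adjointE.
Qed.

(** Cauchy-Schwarz on (T T' h, h) = |T' h|^2 gives |T' h|^4 <= |T' h|^2 |h|^2. *)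
Lemma adjoint_contraction h : H h -> sqn (T' h) <= sqn h.
Proof.
move=> Hh; have Hh' := in_adjoint Hh.
have s0 := sqn_ge0 si Hh'; have [->|sn0] := eqVneq (sqn (T' h)) 0; first exact: (sqn_ge0 si).
have sp : 0 < sqn (T' h) by rewrite lt_def sn0.
have := cauchy_schwarz si (HT Hh') Hh; rewrite adjointE//.
rewrite -(sqnE si)// ger0_norm ?ler0c// => h1.
rewrite -(ler_pM2l sp) -expr2 -lecR rmorphXn/= (le_trans h1)// lecR ler_wpM2r ?(sqn_ge0 si)//.
exact: cT.
Qed.

Lemma ip_defect u : H u -> ip (u - T (T' u)) u = (sqn u - sqn (T' u))%:C%C.
Proof.
move=> Hu; have Hu' := in_adjoint Hu; have HTu := HT Hu'.
by rewrite (ipBl si)// adjointE// -!(sqnE si)// rmorphB.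
Qed.

Lemma exists_defect_root : exists D, is_psqrt H ip (fun u => u - T (T' u)) D.
Proof.
apply: (exists_psqrt si definite rep).
- by move=> u Hu; apply: HT; exact: in_adjoint.
- by move=> a u v Hu Hv; rewrite adjoint_linear// lT//; exact: in_adjoint.
- move=> u v Hu Hv; rewrite adjointE ?adjointEr//; exact: in_adjoint.
- move=> u Hu; have Hu' := in_adjoint Hu.
  exact: le_trans (cT Hu') (adjoint_contraction Hu).
Qed.

Lemma defect_root_spec :
  is_psqrt H ip (fun u => u - T (T' u)) (psqrt H ip (fun u => u - T (T' u))).
Proof.
have [D hD] := exists_defect_root.
by apply: (@xgetPex _ (idfun : E -> E) [set D | is_psqrt H ip _ D]); exists D.
Qed.

(** If T' u = u then (T u, u) = |u|^2, so |T u - u|^2 = |T u|^2 - |u|^2 <= 0. Applied to Szego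
    kernels, this is the source of the invertibility of 1 - Theta(z). *)
Lemma contraction_fixed u : H u -> T' u = u -> T u = u.
Proof.
move=> Hu fu; have HTu := HT Hu; apply/eqP; rewrite -subr_eq0; apply/eqP.
have Hd := siB si HTu Hu; apply: definite => //.
apply/eqP; rewrite eq_le (sqn_ge0 si)// andbT.
have e1 : ip (T u) u = ip u u by rewrite adjointE// fu.
have e2 : ip u (T u) = ip u u by rewrite adjointEr// fu.
have := cT Hu; rewrite !sqn_def (ipBr si)// !(ipBl si)// e1 e2 !raddfB/=; lra.
Qed.

End adjoint_of_contraction.

(** * Power series *)

Section matrix_sequences.
Context {R : realType}.

Lemma cvg_mxP p q (u : nat -> 'M[R[i]]_(p, q)) (l : 'M[R[i]]_(p, q)) :
  u @ \oo --> l <-> forall i j, (fun k => u k i j) @ \oo --> l i j.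
Proof.
split=> [ul i j|h].
  apply: (@cvg_comp _ _ _ u (fun M : 'M[R[i]]_(p, q) => M i j) _ (nbhs l)) => //.
  exact: (@coord_continuous R[i] p q i j l).
move=> A [P hP PA].
have h1 : \forall k \near \oo, forall ij : 'I_p * 'I_q, P ij.1 ij.2 (u k ij.1 ij.2).
  by apply: filter_forall => -[i j] /=; exact: (h i j _ (hP i j)).
by apply: filterS h1 => k hk; apply: PA => i j; exact: (hk (i, j)).
Qed.

End matrix_sequences.

Section power_series.
Context {R : realType}.
Implicit Types (a b : nat -> R[i]) (z : R[i]).

Lemma normc_real z : `|z| = (complex.Re `|z|)%:C%C.
Proof. by rewrite RRe_real// normr_real. Qed.

Definition cpseries a z := series (fun k => z ^+ k * a k).

(* Equivalent to the radius of convergence being at least one. *)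
Definition pbounded a := forall r : R, 0 < r < 1 ->
  exists M : R, forall k, `|a k| * r%:C%C ^+ k <= M%:C%C.

Lemma pbounded_of_cvg a : (forall z, `|z| < 1 -> cvgn (cpseries a z)) -> pbounded a.
Proof.
move=> h r /andP[r0 r1].
have nr : `|r%:C%C| = r%:C%C :> R[i] by rewrite ger0_norm ?ler0c// ltW.
have /h/cvg_series_cvg_0 : `|r%:C%C| < 1 :> R[i] by rewrite nr ltcR.
move=> /cvgrPdist_lt /(_ 1 ltr01)[N _ hN].
pose t k := `|a k| * r%:C%C ^+ k.
exists (complex.Re (1 + \sum_(k < N) t k)) => k.
have r0c : 0 <= r%:C%C :> R[i] by rewrite ler0c ltW.
have t0 i : 0 <= t i by rewrite /t mulr_ge0 ?exprn_ge0.
have S0 (P : pred 'I_N) : 0 <= \sum_(i < N | P i) t i by apply: sumr_ge0.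
rewrite RRe_real; last by rewrite ger0_real// addr_ge0.
have [kN|kN] := leqP N k.
  have := hN k kN; rewrite /= sub0r normrN normrM normrX nr mulrC => /ltW /le_trans; apply.
  by rewrite lerDl.
rewrite (bigD1 (Ordinal kN))//= addrCA -/(t k) lerDl.
by apply: addr_ge0.
Qed.

(** Compare with a radius r strictly between |z| and 1; the ratio is q = |z| / r. *)
Lemma geometric_bound a z : pbounded a -> `|z| < 1 ->
  exists M q : R, [/\ 0 <= M, 0 <= q, q < 1 &
    forall k, `|z ^+ k * a k| <= (M * q ^+ k)%:C%C].
Proof.
move=> ha; rewrite normc_real -[1]/(1%:C%C) ltcR; set x := complex.Re _ => x1.
have x0 : 0 <= x by rewrite -ler0c -normc_real.
have [r xr r1] : exists2 r, x < r & r < 1 by exists ((1 + x) / 2); lra.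
have r0 : 0 < r by lra.
have [|M hM] := ha r; first by rewrite r0.
have M0 : 0 <= M by rewrite -ler0c (le_trans _ (hM 0%N))// expr0 mulr1.
exists M, (x / r); split => //.
- by rewrite divr_ge0// ltW.
- by rewrite ltr_pdivrMr// mul1r.
move=> k.
have -> : (M * (x / r) ^+ k)%:C%C = M%:C%C / r%:C%C ^+ k * x%:C%C ^+ k.
  by rewrite expr_div_n mulrA mulrAC !rmorphM/= fmorphV/= !rmorphXn.
have rk : 0 < r%:C%C ^+ k :> R[i] by rewrite exprn_gt0// ltcR.
have xk : 0 <= x%:C%C ^+ k :> R[i] by rewrite exprn_ge0// ler0c.
by rewrite normrM normrX [`|z|]normc_real -/x mulrC ler_wpM2r// ler_pdivlMr.
Qed.

Lemma pbounded_cvg a z : pbounded a -> `|z| < 1 -> cvgn (cpseries a z).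
Proof.
move=> ha z1; have [M [q [M0 q0 q1 h]]] := geometric_bound ha z1.
apply: (series_abs_cvg h); apply: is_cvg_geometric_series.
by rewrite ger0_norm.
Qed.

(** For p = 1 - (1 - q)/3 one has q <= p^3. Two of the three factors p^N absorb N^2, as N p^N is at
    most the geometric sum 1/(1 - p), and the third tends to 0. *)
Lemma mulnn_geometric_cvg (q : R) : 0 <= q < 1 ->
  (fun N => (N ^ 2)%:R * q ^+ N) @ \oo --> (0 : R).
Proof.
move=> /andP[q0 q1]; pose p := 1 - (1 - q) / 3.
have p1 : p < 1 by rewrite /p; lra.
have p0 : 0 < p by rewrite /p; lra.
have qp : q <= p ^+ 3.
  have : 0 <= (1 - q) ^+ 2 by exact: sqr_ge0.
  by rewrite /p !exprS; nra.
have geo N : N%:R * p ^+ N <= (1 - p)^-1.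
  have -> : N%:R * p ^+ N = \sum_(k < N) p ^+ N.
    by rewrite sumr_const card_ord mulr_natl.
  apply: (@le_trans _ _ (\sum_(k < N) p ^+ k)).
    by apply: ler_sum => k _; rewrite ler_wiXn2l ?(ltW p0) ?(ltW p1)// ltnW.
  have d0 : 0 < 1 - p by lra.
  rewrite -[_^-1]mul1r ler_pdivlMr// mulrC -opprB mulNr -subrX1 opprB.
  by rewrite lerBlDr lerDl exprn_ge0// ltW.
have d0 : 0 <= (1 - p)^-1 by rewrite invr_ge0; lra.
apply: (@squeeze_cvgr _ _ _ _ (cst 0) (fun N => (1 - p)^-1 ^+ 2 * p ^+ N)).
- apply: nearW => N; rewrite mulr_ge0 ?exprn_ge0//=.
  have h0 : 0 <= N%:R * p ^+ N by rewrite mulr_ge0// exprn_ge0// ltW.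
  apply: (@le_trans _ _ ((N%:R * p ^+ N) ^+ 2 * p ^+ N)).
    rewrite exprMn -natrX -mulrA ler_wpM2l// -exprM -exprD.
    rewrite (_ : (N * 2 + N = 3 * N)%N); last by lia.
    by rewrite exprM lerXn2r// nnegrE exprn_ge0// ltW.
  by rewrite ler_wpM2r ?exprn_ge0 ?(ltW p0)// lerXn2r// nnegrE.
- exact: cvg_cst.
- rewrite -[X in _ --> X](mulr0 ((1 - p)^-1 ^+ 2)); apply: cvgM; first exact: cvg_cst.
  by apply: cvg_expr; rewrite ger0_norm// ltW.
Qed.

Definition cconv (V : pzSemiRingType) (a b : nat -> V) (m : nat) : V :=
  \sum_(j < m.+1) a j * b (m - j)%N.

(** The product of the partial sums is a sum over a square, the partial sum of the Cauchy product
    one over a triangle. They differ by at most N^2 terms with i + j >= N, each bounded by M^2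
    q^N. *)
Lemma cauchy_product (x y : nat -> R[i]) (A B : R[i]) (M q : R) :
  0 <= q -> q < 1 -> (forall k, `|x k| <= (M * q ^+ k)%:C%C) ->
  (forall k, `|y k| <= (M * q ^+ k)%:C%C) ->
  series x @ \oo --> A -> series y @ \oo --> B -> series (cconv x y) @ \oo --> A * B.
Proof.
move=> q0 q1 hx hy xA yB.
have M0 : 0 <= M by have := le_trans (normr_ge0 _) (hx 0%N); rewrite expr0 mulr1 ler0c.
have d : (fun N => series (cconv x y) N - series x N * series y N) @ \oo --> (0 : R[i]).
  apply: (@complex_squeeze _ _ _ (fun N => M ^+ 2 * ((N ^ 2)%:R * q ^+ N))); last first.
    rewrite -[X in _ --> X](mulr0 (M ^+ 2)); apply: cvgM; first exact: cvg_cst.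
    by apply: mulnn_geometric_cvg; rewrite q0.
  apply: nearW => N; rewrite subr0 -normrN opprB /series /= !big_mkord.
  rewrite (triangle_sum (fun j i => x j * y i)) mulr_suml -sumrB.
  rewrite (le_trans (ler_norm_sum _ _ _))//.
  rewrite (@le_trans _ _ (\sum_(j < N) \sum_(i < N) (M ^+ 2 * q ^+ N)%:C%C))//; last first.
    rewrite !sumr_const !card_ord -mulrnA -rmorphMn /= lecR -mulr_natl mulnn mulrCA.
    exact: lexx.
  apply: ler_sum => j _; rewrite mulr_sumr (big_ord_subr (fun i => x j * y i)) ?leq_subr//.
  rewrite (le_trans (ler_norm_sum _ _ _))//.
  apply: (@le_trans _ _ (\sum_(N - j <= i < N) (M ^+ 2 * q ^+ N)%:C%C)).
    rewrite big_nat_cond [leRHS]big_nat_cond; apply: ler_sum => i /andP[/andP[h1 h2] _].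
    rewrite normrM (le_trans (ler_pM _ _ (hx j) (hy i)))// -rmorphM/= lecR.
    rewrite mulrACA -expr2 ler_wpM2l ?sqr_ge0// -exprD.
    by rewrite ler_wiXn2l ?(ltW q1)//; have := ltn_ord j; lia.
  rewrite -(big_mkord xpredT (fun=> (M ^+ 2 * q ^+ N)%:C%C)).
  rewrite [leRHS](big_cat_nat (leq0n (N - j)) (leq_subr _ _))/= lerDr sumr_ge0// => i _.
  by rewrite ler0c mulr_ge0 ?exprn_ge0.
have -> : series (cconv x y) = fun N => (series (cconv x y) N - series x N * series y N) + series x N * series y N.
  by apply/funext => N; rewrite subrK.
rewrite -[A * B]add0r; exact: (cvgD d (cvgM xA yB)).
Qed.

Lemma pseriesM a b z (A B : R[i]) : pbounded a -> pbounded b -> `|z| < 1 ->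
  cpseries a z @ \oo --> A -> cpseries b z @ \oo --> B ->
  cpseries (cconv a b) z @ \oo --> A * B.
Proof.
move=> ha hb z1 aA bB.
have [M1 [q1 [M10 q10 q11 h1]]] := geometric_bound ha z1.
have [M2 [q2 [M20 q20 q21 h2]]] := geometric_bound hb z1.
pose M := Num.max M1 M2; pose q := Num.max q1 q2.
have -> : cpseries (cconv a b) z = series (cconv (fun k => z ^+ k * a k) (fun k => z ^+ k * b k)).
  congr series; apply/funext => k; rewrite /cconv mulr_sumr; apply: eq_bigr => j _.
  by rewrite mulrACA -exprD subnKC// -ltnS.
apply: (@cauchy_product _ _ A B M q _ _ _ _ aA bB).
- by rewrite le_max q10.
- by rewrite gt_max q11.
- move=> k; apply: (le_trans (h1 k)); rewrite lecR ler_pM ?exprn_ge0// ?le_max ?lexx//.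
  by rewrite lerXn2r ?nnegrE ?le_max ?q10 ?lexx.
- move=> k; apply: (le_trans (h2 k)); rewrite lecR ler_pM ?exprn_ge0// ?le_max ?lexx ?orbT//.
  by rewrite lerXn2r ?nnegrE ?le_max ?q10 ?lexx ?orbT.
Qed.

Lemma pbounded_of_bounded a (M : R) : (forall k, `|a k| <= M%:C%C) -> pbounded a.
Proof.
move=> h r /andP[r0 r1]; exists M => k; rewrite -[leRHS]mulr1 ler_pM//.
  by rewrite exprn_ge0// ler0c ltW.
by rewrite exprn_ile1// ?ler0c -?[1]/(1%:C%C) ?lecR ltW.
Qed.

Lemma pboundedD a b : pbounded a -> pbounded b -> pbounded (fun k => a k + b k).
Proof.
move=> ha hb r hr; have [M1 h1] := ha r hr; have [M2 h2] := hb r hr.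
exists (M1 + M2) => k; rewrite rmorphD/= (le_trans _ (lerD (h1 k) (h2 k)))//.
rewrite -mulrDl ler_wpM2r ?ler_normD// exprn_ge0// ler0c.
by case/andP: hr => /ltW.
Qed.

Lemma pboundedZ (c : R[i]) a : pbounded a -> pbounded (fun k => c * a k).
Proof.
move=> ha r hr; have [M h] := ha r hr; exists (complex.Re `|c| * M) => k.
by rewrite normrM -mulrA rmorphM/= -normc_real ler_wpM2l.
Qed.

Lemma pbounded_conj a : pbounded a -> pbounded (fun k => (a k)^*).
Proof. by move=> ha r hr; have [M h] := ha r hr; exists M => k; rewrite norm_conjC. Qed.

(** If the coefficients below m vanish, the term a_m t^m is the opposite of the tail beyond it, so
    |a_m| is at most a constant times t for every small t > 0. Real arguments in (0, 1) suffice, as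
    needed when a function of z and conj(z) is restricted to a ray. *)
Lemma pseries_uniq0 a : pbounded a ->
  (forall t : R, 0 < t < 1 -> cpseries a t%:C%C @ \oo --> (0 : R[i])) -> forall k, a k = 0.
Proof.
move=> ha h; elim/ltn_ind => m IH.
have [|M hM] := ha 2^-1; first by lra.
have M0 : 0 <= M by rewrite -ler0c (le_trans _ (hM 0%N))// expr0 mulr1.
(* The bound at radius 1/2 gives |a_k| <= M 2^k, hence a tail of at most M (2 t)^(m+1) / (1 - 2 t);
   for t < 1/4 the denominator exceeds 1/2, which accounts for the exponent m + 2. *)
have key (t : R) : 0 < t -> t < 4^-1 -> `|a m| <= (M * 2 ^+ m.+2 * t)%:C%C.
  move=> t0 t4; have t1 : 0 < t < 1 by lra.
  have tb k : `|t%:C%C ^+ k * a k| <= (geometric M (2 * t) k)%:C%C.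
    rewrite /geometric /= normrM normrX [X in X ^+ k]ger0_norm ?ler0c ?(ltW t0)// mulrC.
    have tk : 0 <= (2 * t)%:C%C ^+ k :> R[i] by rewrite exprn_ge0// ler0c mulr_ge0// ltW.
    have := ler_wpM2r tk (hM k); rewrite -mulrA -exprMn -rmorphM/=.
    have e : (M * (2 * t) ^+ k)%:C%C = M%:C%C * (2 * t)%:C%C ^+ k by rewrite [LHS]rmorphM rmorphXn.
    rewrite e mulrA mulVf ?mul1r; last by rewrite pnatr_eq0.
    by move=> h'; exact: h'.
  have gc : series (geometric M (2 * t)) @ \oo --> M / (1 - 2 * t).
    by apply: cvg_geometric_series; rewrite ger0_norm; lra.
  have := series_tail_le tb (h t t1) gc m.+1.
  rewrite sub0r normrN seriesS /series /= big1_seq ?addr0 => [|k]; last first.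
    by rewrite mem_index_iota => /andP[_ /andP[_ km]]; rewrite IH ?mulr0.
  have tm : 0 < t%:C%C ^+ m :> R[i] by rewrite exprn_gt0// ltcR.
  rewrite normrM normrX ger0_norm ?ler0c ?(ltW t0)// mulrC -ler_pdivlMr// => /le_trans; apply.
  have e (y : R) : y%:C%C * t%:C%C ^+ m = (y * t ^+ m)%:C%C by rewrite [RHS]rmorphM rmorphXn.
  rewrite ler_pdivrMr// e lecR.
  have -> : \sum_(0 <= k < m.+1) geometric M (2 * t) k = M * (1 - (2 * t) ^+ m.+1) / (1 - 2 * t).
    by rewrite -[LHS]/(series (geometric M (2 * t)) m.+1) geometric_seriesE// lt_eqF; lra.
  rewrite -mulrBl -[X in X - _]mulr1 -mulrBr opprB addrC subrK ler_pdivrMr; last lra.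
  rewrite exprMn [in leRHS]exprS.
  have -> : M * (2 * 2 ^+ m.+1) * t * t ^+ m * (1 - 2 * t) = (M * (2 ^+ m.+1 * t ^+ m.+1)) * (2 * (1 - 2 * t)).
    by rewrite [t ^+ m.+1]exprS; ring.
  by rewrite ler_peMr ?mulr_ge0 ?exprn_ge0 ?(ltW t0)//; lra.
apply/eqP; rewrite -normr_eq0 normc_real; set x := complex.Re _.
suff -> : x = 0 by [].
have x0 : 0 <= x by rewrite -ler0c -normc_real.
apply/eqP; rewrite eq_le x0 andbT leNgt; apply/negP => xp.
pose C := M * 2 ^+ m.+2.
have C0 : 0 <= C by rewrite mulr_ge0// exprn_ge0.
have C1 : 0 < 8 * (C + x + 1) by lra.
(* This t is below 1/4 and satisfies C t < x, which contradicts the estimate x <= C t. *)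
have := key (x / (8 * (C + x + 1))).
rewrite normc_real lecR -/x -/C; move=> /(_ _ _) hh.
have : x <= C * (x / (8 * (C + x + 1))).
  by apply: hh; [rewrite divr_gt0//|rewrite ltr_pdivrMr//; lra].
by rewrite mulrA ler_pdivlMr// => hx; nra.
Qed.

Lemma pseries_uniq a b : pbounded a -> pbounded b ->
  (forall z, `|z| < 1 -> exists2 l : R[i], cpseries a z @ \oo --> l & cpseries b z @ \oo --> l) -> a = b.
Proof.
move=> ha hb h; apply/funext => k; apply/eqP; rewrite -subr_eq0; apply/eqP.
apply: (@pseries_uniq0 (fun k => a k - b k)).
  rewrite (_ : (fun k => _) = fun k => a k + (-1) * b k).
    by apply: pboundedD => //; exact: pboundedZ.
  by apply/funext => j; rewrite mulN1r.
move=> t /andP[t0 t1]; have [|l al bl] := h t%:C%C.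
  by rewrite ger0_norm ?ler0c ?(ltW t0)// -[1]/(1%:C%C) ltcR.
rewrite -(subrr l) (_ : cpseries _ _ = fun N => cpseries a t%:C%C N - cpseries b t%:C%C N).
  exact: (cvgB al bl).
by apply/funext => N; rewrite /cpseries /series /= -sumrB; apply: eq_bigr => j _; rewrite mulrBr.
Qed.

End power_series.

Section roots_of_unity.
Context {R : realType}.

(** X^N - 1 splits over an algebraically closed field and is separable in characteristic 0; its N
    distinct roots include a primitive one. *)
Lemma prim_root_exists (N : nat) : (0 < N)%N -> exists w : R[i], N.-primitive_root w.
Proof.
move=> N0; pose p : {poly R[i]} := 'X^N - 1.
have [rs Dp] := closed_field_poly_normal p.
move: Dp; rewrite lead_coefXnsubC// scale1r => Dp.
have rs_p : all N.-unity_root rs by apply/allP => r; rewrite -root_prod_XsubC -Dp.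
have rs_N : (size rs = N)%N by have := size_XnsubC (1 : R[i]) N0; rewrite -/p Dp size_prod_XsubC => -[].
have urs : uniq rs.
  by rewrite -separable_prod_XsubC -Dp separable_Xn_sub_1// pnatr_eq0 -lt0n.
have /hasP[z _ hz] : has N.-primitive_root rs by apply: has_prim_root => //; rewrite rs_N.
by exists z.
Qed.

Lemma prim_root_norm (N : nat) (w : R[i]) : (0 < N)%N -> N.-primitive_root w -> `|w| = 1.
Proof.
move=> N0 /prim_expr_order h; apply/eqP; rewrite -(@pexpr_eq1 _ _ N)// -normrX h normr1.
by rewrite eqxx.
Qed.

End roots_of_unity.

Section limits.
Context {R : realType}.

Lemma cvg_complex_sum (I : Type) (s : seq I) (P : pred I) (F : I -> nat -> R[i]) (l : I -> R[i]) :
  (forall i, P i -> F i @ \oo --> l i) ->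
  (fun k => \sum_(i <- s | P i) F i k) @ \oo --> \sum_(i <- s | P i) l i.
Proof.
move=> h; elim: s => [|i s IH].
  under eq_fun do rewrite big_nil.
  by rewrite big_nil; exact: cvg_cst.
rewrite big_cons; under eq_fun do rewrite big_cons.
by case: ifP => [Pi|_]; [exact: (cvgD (h i Pi) IH)|exact: IH].
Qed.

Lemma cvg_complex_conj (u : nat -> R[i]) (l : R[i]) :
  u @ \oo --> l -> (fun k => (u k)^*) @ \oo --> l^*.
Proof.
move=> ul; apply: cvg_complex.
  rewrite (_ : (fun _ => _) = fun k => complex.Re (u k)); last by apply/funext => k; case: (u k).
  by rewrite (_ : complex.Re _ = complex.Re l); [exact: cvg_complex_Re|case: (l)].
rewrite (_ : (fun _ => _) = fun k => - complex.Im (u k)); last by apply/funext => k; case: (u k).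
rewrite (_ : complex.Im _ = - complex.Im l); last by case: (l).
by apply: cvgN; exact: cvg_complex_Im.
Qed.

(** Fix d = j + k and restrict to the ray z = t c with |c| = 1. The coefficient of t^d, multiplied
    by c^d, is the polynomial sum_m C_m (c^2)^m of degree at most d, where C_m collects the
    coefficients of z^m conj(z)^(d-m). It vanishes for every unimodular c, hence at more points c^2
    than its degree allows, and all C_m are 0. *)
Lemma sesqui_pseries_uniq (I : finType) (x y : I -> nat -> R[i]) (X Y : I -> R[i] -> R[i]) :
  (forall i, pbounded (x i)) -> (forall i, pbounded (y i)) ->
  (forall i (z : R[i]), `|z| < 1 -> cpseries (x i) z @ \oo --> X i z) ->
  (forall i (z : R[i]), `|z| < 1 -> cpseries (y i) z @ \oo --> Y i z) ->
  (forall z : R[i], `|z| < 1 -> \sum_i X i z * (Y i z)^* = 0) ->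
  forall j k, \sum_i x i j * (y i k)^* = 0.
Proof.
move=> bx by_ hX hY h0 j k.
pose d := (j + k)%N.
pose C m := \sum_i x i m * (y i (d - m)%N)^*.
have circ (c : R[i]) : `|c| = 1 -> \sum_(m < d.+1) C m * (c ^+ 2) ^+ m = 0.
  move=> c1.
  pose a i m := c ^+ m * x i m; pose b i m := (c ^+ m * y i m)^*.
  have cb (f : nat -> R[i]) : pbounded f -> pbounded (fun m => c ^+ m * f m).
    move=> hf r hr; have [M hM] := hf r hr; exists M => m.
    by rewrite normrM normrX c1 expr1n mul1r.
  have ba i : pbounded (a i) by exact: cb.
  have bb i : pbounded (b i) by apply: pbounded_conj; exact: cb.
  have : \sum_i cconv (a i) (b i) d = 0.
    apply: (@pseries_uniq0 _ (fun m => \sum_i cconv (a i) (b i) m)).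
      apply: pbounded_of_cvg => z z1.
      have hs i : cpseries (cconv (a i) (b i)) z @ \oo --> limn (cpseries (a i) z) * limn (cpseries (b i) z).
        exact: (pseriesM (ba i) (bb i) z1 (pbounded_cvg (ba i) z1) (pbounded_cvg (bb i) z1)).
      apply/cvg_ex; exists (\sum_i limn (cpseries (a i) z) * limn (cpseries (b i) z)).
      rewrite (_ : cpseries _ _ = fun N => \sum_i cpseries (cconv (a i) (b i)) z N).
        by apply: cvg_complex_sum => i _; exact: hs.
      apply/funext => N; rewrite /cpseries /series /= exchange_big /=.
      by apply: eq_bigr => m _; rewrite mulr_sumr.
    move=> t /andP[t0 t1].
    have nt : `|t%:C%C| = t%:C%C :> R[i] by rewrite ger0_norm// ler0c ltW.
    have tl : `|t%:C%C| < 1 :> R[i] by rewrite nt -[1]/(1%:C%C) ltcR.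
    have tcl : `|t%:C%C * c| < 1 by rewrite normrM c1 mulr1.
    have ha i : cpseries (a i) t%:C%C @ \oo --> X i (t%:C%C * c).
      rewrite (_ : cpseries _ _ = cpseries (x i) (t%:C%C * c)); first exact: hX.
      by congr series; apply/funext => m; rewrite /a exprMn mulrA.
    have hb i : cpseries (b i) t%:C%C @ \oo --> (Y i (t%:C%C * c))^*.
      rewrite (_ : cpseries _ _ = fun N => (cpseries (y i) (t%:C%C * c) N)^*).
        by apply: cvg_complex_conj; exact: hY.
      apply/funext => N; rewrite /cpseries /series /= rmorph_sum; apply: eq_bigr => m _.
      rewrite /b /= exprMn !rmorphM/= !rmorphXn/= -mulrA; congr (_ ^+ _ * _).
      by rewrite [RHS]conjc_real.
    rewrite (_ : cpseries _ _ = fun N => \sum_i cpseries (cconv (a i) (b i)) t%:C%C N); last first.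
      apply/funext => N; rewrite /cpseries /series /= exchange_big /=.
      by apply: eq_bigr => m _; rewrite mulr_sumr.
    rewrite -[X in _ --> X](h0 _ tcl); apply: cvg_complex_sum => i _.
    exact: (pseriesM (ba i) (bb i) tl (ha i) (hb i)).
  move=> /(congr1 ( *%R (c ^+ d))); rewrite mulr0 => hh; rewrite -[RHS]hh.
  rewrite [RHS]mulr_sumr /cconv.
  rewrite [RHS](eq_bigr (fun i => \sum_(m < d.+1) c ^+ d * (a i m * b i (d - m)%N))); last first.
    by move=> i _; rewrite mulr_sumr.
  rewrite [RHS]exchange_big /=; apply: eq_bigr => m _.
  rewrite /C mulr_suml; apply: eq_bigr => i _; rewrite /a /b.
  have md : (m <= d)%N by rewrite -ltnS.
  have ccn (e : nat) : c ^+ e * (c ^+ e)^* = 1.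
    by rewrite -normCK normrX c1 !expr1n.
  have -> : c ^+ d = c ^+ m * c ^+ (d - m) by rewrite -exprD subnKC.
  rewrite rmorphM/= -exprM mulnC exprM expr2 -[LHS]mul1r -(ccn (d - m)%N); ring.
(* The order is doubled because the points are squares: the w^(2 i) with i <= d are then d + 1
   distinct roots. *)
have [w hw] := @prim_root_exists R (2 * d.+1) isT.
have w1 := prim_root_norm (isT : (0 < 2 * d.+1)%N) hw.
pose p := \poly_(m < d.+1) C m.
have p0 : p = 0.
  apply/eqP/negPn/negP => pn0.
  have := @max_poly_roots _ p [seq w ^+ (2 * i) | i <- iota 0 d.+1] pn0 _ _.
  rewrite size_map size_iota => h.
  have /h : all (root p) [seq w ^+ (2 * i) | i <- iota 0 d.+1].
    apply/allP => _ /mapP[i _ ->]; rewrite rootE /p horner_poly mulnC exprM.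
    by apply/eqP; apply: circ; rewrite normrX w1 expr1n.
  have u : uniq [seq w ^+ (2 * i) | i <- iota 0 d.+1].
    rewrite map_inj_in_uniq ?iota_uniq// => a b; rewrite !mem_iota !add0n => ha hb /eqP.
    rewrite (eq_prim_root_expr hw) !modn_small ?ltn_pmul2l// => /eqP; lia.
  by move=> /(_ u); rewrite ltnNge size_poly.
have : p`_j = 0 by rewrite p0 coef0.
by rewrite coef_poly ltnS leq_addr /C /d addKn.
Qed.

End limits.

Section matrix_power_series.
Context {R : realType}.
Local Notation C := R[i].

Lemma dval_lt1 (w : disc R) : `|dval w| < 1.
Proof. by have := set_mem (valP w). Qed.

Lemma disc_ex (z : C) : `|z| < 1 -> exists w : disc R, dval w = z.
Proof. by move=> h; exists (exist _ z (mem_set h)). Qed.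

Lemma dval0 : dval (disc0 : disc R) = 0. Proof. by []. Qed.

Definition mpbounded p q (a : nat -> 'M[C]_(p, q)) : Prop :=
  forall i j, pbounded (fun k => a k i j).

Definition mconv p q s (a : nat -> 'M[C]_(p, q)) (b : nat -> 'M[C]_(q, s)) m :=
  \sum_(j < m.+1) a j *m b (m - j)%N.

Lemma power_seriesP p q (a : nat -> 'M[C]_(p, q)) F :
  power_series_on_disc a F <->
  forall (w : disc R) i j, cpseries (fun k => a k i j) (dval w) @ \oo --> F w i j.
Proof.
have e (w : disc R) i j : (fun N => series (fun k => dval w ^+ k *: a k) N i j) =
    cpseries (fun k => a k i j) (dval w).
  by apply/funext => N; rewrite /cpseries /series /= summxE; apply: eq_bigr => k _; rewrite mxE.
split=> [h w i j|h w].
  by rewrite -e; move/cvg_mxP: (h w); apply.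
by apply/cvg_mxP => i j; rewrite e; exact: h.
Qed.

Lemma power_series_pbounded p q (a : nat -> 'M[C]_(p, q)) F :
  power_series_on_disc a F -> mpbounded a.
Proof.
move=> /power_seriesP h i j; apply: pbounded_of_cvg => z /disc_ex[w <-].
by apply/cvg_ex; exists (F w i j); exact: h.
Qed.

Lemma power_series_ex p q (a : nat -> 'M[C]_(p, q)) :
  mpbounded a -> exists F, power_series_on_disc a F.
Proof.
move=> h; exists (fun w => \matrix_(i, j) limn (cpseries (fun k => a k i j) (dval w))).
apply/power_seriesP => w i j; rewrite mxE; apply: pbounded_cvg => //.
exact: dval_lt1.
Qed.

Lemma power_series_coef_uniq p q (a b : nat -> 'M[C]_(p, q)) F :
  power_series_on_disc a F -> power_series_on_disc b F -> a = b.
Proof.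
move=> ha hb; have ba := power_series_pbounded ha; have bb := power_series_pbounded hb.
move/power_seriesP: ha => ha; move/power_seriesP: hb => hb.
apply/funext => k; apply/matrixP => i j.
suff /(congr1 (fun f => f k)) : (fun k => a k i j) = (fun k => b k i j) by [].
apply: pseries_uniq => // z /disc_ex[w <-]; exists (F w i j); [exact: ha|exact: hb].
Qed.

Lemma power_series_uniq p q (a : nat -> 'M[C]_(p, q)) F G :
  power_series_on_disc a F -> power_series_on_disc a G -> F = G.
Proof.
move=> /power_seriesP h /power_seriesP h'; apply/funext => w; apply/matrixP => i j.
exact: (cvg_complex_uniq (h w i j) (h' w i j)).
Qed.

Lemma power_seriesP_lin p q (c : C) (a b : nat -> 'M[C]_(p, q)) F G :
  power_series_on_disc a F -> power_series_on_disc b G ->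
  power_series_on_disc (fun k => c *: a k + b k) (fun w => c *: F w + G w).
Proof.
move=> /power_seriesP h /power_seriesP h'; apply/power_seriesP => w i j.
rewrite !mxE (_ : cpseries _ _ = fun N => c * cpseries (fun k => a k i j) (dval w) N
    + cpseries (fun k => b k i j) (dval w) N).
  exact: (cvgD (cvgM (cvg_cst c) (h w i j)) (h' w i j)).
apply/funext => N; rewrite /cpseries /series /= mulr_sumr -big_split; apply: eq_bigr => k _ /=.
by rewrite !mxE mulrDr mulrCA.
Qed.

Lemma power_seriesM p q s (a : nat -> 'M[C]_(p, q)) (b : nat -> 'M[C]_(q, s)) F G :
  power_series_on_disc a F -> power_series_on_disc b G ->
  power_series_on_disc (mconv a b) (fun w => F w *m G w).
Proof.
move=> ha hb; have ba := power_series_pbounded ha; have bb := power_series_pbounded hb.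
move/power_seriesP: ha => ha; move/power_seriesP: hb => hb.
apply/power_seriesP => w i j; rewrite mxE.
rewrite (_ : cpseries _ _ = fun N => \sum_l cpseries (cconv (fun k => a k i l) (fun k => b k l j)) (dval w) N).
  apply: cvg_complex_sum => l _.
  exact: (pseriesM (ba i l) (bb l j) (dval_lt1 w) (ha w i l) (hb w l j)).
apply/funext => N; rewrite /cpseries /series /= exchange_big; apply: eq_bigr => k _ /=.
rewrite -mulr_sumr /mconv summxE /cconv exchange_big; congr (_ * _); apply: eq_bigr => m _ /=.
by rewrite mxE.
Qed.

Lemma power_series_cst p q (A : 'M[C]_(p, q)) :
  power_series_on_disc (fun k => if k == 0%N then A else 0) (fun=> A).
Proof.
apply/power_seriesP => w i j; apply: (complex_squeeze (b := cst 0)); last exact: cvg_cst.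
exists 1%N => // -[//|N] _ /=; rewrite /cpseries /series /= big_nat_recl//= big1 => [|k _].
  by rewrite expr0 mul1r addr0 subrr normr0.
by rewrite mxE mulr0.
Qed.

Lemma power_series_disc0 p q (a : nat -> 'M[C]_(p, q)) F :
  power_series_on_disc a F -> F disc0 = a 0%N.
Proof.
move=> /power_seriesP h; apply/matrixP => i j; apply: (cvg_complex_uniq (h disc0 i j)).
apply: (complex_squeeze (b := cst 0)); last exact: cvg_cst.
exists 1%N => // -[//|N] _ /=; rewrite dval0 /cpseries /series /= big_nat_recl//= big1 => [|k _].
  by rewrite expr0 mul1r addr0 subrr normr0.
by rewrite exprS !mul0r.
Qed.

Lemma taylor_coefE n (a : nat -> 'cV[C]_n) F : power_series_on_disc a F -> taylor_coef F = a.
Proof.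
move=> h; apply: (@power_series_coef_uniq _ _ _ _ F) => //.
by apply: (@xgetPex _ (fun=> 0) [set a | power_series_on_disc a F]); exists a.
Qed.

End matrix_power_series.

(** * The Hardy space *)

Section dotc_theory.
Context {R : realType} {n : nat}.
Local Notation C := R[i].
Implicit Types u v w : 'cV[C]_n.

Lemma semi_inner_dotc : semi_inner [set: 'cV[C]_n] dotc.
Proof.
split=> //.
- move=> a u v w _ _ _; rewrite /dotc mulr_sumr -big_split; apply: eq_bigr => i _ /=.
  by rewrite !mxE mulrDl mulrA.
- move=> u v _ _; rewrite /dotc rmorph_sum; apply: eq_bigr => i _ /=.
  by rewrite rmorphM/= conjCK mulrC.
- by move=> u _; rewrite /dotc sumr_ge0// => i _; rewrite mul_conjC_ge0.
Qed.

Definition sqv (v : 'cV[C]_n) : R := sqn dotc v.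

Lemma sqvE v : (sqv v)%:C%C = \sum_i `|v i 0| ^+ 2.
Proof.
rewrite /sqv (sqnE semi_inner_dotc)// /dotc; apply: eq_bigr => i _.
by rewrite normCK.
Qed.

Lemma sqv_ge0 v : 0 <= sqv v. Proof. exact: (sqn_ge0 semi_inner_dotc). Qed.

Lemma sqv_eq0 v : sqv v = 0 -> v = 0.
Proof.
move=> /(congr1 (real_complex R)); rewrite [LHS]sqvE => /eqP.
rewrite psumr_eq0; last by move=> i _; rewrite exprn_ge0.
move=> /allP h; apply/matrixP => i j; rewrite ord1 mxE; apply/eqP.
by have := h i (mem_index_enum _); rewrite sqrf_eq0 normr_eq0.
Qed.

Lemma entry_le_sqv v i : `|v i 0| ^+ 2 <= (sqv v)%:C%C.
Proof.
by rewrite sqvE (bigD1 i)//= lerDl sumr_ge0// => j _; rewrite exprn_ge0.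
Qed.

Lemma cvnormE v : cvnorm v = Num.sqrt (sqv v). Proof. by []. Qed.

Lemma sqr_cvnorm v : cvnorm v ^+ 2 = sqv v.
Proof. by rewrite cvnormE sqr_sqrtr// sqv_ge0. Qed.

Lemma dotc_adjmx (A : 'M[C]_n) u v : dotc (A *m u) v = dotc u (adjmx A *m v).
Proof.
rewrite /dotc; under eq_bigr do rewrite mxE mulr_suml.
rewrite exchange_big; apply: eq_bigr => j _ /=.
rewrite mxE rmorph_sum mulr_sumr; apply: eq_bigr => i _ /=.
by rewrite !mxE rmorphM/= conjCK mulrA [u j 0 * _]mulrC.
Qed.

Lemma adjmxK (A : 'M[C]_n) : adjmx (adjmx A) = A.
Proof. by apply/matrixP => i j; rewrite !mxE conjCK. Qed.

Lemma sqvZ (a : C) v : (sqv (a *: v))%:C%C = `|a| ^+ 2 * (sqv v)%:C%C.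
Proof. exact: (sqnZ semi_inner_dotc). Qed.

(** Coordinate i of A v is the inner product of v with A' e_i, where A' is the adjoint;
    Cauchy-Schwarz on each coordinate gives the constant. Without such a bound the supremum in
    [opnorm] could be a default value. *)
Lemma mulmx_bounded (A : 'M[C]_n) : exists2 M : R, 0 <= M &
  forall v, sqv (A *m v) <= M * sqv v.
Proof.
exists (\sum_i sqv (adjmx A *m (delta_mx i 0 : 'cV_n))).
  by apply: sumr_ge0 => i _; exact: sqv_ge0.
move=> v; rewrite -lecR sqvE mulr_suml rmorph_sum/=; apply: ler_sum => i _.
have <- : dotc v (adjmx A *m delta_mx i 0) = (A *m v) i 0.
  rewrite -dotc_adjmx /dotc (bigD1 i)//= big1 ?addr0 => [|j ji].
    by rewrite [in X in _ * X]mxE !eqxx conjC1 mulr1.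
  by rewrite [in X in _ * X]mxE (negbTE ji) conjC0 mulr0.
by rewrite mulrC; apply: (cauchy_schwarz semi_inner_dotc).
Qed.

Lemma opnorm_bound (A : 'M[C]_n) v : cvnorm (A *m v) <= opnorm A * cvnorm v.
Proof.
have [M M0 hM] := mulmx_bounded A.
have hs : has_sup [set cvnorm (A *m v) | v in [set v | cvnorm v <= 1]].
  split; first by exists (cvnorm (A *m 0)); exists 0 => //=; rewrite cvnormE /sqv /sqn (ip0l semi_inner_dotc)//= sqrtr0.
  exists (Num.sqrt M) => _ [w /= w1 <-]; rewrite cvnormE ler_wsqrtr// (le_trans (hM w))//.
  by rewrite ler_piMr// -sqr_cvnorm expr_le1// cvnormE sqrtr_ge0.
have [v0|v0] := eqVneq (cvnorm v) 0.
  have -> : v = 0 by apply: sqv_eq0; rewrite -sqr_cvnorm v0 expr0n.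
  by rewrite mulmx0 !cvnormE /sqv /sqn (ip0l semi_inner_dotc)//= sqrtr0 mulr0.
have vp : 0 < cvnorm v by rewrite lt_def v0 cvnormE sqrtr_ge0.
have cZ (c : R) w : 0 <= c -> cvnorm (c%:C%C *: w) = c * cvnorm w.
  move=> c0; rewrite !cvnormE -[c in RHS]ger0_norm// -sqrtr_sqr -sqrtrM ?sqr_ge0//.
  congr Num.sqrt; apply: complexI; rewrite [LHS]sqvZ ger0_norm ?ler0c//.
  by rewrite rmorphM/= rmorphXn.
rewrite -ler_pdivrMr// mulrC -cZ ?invr_ge0 ?(ltW vp)// scalemxAr.
apply: ub_le_sup; first by case: hs.
by exists ((cvnorm v)^-1%:C%C *: v) => //=; rewrite cZ ?invr_ge0 ?(ltW vp)// mulVf.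
Qed.

Lemma opnorm_le1 (A : 'M[C]_n) v : opnorm A <= 1 -> sqv (A *m v) <= sqv v.
Proof.
move=> A1; rewrite -!sqr_cvnorm lerXn2r ?nnegrE ?cvnormE ?sqrtr_ge0//.
by rewrite (le_trans (opnorm_bound A v))// ler_piMl// cvnormE sqrtr_ge0.
Qed.

Lemma opnorm_lt1_fixed (A : 'M[C]_n) v : opnorm A < 1 -> A *m v = v -> v = 0.
Proof.
move=> A1 Av; have := opnorm_bound A v; rewrite Av.
have := sqrtr_ge0 (sqv v); rewrite -cvnormE => c0 h.
by apply: sqv_eq0; rewrite -sqr_cvnorm; apply/eqP; rewrite sqrf_eq0; apply/eqP; nra.
Qed.

Lemma dotc_delta v i : dotc v (delta_mx i 0) = v i 0.
Proof.
rewrite /dotc (bigD1 i)//= big1 ?addr0 => [|j ji].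
  by rewrite [in X in _ * X]mxE !eqxx conjC1 mulr1.
by rewrite [in X in _ * X]mxE (negbTE ji) conjC0 mulr0.
Qed.

End dotc_theory.

Section hardy_space.
Context {R : realType} {n : nat}.
Local Notation C := R[i].
Implicit Types (a b : nat -> 'cV[C]_n) (f g : disc R -> 'cV[C]_n).

Definition l2 a : Prop := cvgn (series (fun k => sqv (a k))).

Let nneg a : nondecreasing_seq (series (fun k => sqv (a k))).
Proof. by apply/nondecreasing_seqP => i; rewrite seriesS lerDr sqv_ge0. Qed.

Lemma l2_of_bounded a (M : R) : (forall N, \sum_(k < N) sqv (a k) <= M) -> l2 a.
Proof.
move=> h; apply: nondecreasing_is_cvgn; first exact: nneg.
by exists M => _ [N _ <-]; rewrite /series /= big_mkord.
Qed.

Lemma l2_partial_le a N : l2 a -> \sum_(k < N) sqv (a k) <= limn (series (fun k => sqv (a k))).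
Proof.
move=> ha; have := nondecreasing_cvgn_le (@nneg a) ha N.
by rewrite {1}/series /= big_mkord.
Qed.

Lemma l2_pbounded a : l2 a -> mpbounded a.
Proof.
move=> ha i j; apply: (@pbounded_of_bounded _ _ (1 + limn (series (fun k => sqv (a k))))) => k.
rewrite ord1; set s := limn _.
have := l2_partial_le k.+1 ha; rewrite big_ord_recr /= -/s => h.
have h0 : 0 <= \sum_(i < k) sqv (a i) by apply: sumr_ge0 => *; exact: sqv_ge0.
have ak := sqv_ge0 (a k).
have h1 : sqv (a k) <= (1 + s) ^+ 2 by nra.
rewrite -(@ler_pXn2r _ 2)// ?nnegrE ?ler0c; last by lra.
rewrite (le_trans (entry_le_sqv _ _))//.
have -> : (1 + s)%:C%C ^+ 2 = ((1 + s) ^+ 2)%:C%C :> C by rewrite [RHS]rmorphXn.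
by rewrite lecR.
Qed.

Lemma l2_lin (c : C) a b : l2 a -> l2 b -> l2 (fun k => c *: a k + b k).
Proof.
move=> ha hb.
pose M := 2 * (complex.Re `|c|) ^+ 2 * limn (series (fun k => sqv (a k))) + 2 * limn (series (fun k => sqv (b k))).
apply: (@l2_of_bounded _ M) => N.
apply: (@le_trans _ _ (\sum_(k < N) (2 * (complex.Re `|c|) ^+ 2 * sqv (a k) + 2 * sqv (b k)))).
  apply: ler_sum => k _; rewrite (le_trans (sqnD2 semi_inner_dotc _ _))// lerD2r -mulrA ler_pM2l//.
  by rewrite -lecR [leLHS]sqvZ normc_real rmorphM/= rmorphXn.
rewrite big_split/= -!mulr_sumr; apply: lerD; apply: ler_wpM2l.
- by rewrite mulr_ge0// sqr_ge0.
- exact: l2_partial_le.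
- by [].
- exact: l2_partial_le.
Qed.

Lemma l2_dot_cvg a b : l2 a -> l2 b -> cvgn (series (fun k => dotc (a k) (b k))).
Proof.
move=> ha hb; apply: (@series_abs_cvg _ _ (fun k => sqv (a k) + sqv (b k))).
  move=> k; rewrite (le_trans (cauchy_schwarz_sqrt semi_inner_dotc _ _))// lecR.
  have ha0 := sqv_ge0 (a k); have hb0 := sqv_ge0 (b k).
  have := sqr_ge0 (Num.sqrt (sqv (a k)) - Num.sqrt (sqv (b k))).
  have := sqrtr_ge0 (sqv (a k)); have := sqrtr_ge0 (sqv (b k)).
  have := sqr_sqrtr ha0; have := sqr_sqrtr hb0.
  by rewrite -/(sqv _) -/(sqv _); nra.
rewrite (_ : series _ = series (fun k => sqv (a k)) \+ series (fun k => sqv (b k))).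
  by apply: is_cvgD; [exact: ha|exact: hb].
by apply/funext => N; rewrite /series /= big_split.
Qed.

Definition coefs f a : Prop := power_series_on_disc a f /\ l2 a.

Lemma hardyP f : hardy f <-> exists a, coefs f a.
Proof.
have e a : (fun k => cvnorm (a k) ^+ 2) = (fun k => sqv (a k)).
  by apply/funext => k; rewrite sqr_cvnorm.
by split=> -[a [h1 h2]]; exists a; split => //; move: h2; rewrite /l2 e.
Qed.

Lemma l2_hardy a : l2 a -> exists2 f, hardy f & coefs f a.
Proof.
move=> ha; have [f hf] := power_series_ex (l2_pbounded ha).
by exists f => //; apply/hardyP; exists a.
Qed.

Lemma coefs_lin (c : C) f g a b : coefs f a -> coefs g b ->
  coefs (c *: f + g) (fun k => c *: a k + b k).
Proof.
move=> [hf la] [hg lb]; split; last exact: l2_lin.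
exact: (power_seriesP_lin hf hg).
Qed.

Lemma hardy_dot_cvg f g a b : coefs f a -> coefs g b ->
  series (fun k => dotc (a k) (b k)) @ \oo --> hardy_dot f g.
Proof.
move=> [hf la] [hg lb]; rewrite /hardy_dot (taylor_coefE hf) (taylor_coefE hg).
exact: l2_dot_cvg.
Qed.

Lemma semi_inner_hardy : semi_inner (@hardy R n) hardy_dot.
Proof.
split.
- apply/hardyP; exists (fun=> 0); split; last first.
    apply: (@l2_of_bounded _ 0) => N; rewrite big1// => k _.
    by rewrite /sqv /sqn (ip0l semi_inner_dotc).
  have := @power_series_cst R n 1 0.
  by rewrite (_ : (fun k => _) = (fun=> 0))//; apply/funext => k; case: ifP.
- move=> c f g /hardyP[a ha] /hardyP[b hb]; apply/hardyP.
  by eexists; apply: coefs_lin ha hb.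
- move=> c f g h /hardyP[a ha] /hardyP[b hb] /hardyP[d hd].
  apply: (cvg_complex_uniq (hardy_dot_cvg (coefs_lin c ha hb) hd)).
  rewrite (_ : series _ = fun N => c * series (fun k => dotc (a k) (d k)) N
     + series (fun k => dotc (b k) (d k)) N).
    exact: (cvgD (cvgM (cvg_cst c) (hardy_dot_cvg ha hd)) (hardy_dot_cvg hb hd)).
  apply/funext => N; rewrite /series /= mulr_sumr -big_split; apply: eq_bigr => k _ /=.
  exact: (siPl semi_inner_dotc).
- move=> f g /hardyP[a ha] /hardyP[b hb].
  apply: (cvg_complex_uniq (hardy_dot_cvg hb ha)).
  rewrite (_ : series _ = fun N => (series (fun k => dotc (a k) (b k)) N)^*).
    by apply: cvg_complex_conj; exact: hardy_dot_cvg.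
  apply/funext => N; rewrite /series /= rmorph_sum; apply: eq_bigr => k _ /=.
  exact: (siC semi_inner_dotc).
- move=> f /hardyP[a ha]; have h := hardy_dot_cvg ha ha.
  have e : series (fun k => dotc (a k) (a k)) = fun N => (series (fun k => sqv (a k)) N)%:C%C.
    apply/funext => N; rewrite /series /= rmorph_sum; apply: eq_bigr => k _ /=.
    by rewrite [RHS](sqnE semi_inner_dotc).
  rewrite e in h; have hr := cvg_complex_Re h; have hi := cvg_complex_Im h.
  rewrite lecE; apply/andP; split.
    apply/eqP; exact: (cvg_unique _ hi (cvg_cst 0)).
  apply: (@ler_cvg_to _ _ eventually_filter _ (cst 0) _ _ _ (cvg_cst 0) hr).
  by apply: nearW => N /=; rewrite sumr_ge0// => k _; exact: sqv_ge0.
Qed.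

Lemma sqn_hardy_cvg f a : coefs f a ->
  series (fun k => sqv (a k)) @ \oo --> sqn hardy_dot f.
Proof.
move=> ha; have := cvg_complex_Re (hardy_dot_cvg ha ha).
rewrite (_ : (fun m => _) = series (fun k => sqv (a k)))//.
by apply/funext => N; rewrite /series /= raddf_sum.
Qed.

Lemma sqn_hardy_ge f a N : coefs f a -> \sum_(k < N) sqv (a k) <= sqn hardy_dot f.
Proof.
move=> ha; have h := sqn_hardy_cvg ha; case: (ha) => _ la.
by rewrite -(cvg_lim _ h)//; exact: l2_partial_le.
Qed.

Lemma sqn_hardy_le f a (M : R) : coefs f a -> (forall N, \sum_(k < N) sqv (a k) <= M) ->
  sqn hardy_dot f <= M.
Proof.
move=> ha hM; apply: (@ler_cvg_to _ _ eventually_filter _ _ (cst M) _ _ (sqn_hardy_cvg ha) (cvg_cst M)).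
by apply: nearW => N; rewrite /series /= big_mkord.
Qed.

Lemma hardy_definite f : hardy f -> sqn hardy_dot f = 0 -> f = 0.
Proof.
move=> /hardyP[a ha] h0; case: (ha) => hf _.
have a0 : a = fun=> 0.
  apply/funext => k; apply: sqv_eq0; apply/eqP; rewrite eq_le sqv_ge0 andbT -h0.
  apply: (le_trans _ (sqn_hardy_ge k.+1 ha)); rewrite big_ord_recr /= lerDr.
  by apply: sumr_ge0 => *; exact: sqv_ge0.
apply: (power_series_uniq hf); rewrite a0.
have := @power_series_cst R n 1 0.
by rewrite (_ : (fun k => _) = (fun=> 0))//; apply/funext => k; case: ifP.
Qed.

End hardy_space.

Section hardy_complete.
Context {R : realType} {n : nat}.
Local Notation C := R[i].

Lemma coefsB (f g : disc R -> 'cV[C]_n) a b : coefs f a -> coefs g b -> coefs (f - g) (fun k => a k - b k).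
Proof.
move=> ha hb; have := coefs_lin (-1) hb ha.
rewrite scaleN1r addrC (_ : (fun k => _) = fun k => a k - b k)//.
by apply/funext => k; rewrite scaleN1r addrC.
Qed.

Lemma cvg_sqv (u : nat -> 'cV[C]_n) (l : 'cV[C]_n) :
  (forall i, (fun m => u m i 0) @ \oo --> l i 0) -> (fun m => sqv (u m)) @ \oo --> sqv l.
Proof.
move=> h; have : (fun m => dotc (u m) (u m)) @ \oo --> dotc l l.
  rewrite /dotc; apply: cvg_complex_sum => i _.
  exact: (cvgM (h i) (cvg_complex_conj (h i))).
exact: cvg_complex_Re.
Qed.

(** The limit is taken coefficient by coefficient, and the norm estimate is recovered from finite
    sums, where passing to the limit is immediate. *)
Lemma hardy_complete : fast_complete (@hardy R n) hardy_dot.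
Proof.
move=> u Hu hu.
have [a ha] := choice (fun m => (hardyP (u m)).1 (Hu m)).
have dk m k : sqv (a m.+1 k - a m k) <= 4^-1 ^+ m.
  apply: (le_trans _ (hu m)); have h := sqn_hardy_ge k.+1 (coefsB (ha m.+1) (ha m)).
  apply: (le_trans _ h); rewrite big_ord_recr /= lerDr.
  by apply: sumr_ge0 => *; exact: sqv_ge0.
have ent k i : cvgn (fun m => a m k i 0).
  pose d m := a m.+1 k i 0 - a m k i 0.
  have : cvgn (series d).
    apply: (@series_abs_cvg _ _ (geometric 1 2^-1)); last first.
      by apply: is_cvg_geometric_series; rewrite ger0_norm ?invr_ge0//; lra.
    move=> m; have h2 : 0 <= 2^-1 ^+ m :> R by rewrite exprn_ge0// invr_ge0.
    rewrite /geometric /= mul1r -(@ler_pXn2r _ 2)// ?nnegrE ?ler0c//.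
    have -> : (2^-1 ^+ m)%:C%C ^+ 2 = (4^-1 ^+ m)%:C%C :> C.
      have e : 2^-1 ^+ 2 = 4^-1 :> R by field.
      by rewrite -[LHS](rmorphXn (real_complex R)) -exprM mulnC exprM e.
    have := entry_le_sqv (a m.+1 k - a m k) i; rewrite !mxE => /le_trans; apply.
    by rewrite lecR.
  move=> /cvg_ex[l hl]; apply/cvg_ex; exists (a 0%N k i 0 + l).
  rewrite (_ : (fun m => _) = fun m => a 0%N k i 0 + series d m).
    exact: (cvgD (cvg_cst _) hl).
  by apply/funext => m; rewrite /series /= telescope_sumr// addrC subrK.
pose g k : 'cV[C]_n := \col_i limn (fun m => a m k i 0).
have gl k i : (fun m => a m k i 0) @ \oo --> g k i 0 by rewrite mxE; exact: ent.
(* Here N is fixed while the index l tends to infinity; uniformity in N then gives both the square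
   summability of [g] and the rate of convergence. *)
have bnd m N : \sum_(k < N) sqv (g k - a m k) <= 4 * 4^-1 ^+ m.
  apply: (@ler_cvg_to _ _ eventually_filter _ (fun l => \sum_(k < N) sqv (a l k - a m k)) (cst _) _ _ _ (cvg_cst _)).
    apply: cvg_big => [|k _]; first exact: add_continuous.
    apply: cvg_sqv => i.
    have -> : (g k - a m k) i 0 = g k i 0 - a m k i 0 by rewrite !mxE.
    have -> : (fun l => (a l k - a m k) i 0) = fun l => a l k i 0 - a m k i 0.
      by apply/funext => l; rewrite !mxE.
    exact: (cvgB (gl k i) (cvg_cst _)).
  exists m => // l /= ml; apply: (le_trans (sqn_hardy_ge N (coefsB (ha l) (ha m)))).
  exact: (sqn_telescope4 semi_inner_hardy).
have lg : l2 g.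
  have h1 : l2 (fun k => g k - a 0%N k) by apply: l2_of_bounded; exact: bnd.
  have := l2_lin (c := 1) h1 (proj2 (ha 0%N)).
  rewrite (_ : (fun k => _) = g)//; apply/funext => k; by rewrite scale1r subrK.
have [f Hf hf] := l2_hardy lg; exists f => //.
apply: (@squeeze_cvgr _ _ _ _ (cst 0) (fun m => 4 * 4^-1 ^+ m)).
- apply: nearW => m; apply/andP; split.
    exact: (sqn_ge0 semi_inner_hardy (siB semi_inner_hardy Hf (Hu m))).
  by apply: (sqn_hardy_le (coefsB hf (ha m))); exact: bnd.
- exact: cvg_cst.
- by rewrite -[X in _ --> X](mulr0 4); apply: cvgM; [exact: cvg_cst|exact: cvg_geo4].
Qed.

Lemma hardy_representable : representable (@hardy R n) hardy_dot.
Proof. exact: (riesz semi_inner_hardy hardy_complete). Qed.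

End hardy_complete.

(** * Mean squares on circles and the maximum principle *)

Section maximum_principle.
Context {R : realType} {n : nat}.
Local Notation C := R[i].

(* Orthogonality of characters on the N-th roots of unity replaces the
   integral over the circle of radius r. *)
Lemma root_average (N : nat) (w : C) (r : R) (p : nat -> 'cV[C]_n) :
  (0 < N)%N -> N.-primitive_root w ->
  \sum_(j < N) sqv (\sum_(k < N) (r%:C%C * w ^+ j) ^+ k *: p k) =
  N%:R * \sum_(k < N) r ^+ (2 * k) * sqv (p k).
Proof.
move=> N0 hw; have w1 := prim_root_norm N0 hw.
have si := @semi_inner_dotc R n.
apply: complexI; rewrite rmorph_sum/=.
transitivity (\sum_(j < N) \sum_(k < N) \sum_(l < N)
    (r%:C%C ^+ k * r%:C%C ^+ l * dotc (p k) (p l)) * ((w ^+ k * (w ^+ l)^*) ^+ j)).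
  apply: eq_bigr => j _; rewrite [LHS](sqnE si)// (ip_suml si)//; apply: eq_bigr => k _.
  rewrite (ip_sumr si)//; apply: eq_bigr => l _; rewrite (ipZl si)// (ipZr si)//.
  have e m : (r%:C%C * w ^+ j) ^+ m = r%:C%C ^+ m * (w ^+ m) ^+ j by rewrite exprMn exprAC.
  have e' m : ((r%:C%C * w ^+ j) ^+ m)^* = r%:C%C ^+ m * ((w ^+ m)^*) ^+ j.
    rewrite e rmorphM/= [(r%:C%C ^+ m)^*]rmorphXn/= [X in X ^+ m * _]conjc_real.
    by rewrite [((w ^+ m) ^+ j)^*]rmorphXn.
  rewrite e' e exprMn; ring.
rewrite exchange_big /= rmorphM/= rmorph_nat rmorph_sum/= mulr_sumr.
apply: eq_bigr => k _; rewrite exchange_big /= (bigD1 k)//= [X in _ + X]big1 ?addr0 => [|l lk].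
  rewrite -normCK normrX w1 !expr1n.
  under eq_bigr do rewrite expr1n mulr1.
  rewrite sumr_const card_ord -[in LHS]mulr_natl -(sqnE si)// -exprD addnn -mul2n.
  by rewrite rmorphM/= rmorphXn.
rewrite -mulr_sumr; set z := w ^+ k * _.
have zN : z ^+ N = 1.
  by rewrite /z exprMn -!exprM rmorphXn/= -exprM ![(_ * N)%N]mulnC !exprM -rmorphXn/= (prim_expr_order hw) rmorph1 !expr1n mulr1.
have z1 : z != 1.
  apply: contra lk => /eqP h; have : w ^+ k = w ^+ l.
    have wl : (w ^+ l)^* * w ^+ l = 1 by rewrite mulrC -normCK normrX w1 !expr1n.
    by rewrite -[LHS]mulr1 -wl mulrA -/z h mul1r.
  move=> /eqP; rewrite (eq_prim_root_expr hw) !modn_small// => /eqP e.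
  by apply/eqP/val_inj.
suff -> : \sum_(j < N) z ^+ j = 0 by rewrite mulr0.
by apply/eqP; have := subrX1 z N; rewrite zN subrr => /esym/eqP; rewrite mulf_eq0 subr_eq0 (negbTE z1).
Qed.

End maximum_principle.

Section maximum_principle.
Context {R : realType} {n : nat}.
Local Notation C := R[i].

Lemma cvg_real_sum (I : Type) (s : seq I) (P : pred I) (F : I -> nat -> R) (l : I -> R) :
  (forall i, P i -> F i @ \oo --> l i) ->
  (fun k => \sum_(i <- s | P i) F i k) @ \oo --> \sum_(i <- s | P i) l i.
Proof. by move=> h; apply: cvg_big => //; exact: add_continuous. Qed.

Lemma cvg0_lin (c d : R) (x y : nat -> R) : x @ \oo --> (0 : R) -> y @ \oo --> (0 : R) ->
  (fun k => c * x k + d * y k) @ \oo --> (0 : R).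
Proof.
move=> hx hy; have := cvgD (cvgM (cvg_cst c) hx) (cvgM (cvg_cst d) hy).
rewrite !mulr0 addr0 => h; exact: h.
Qed.

(** The difference of the two sides, times s, is |s u - v|^2. As s tends to 0 the factor of |u|^2
    tends to 1; the factor 2 of the simpler inequality would destroy contractivity. *)
Lemma sqvD_eps (s : R) (u v : 'cV[C]_n) : 0 < s ->
  sqv (u + v) <= (1 + s) * sqv u + (1 + s^-1) * sqv v.
Proof.
move=> s0; have si := @semi_inner_dotc R n.
have h := sqv_ge0 (s%:C%C *: u - v).
suff e : s * ((1 + s) * sqv u + (1 + s^-1) * sqv v - sqv (u + v)) = sqv (s%:C%C *: u - v).
  by rewrite -subr_ge0 -(pmulr_rge0 _ s0) e.
rewrite /sqv /sqn !(ipBl si)// !(ipBr si)// !(ipDl si)// !(ipDr si)// !(ipZl si)// !(ipZr si)//.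
rewrite [(s%:C%C)^*]conjc_real (siC si (I : [set: 'cV[C]_n] u) (I : [set: 'cV[C]_n] v)).
have zs : s != 0 by rewrite gt_eqF.
case: (dotc u u) (dotc v v) (dotc u v) => [a a'] [b b'] [c c'] /=.
by field.
Qed.

(** Uniformity over the circle |z| = r is the point: the error survives averaging over L points with
    L growing. *)
Lemma uniform_tail (b : nat -> 'cV[C]_n) F (r : R) : power_series_on_disc b F -> 0 < r < 1 ->
  exists2 e : nat -> R, e @ \oo --> (0 : R) &
    forall L w, `|dval w| = r%:C%C -> sqv (F w - \sum_(k < L) dval w ^+ k *: b k) <= e L.
Proof.
move=> hF /andP[r0 r1]; have pb := power_series_pbounded hF.
have nr : `|r%:C%C| = r%:C%C :> C by rewrite ger0_norm// ler0c ltW.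
have rl : `|r%:C%C| < 1 :> C by rewrite nr -[1]/(1%:C%C) ltcR.
have ex i : exists Mq : R * R, [/\ 0 <= Mq.2, Mq.2 < 1 &
    forall k, `|r%:C%C ^+ k * b k i 0| <= (geometric Mq.1 Mq.2 k)%:C%C].
  by have [M [q [M0 q0 q1 h]]] := geometric_bound (pb i 0) rl; exists (M, q).
have [Mq hMq] := choice ex.
pose M i := (Mq i).1; pose q i := (Mq i).2.
pose d i L := M i / (1 - q i) - series (geometric (M i) (q i)) L.
have gc i : series (geometric (M i) (q i)) @ \oo --> M i / (1 - q i).
  by apply: cvg_geometric_series; have [q0 q1 _] := hMq i; rewrite ger0_norm.
have d0 i : d i @ \oo --> (0 : R).
  by rewrite -(subrr (M i / (1 - q i))); exact: (cvgB (cvg_cst _) (gc i)).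
exists (fun L => \sum_i d i L * d i L).
  have e0 : \sum_(i < n) (0 : R) = 0 by rewrite big1.
  rewrite -[X in _ --> X]e0.
  apply: cvg_real_sum => i _; rewrite -[X in _ --> X](mulr0 0).
  exact: (cvgM (d0 i) (d0 i)).
move=> L w hw; rewrite -lecR sqvE rmorph_sum/=; apply: ler_sum => i _.
have t k : `|dval w ^+ k * b k i 0| <= (geometric (M i) (q i) k)%:C%C.
  by have [_ _ h] := hMq i; rewrite normrM normrX hw -nr -normrX -normrM; exact: h.
have := series_tail_le t ((power_seriesP _ _).1 hF w i 0) (gc i) L.
rewrite -/(d i L) => h; have d_ge0 := le_trans (normr_ge0 _) h.
have -> : (F w - \sum_(k < L) dval w ^+ k *: b k) i 0 = F w i 0 - series (fun k => dval w ^+ k * b k i 0) L.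
  rewrite !mxE summxE /series /= big_mkord; congr (_ - _).
  by apply: eq_bigr => k _; rewrite mxE.
by rewrite rmorphM/= -expr2 lerXn2r.
Qed.

Lemma bernoulli_le (x : R) m : 0 <= x <= 1 -> 1 - m%:R * x <= (1 - x) ^+ m.
Proof.
move=> /andP[x0 x1]; elim: m => [|m IH]; first by rewrite mul0r subr0 expr0.
rewrite exprS -natr1; have h : 0 <= 1 - x by lra.
have := ler_wpM2l h IH; have m0 : 0 <= m%:R :> R by []; nra.
Qed.

(** Truncate both series at L terms, compare them at the points r w^j for w a primitive L-th root of
    unity, and average: orthogonality turns pointwise domination into a comparison of sums of r^(2
    k) |b_k|^2 and r^(2 k) |a_k|^2, up to truncation errors. First L tends to infinity, then r to 1
    and s to 0. *)
Lemma maximum_principle (U F : disc R -> 'cV[C]_n) a b : coefs U a ->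
  power_series_on_disc b F -> (forall w, sqv (F w) <= sqv (U w)) ->
  forall M, \sum_(k < M) sqv (b k) <= sqn hardy_dot U.
Proof.
move=> hU hF FU M; have [hUp lU] := hU; set S := sqn hardy_dot U.
have S0 : 0 <= S by apply: (sqn_ge0 semi_inner_hardy); apply/hardyP; exists a.
set B := \sum_(k < M) _.
have B0 : 0 <= B by apply: sumr_ge0 => *; exact: sqv_ge0.
have key (r s : R) : 0 < r < 1 -> 0 < s -> r ^+ (2 * M) * B <= (1 + s) ^+ 2 * S.
  move=> r01 s0; have [eF eF0 hF'] := uniform_tail hF r01; have [eU eU0 hU'] := uniform_tail hUp r01.
  have /andP[r0 r1] := r01.
  have si0 : 0 < s^-1 by rewrite invr_gt0.
  pose eps L := (1 + s) * (1 + s^-1) * eU L + (1 + s^-1) * eF L.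
  have epsc : (fun L => (1 + s) ^+ 2 * S + eps L) @ \oo --> (1 + s) ^+ 2 * S.
    have := cvgD (cvg_cst ((1 + s) ^+ 2 * S)) (cvg0_lin ((1 + s) * (1 + s^-1)) (1 + s^-1) eU0 eF0).
    rewrite addr0 => h; exact: h.
  apply: (@ler_cvg_to _ _ eventually_filter _ (cst _) _ _ _ (cvg_cst _) epsc).
  exists M.+1 => // L /= ML; have L0 : (0 < L)%N by lia.
  have [w hw] := @prim_root_exists R L L0; have w1 := prim_root_norm L0 hw.
  have pt j : sqv (\sum_(k < L) (r%:C%C * w ^+ j) ^+ k *: b k) <=
       (1 + s) ^+ 2 * sqv (\sum_(k < L) (r%:C%C * w ^+ j) ^+ k *: a k) + eps L.
    have nz : `|r%:C%C * w ^+ j| = r%:C%C.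
      by rewrite normrM normrX w1 expr1n mulr1 ger0_norm// ler0c ltW.
    have [|z hz] := @disc_ex R (r%:C%C * w ^+ j); first by rewrite nz -[1]/(1%:C%C) ltcR.
    rewrite -hz in nz *; have h1 := hF' L z nz; have h2 := hU' L z nz.
    set FL := \sum_(k < L) _ in h1 *; set UL := \sum_(k < L) _ in h2 *.
    have e1 : FL = F z + - (F z - FL) by rewrite opprB addrC subrK.
    have e2 : U z = UL + (U z - UL) by rewrite addrC subrK.
    have sN v : sqv (- v) = sqv v :> R.
      by apply: complexI; rewrite -scaleN1r [LHS]sqvZ normrN1 expr1n mul1r.
    have i1 := sqvD_eps (F z) (- (F z - FL)) s0; rewrite -e1 sN in i1.
    have i2 := sqvD_eps UL (U z - UL) s0; rewrite -e2 in i2.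
    have i3 := FU z; apply: (le_trans i1); rewrite /eps.
    have s1 : 0 <= 1 + s by rewrite addr_ge0// ltW.
    have s2 : 0 <= 1 + s^-1 by rewrite addr_ge0// invr_ge0 ltW.
    have j1 := ler_wpM2l s1 (le_trans i3 i2).
    have j2 := ler_wpM2l s2 h1.
    have j3 := ler_wpM2l (mulr_ge0 s1 s2) h2.
    rewrite expr2; move: j1 j2 j3; rewrite mulrDr !mulrA; lra.
  have sm : \sum_(j < L) sqv (\sum_(k < L) (r%:C%C * w ^+ j) ^+ k *: b k) <=
     \sum_(j < L) ((1 + s) ^+ 2 * sqv (\sum_(k < L) (r%:C%C * w ^+ j) ^+ k *: a k) + eps L).
    by apply: ler_sum => j _; exact: pt.
  have Lp : 0 < L%:R :> R by rewrite ltr0n.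
  move: sm; rewrite big_split/= sumr_const card_ord -mulr_sumr !(root_average _ _ L0 hw).
  have -> (x y z : R) : x * (L%:R * y) + z *+ L = L%:R * (x * y + z).
    by rewrite -mulr_natl; ring.
  rewrite ler_pM2l// => sm.
  apply: (le_trans _ (le_trans sm _)).
    rewrite /B mulr_sumr -!(big_mkord xpredT (fun k => r ^+ (2 * M) * sqv (b k))) -(big_mkord xpredT (fun k => r ^+ (2 * k) * sqv (b k))).
    have ML' := ltnW ML.
    rewrite (big_cat_nat (leq0n M) ML')/= -[leLHS]addr0 lerD//.
      rewrite big_nat_cond [leRHS]big_nat_cond; apply: ler_sum => k /andP[/andP[_ kM] _].
      rewrite ler_wpM2r ?sqv_ge0// ler_wiXn2l ?(ltW r0) ?(ltW r1)//.
      by rewrite leq_mul2l (ltnW kM) orbT.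
    by apply: sumr_ge0 => k _; rewrite mulr_ge0 ?sqv_ge0// exprn_ge0// ltW.
  rewrite lerD2r ler_wpM2l ?sqr_ge0//.
  apply: (le_trans _ (sqn_hardy_ge L hU)); apply: ler_sum => k _.
  by rewrite ler_piMl ?sqv_ge0// exprn_ile1 ?(ltW r0) ?(ltW r1).
(* One parameter h = 1/(m + 1) drives both limits, with r = 1 - h/2 and s = h; Bernoulli gives r^(2
   M) >= 1 - M h. *)
have hh := @cvg_harmonic R.
have h0 m : 0 < harmonic m :> R by rewrite /harmonic invr_gt0 ltr0n.
have h1 m : harmonic m <= 1 :> R by rewrite /harmonic invf_le1 ?ler1n ?ltr0n.
apply: (@ler_cvg_to _ _ eventually_filter _ (fun m => (1 - M%:R * harmonic m) * B)
  (fun m => (1 + harmonic m) * (1 + harmonic m) * S)).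
- have c : (fun m => (1 - M%:R * harmonic m) * B) @ \oo --> (1 - M%:R * 0) * B.
    by apply: (cvgM (cvgB (cvg_cst _) (cvgM (cvg_cst _) hh)) (cvg_cst _)).
  by rewrite mulr0 subr0 mul1r in c; exact: c.
- have c1 : (fun m => 1 + harmonic m) @ \oo --> (1 + 0 : R) by exact: (cvgD (cvg_cst _) hh).
  have c : (fun m => (1 + harmonic m) * (1 + harmonic m) * S) @ \oo --> (1 + 0) * (1 + 0) * S.
    by exact: (cvgM (cvgM c1 c1) (cvg_cst _)).
  by rewrite addr0 !mul1r in c; exact: c.
- apply: nearW => m; have := h0 m; have := h1 m; move: (harmonic m) => h hm1 hm.
  have hr : 0 < 1 - h / 2 < 1 by lra.
  rewrite -expr2; apply: (le_trans _ (key (1 - h / 2) h hr hm)).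
  have hb : 0 <= h / 2 <= 1 by lra.
  rewrite ler_wpM2r//; apply: (le_trans _ (bernoulli_le (2 * M) hb)).
  by rewrite natrM; lra.
Qed.

End maximum_principle.

(** * Szego kernels and the invertibility of 1 - Theta(z) *)

Section szego_kernel.
Context {R : realType} {n : nat}.
Local Notation C := R[i].

Lemma dotc_evaluation_cvg (a : nat -> 'cV[C]_n) (f : disc R -> 'cV[C]_n) (w : disc R) v :
  power_series_on_disc a f ->
  series (fun k => dotc (a k) ((dval w)^* ^+ k *: v)) @ \oo --> dotc (f w) v.
Proof.
move=> /power_seriesP h; rewrite (_ : series _ = fun N => \sum_i cpseries (fun k => a k i 0) (dval w) N * (v i 0)^*).
  by apply: cvg_complex_sum => i _; exact: (cvgM (h w i 0) (cvg_cst _)).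
apply/funext => N; rewrite /cpseries /series /=.
under [RHS]eq_bigr do rewrite mulr_suml.
rewrite exchange_big; apply: eq_bigr => k _ /=; rewrite /dotc; apply: eq_bigr => i _.
by rewrite mxE rmorphM rmorphXn/= conjCK mulrCA mulrA.
Qed.

Lemma szego_l2 (w : disc R) (v : 'cV[C]_n) : l2 (fun k => (dval w)^* ^+ k *: v).
Proof.
have w1 := dval_lt1 w; set x := complex.Re `|dval w|.
have xw : `|dval w| = x%:C%C by rewrite -normc_real.
have x0 : 0 <= x by rewrite -ler0c -xw.
have x1 : x < 1 by rewrite -ltcR -xw.
have e k : sqv ((dval w)^* ^+ k *: v) = geometric (sqv v) (x ^+ 2) k.
  apply: complexI; rewrite [LHS]sqvZ normrX norm_conjC xw /geometric /= rmorphM/= mulrC.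
  by rewrite exprAC !rmorphXn.
rewrite /l2 (_ : (fun k => _) = geometric (sqv v) (x ^+ 2)); last by apply/funext.
by apply: is_cvg_geometric_series; rewrite ger0_norm ?sqr_ge0// expr_lt1.
Qed.

(** The function is v / (1 - conj(w) z), with coefficients conj(w)^k v. Its value at 0 is recorded
    because invertibility at [w] is reduced to the hypothesis at 0. *)
Lemma szego_ex (w : disc R) (v : 'cV[C]_n) :
  exists k : disc R -> 'cV[C]_n, [/\ hardy k, k disc0 = v &
    forall f, hardy f -> hardy_dot f k = dotc (f w) v].
Proof.
have lk : l2 (fun k => (dval w)^* ^+ k *: v) by exact: szego_l2.
have [k Hk hk] := l2_hardy lk; exists k; split => //.
  by case: hk => h _; rewrite (power_series_disc0 h) expr0 scale1r.
move=> f /hardyP[a ha].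
apply: (cvg_complex_uniq (hardy_dot_cvg ha hk)).
by apply: dotc_evaluation_cvg; case: ha.
Qed.

End szego_kernel.

Section contractive_multiplier.
Context {R : realType} {n : nat}.
Local Notation C := R[i].
Variable Theta : disc R -> 'M[C]_n.
Hypothesis Theta_analytic : analytic Theta.
Hypothesis Theta_pc : purely_contractive Theta.

Let si := @semi_inner_hardy R n.
Local Notation T := (Tmul Theta).

Lemma Tmul_coefs u : hardy u ->
  exists b, coefs (T u) b /\ forall M, \sum_(k < M) sqv (b k) <= sqn hardy_dot u.
Proof.
move=> /hardyP[a ha]; have [Th hTh] := Theta_analytic.
have hb := power_seriesM hTh (proj1 ha).
have cw w : sqv (Theta w *m u w) <= sqv (u w).
  by have [h _] := Theta_pc; exact: (opnorm_le1 (u w) (h w)).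
have mp := maximum_principle ha hb cw.
exists (mconv Th a); split; last exact: mp.
split; [exact: hb|exact: l2_of_bounded mp].
Qed.

Lemma Tmul_hardy u : hardy u -> hardy (T u).
Proof. by move=> /Tmul_coefs[b [hb _]]; apply/hardyP; exists b. Qed.

Lemma Tmul_linear (c : C) u v : hardy u -> hardy v -> T (c *: u + v) = c *: T u + T v.
Proof.
by move=> _ _; apply/funext => w; rewrite /Tmul /= mulmxDr -scalemxAr.
Qed.

Lemma Tmul_contraction u : hardy u -> sqn hardy_dot (T u) <= sqn hardy_dot u.
Proof. by move=> /Tmul_coefs[b [hb h]]; exact: (sqn_hardy_le hb). Qed.

Let definite := @hardy_definite R n.
Let rep := @hardy_representable R n.

(** Otherwise the adjoint of Theta(w) fixes some x != 0, and T^* fixes the Szego kernel k at w in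
    direction x, because T^* acts on such kernels through the adjoint of Theta(w). By
    [contraction_fixed] T k = k, and evaluation at 0 gives Theta(0) x = x, against the strict bound
    there. *)
Lemma unitmx_1_sub_contraction w : 1%:M - Theta w \in unitmx.
Proof.
apply: contraT => nu.
(* [kermx] is a left kernel: it yields a row y with y (1 - Theta w) = 0, whose conjugate transpose
   is the vector sought. *)
have [x x0 xT] : exists2 x : 'cV[C]_n, x != 0 & adjmx (Theta w) *m x = x.
  have : kermx (1%:M - Theta w) != 0.
    by rewrite kermx_eq0 row_free_unit.
  move=> /rowV0Pn[y /sub_kermxP hy y0].
  exists (map_mx Num.conj y)^T.
    apply: contra y0 => /eqP h; apply/eqP/matrixP => i j.
    have := congr1 (fun A : 'cV[C]_n => A j i) h; rewrite !mxE => /eqP.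
    by rewrite conjC_eq0 => /eqP ->.
  rewrite /adjmx -trmx_mul -map_mxM; congr (map_mx _ _)^T.
  by apply/eqP; rewrite eq_sym -subr_eq0 -{1}[y]mulmx1 -mulmxBr hy.
have [k [Hk k0 hk]] := szego_ex w x.
have Tk : adjoint hardy hardy_dot T k = k.
  have HTk := in_adjoint si rep Tmul_hardy Tmul_linear Tmul_contraction Hk.
  apply: (in_ip_inj si definite HTk Hk).
  move=> u Hu; rewrite -(adjointE si rep Tmul_hardy Tmul_linear Tmul_contraction Hu Hk).
  by rewrite (hk _ Hu) (hk _ (Tmul_hardy Hu)) /Tmul dotc_adjmx xT.
have := contraction_fixed si definite rep Tmul_hardy Tmul_linear Tmul_contraction Hk Tk.
move=> /(congr1 (fun f => f disc0)); rewrite /Tmul k0 => h.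
have [_ h1] := Theta_pc.
by rewrite (opnorm_lt1_fixed h1 h) eqxx in x0.
Qed.

End contractive_multiplier.

(** * Membership in the de Branges-Rovnyak space *)

Section shift.
Context {R : realType} {n : nat}.
Local Notation C := R[i].
Let si := @semi_inner_hardy R n.

Definition shift_coef (a : nat -> 'cV[C]_n) k := if k is k'.+1 then a k' else 0.

Lemma sqv0 : sqv (0 : 'cV[C]_n) = 0.
Proof. by rewrite /sqv /sqn (ip0l semi_inner_dotc). Qed.

Lemma shift_coefs (u : disc R -> 'cV[C]_n) a : coefs u a -> coefs (Defs.shift u) (shift_coef a).
Proof.
move=> [ha la]; split.
  move/power_seriesP: ha => ha; apply/power_seriesP => w i j; rewrite /Defs.shift mxE.
  rewrite -(@cvg_shiftS _ _ _).
  have e : (fun N => cpseries (fun k => shift_coef a k i j) (dval w) N.+1) =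
      fun N => dval w * cpseries (fun k => a k i j) (dval w) N.
    apply/funext => N; rewrite /cpseries /series /= big_nat_recl//= mxE mulr0 add0r mulr_sumr.
    by apply: eq_bigr => k _; rewrite exprS mulrA.
  rewrite [X in X @ _]e; exact: (cvgM (cvg_cst _) (ha w i j)).
apply: (@l2_of_bounded _ _ _ (limn (series (fun k => sqv (a k))))) => -[|N].
  by rewrite big_ord0 (le_trans _ (l2_partial_le 0 la))// big_ord0.
by rewrite big_ord_recl /= sqv0 add0r; exact: l2_partial_le.
Qed.

(** The backward shift satisfies the defining relation of the adjoint, and definiteness of the Hardy
    inner product identifies it with the chosen one. *)
Lemma shift_adj_coefs (f : disc R -> 'cV[C]_n) a : coefs f a ->
  coefs (shift_adj f) (fun k => a k.+1).
Proof.
move=> hf; have [_ la] := hf.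
have l1 : l2 (fun k => a k.+1).
  apply: (@l2_of_bounded _ _ _ (limn (series (fun k => sqv (a k))))) => N.
  by apply: (le_trans _ (l2_partial_le N.+1 la)); rewrite big_ord_recl /= lerDr sqv_ge0.
have [g Hg hg] := l2_hardy l1.
have Hf : hardy f by apply/hardyP; exists a.
have gE (u : disc R -> 'cV[C]_n) : hardy u -> hardy_dot (Defs.shift u) f = hardy_dot u g.
  move=> /hardyP[b hb]; have h := hardy_dot_cvg (shift_coefs hb) hf.
  rewrite -(@cvg_shiftS _ _ _) in h.
  apply: (cvg_complex_uniq h); rewrite [X in X @ _](_ : _ = series (fun k => dotc (b k) (a k.+1))).
    exact: hardy_dot_cvg.
  apply/funext => N; rewrite /series /= big_nat_recl//= (ip0l semi_inner_dotc)// add0r.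
  by apply: eq_bigr.
have [HS hS] : hardy (shift_adj f) /\
    forall u : disc R -> 'cV[C]_n, hardy u -> hardy_dot (Defs.shift u) f = hardy_dot u (shift_adj f).
  by apply: adjoint_spec; exists g.
suff -> : shift_adj f = g by [].
apply: (in_ip_inj si (@hardy_definite R n) HS Hg) => u Hu.
by rewrite -(hS _ Hu) (gE _ Hu).
Qed.

End shift.

Section delta_sequences.
Context {R : realType} {n : nat}.
Local Notation C := R[i].
Variables (j : nat) (i : 'I_n).

Definition delta_seq k : 'cV[C]_n := if k == j then delta_mx i 0 else 0.

Lemma delta_l2 : l2 delta_seq.
Proof.
apply: (@l2_of_bounded _ _ _ (sqv (delta_mx i 0 : 'cV[C]_n))) => N.
rewrite /delta_seq; have [jN|jN] := ltnP j N.
  rewrite (bigD1 (Ordinal jN))//= eqxx big1 ?addr0// => k kj.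
  by rewrite ifN ?sqv0//; apply: contra kj => /eqP e; apply/eqP/val_inj.
rewrite big1 ?sqv_ge0// => k _; rewrite ifN ?sqv0//.
by apply/eqP => e; have := ltn_ord k; rewrite e ltnNge jN.
Qed.

Lemma delta_dot_cvg (b : nat -> 'cV[C]_n) :
  series (fun k => dotc (b k) (delta_seq k)) @ \oo --> b j i 0.
Proof.
apply: (complex_squeeze (b := cst 0)); last exact: cvg_cst.
exists j.+1 => // N /= jN; rewrite /series /= big_mkord (bigD1 (Ordinal jN))//= big1 => [|k kj].
  by rewrite /delta_seq eqxx dotc_delta addr0 subrr normr0.
rewrite /delta_seq ifN; first by rewrite (ip0r semi_inner_dotc).
by apply: contra kj => /eqP e; apply/eqP/val_inj.
Qed.

Lemma mconv_delta (Th : nat -> 'M[C]_n) k :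
  mconv Th delta_seq k = if (j <= k)%N then Th (k - j)%N *m delta_mx i 0 else 0.
Proof.
rewrite /mconv; case: leqP => jk.
  have jk' : (k - j < k.+1)%N by lia.
  rewrite (bigD1 (Ordinal jk'))//= big1 => [|l lk].
    by rewrite addr0 /delta_seq subKn// eqxx.
  rewrite /delta_seq ifN ?mulmx0//; apply: contra lk => /eqP e; apply/eqP/val_inj => /=.
  by have := ltn_ord l; lia.
rewrite big1// => l _; rewrite /delta_seq ifN ?mulmx0//; apply/eqP.
by have := ltn_ord l; lia.
Qed.

(** Coefficient m of T^* u, where T is multiplication by the series with coefficients [Th] and [u]
    is cut off at index N. *)
Definition trunc_adj (Th : nat -> 'M[C]_n) (u : nat -> 'cV[C]_n) N m :=
  \sum_(m <= k < N) adjmx (Th (k - m)%N) *m u k.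

Lemma trunc_adj_delta Th (a : nat -> 'cV[C]_n) :
  (fun N => trunc_adj Th a N j i 0) = series (fun k => dotc (a k) (mconv Th delta_seq k)).
Proof.
apply/funext => N; rewrite /trunc_adj summxE /series /=.
have [jN|jN] := leqP j N.
  rewrite [RHS](big_cat_nat (leq0n j) jN)/= [X in _ = X + _]big_nat_cond [X in _ = X + _]big1 ?add0r => [|k /andP[/andP[_ kj] _]].
    rewrite [RHS]big_nat_cond [LHS]big_nat_cond; apply: eq_bigr => k /andP[/andP[jk _] _].
    by rewrite mconv_delta jk -[Th _ in RHS]adjmxK -dotc_adjmx dotc_delta.
  by rewrite mconv_delta leqNgt kj/= (ip0r semi_inner_dotc).
rewrite big_geq ?(ltnW jN)// big_nat_cond big1// => k /andP[/andP[_ kN] _].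
by rewrite mconv_delta leqNgt (ltn_trans kN jN)/= (ip0r semi_inner_dotc).
Qed.

End delta_sequences.

Section de_branges_rovnyak.
Context {R : realType} {n : nat}.
Local Notation C := R[i].
Variable Theta : disc R -> 'M[C]_n.
Hypothesis Theta_analytic : analytic Theta.
Hypothesis Theta_pc : purely_contractive Theta.
Variable Th : nat -> 'M[C]_n.
Hypothesis ThE : power_series_on_disc Th Theta.

Let si := @semi_inner_hardy R n.
Let definite := @hardy_definite R n.
Let rep := @hardy_representable R n.
Local Notation T := (Tmul Theta).
Let HT := Tmul_hardy Theta_analytic Theta_pc.
Let lT := @Tmul_linear R n Theta.
Let cT := Tmul_contraction Theta_analytic Theta_pc.

Lemma dBR_of_bound h (c : R) : hardy h -> 0 <= c ->
  (forall u, hardy u -> `|hardy_dot u h| ^+ 2 <=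
    (c * (sqn hardy_dot u - sqn hardy_dot (Tmul_adj Theta u)))%:C%C) ->
  dBR Theta h.
Proof.
move=> Hh c0 hb.
have D := defect_root_spec si definite rep HT lT cT.
have [|w Hw hw] := psqrt_range si (@hardy_complete R n) definite D Hh c0.
  move=> u Hu; rewrite (ip_defect si rep HT lT cT Hu); exact: hb.
by exists w.
Qed.

Local Notation trunc_adj := (trunc_adj Th).

(** Testing T^* u against z^j e_i gives (u, T z^j e_i), a series whose N-th partial sum is exactly
    the truncated adjoint. *)
Lemma Tmul_adj_coefs u a b j i : coefs u a -> coefs (Tmul_adj Theta u) b ->
  (fun N => trunc_adj a N j i 0) @ \oo --> b j i 0.
Proof.
move=> hu hb; have Hu : hardy u by apply/hardyP; exists a.
have ld := @delta_l2 R n j i.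
have [m Hm hm] := l2_hardy ld.
have hTm : coefs (T m) (mconv Th (delta_seq j i)).
  have [b' [[hb' lb'] _]] := Tmul_coefs Theta_analytic Theta_pc Hm.
  have h := power_seriesM ThE (proj1 hm).
  by split; [exact: h|rewrite (power_series_coef_uniq h hb')].
have e1 := hardy_dot_cvg hu hTm.
have e2 := hardy_dot_cvg hb hm.
have := adjointEr si rep HT lT cT Hm Hu; rewrite -/(Tmul_adj Theta u) => ee.
rewrite -(cvg_complex_uniq e2 (@delta_dot_cvg _ _ j i b)) -ee.
suff -> : (fun N => trunc_adj a N j i 0) = series (fun k => dotc (a k) (mconv Th (delta_seq j i) k)).
  exact: e1.
exact: trunc_adj_delta.
Qed.

(** Reduces the range criterion to finite sequences, the only ones for which the identity between
    [Theta] and [Om] is a finite computation. *)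
Lemma dBR_of_truncated_bound h v (c : R) : power_series_on_disc v h -> 0 <= c ->
  (forall (u : nat -> 'cV[C]_n) N, `|\sum_(k < N) dotc (u k) (v k)| ^+ 2 <=
    (c * (\sum_(k < N) sqv (u k) - \sum_(j < N) sqv (trunc_adj u N j)))%:C%C) ->
  hardy h /\ dBR Theta h.
Proof.
move=> hv c0 hb.
have lv : l2 v.
  apply: (@l2_of_bounded _ _ _ c) => N.
  (* For u = v the left side is S^2 and the right side at most c S, so S <= c. *)
  have := hb v N; set S := \sum_(k < N) sqv (v k).
  have S0 : 0 <= S by apply: sumr_ge0 => *; exact: sqv_ge0.
  have -> : \sum_(k < N) dotc (v k) (v k) = S%:C%C.
    rewrite rmorph_sum/=; apply: eq_bigr => k _.
    by rewrite -(sqnE semi_inner_dotc).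
  rewrite ger0_norm ?ler0c// -[X in X <= _](rmorphXn (real_complex R)) lecR.
  set D := \sum_(_ < _) _; have D0 : 0 <= D by apply: sumr_ge0 => *; exact: sqv_ge0.
  move=> hS; rewrite leNgt; apply/negP => cS; nra.
have hh : coefs h v by split.
have Hh : hardy h by apply/hardyP; exists v.
split=> //; apply: (dBR_of_bound Hh c0) => u Hu.
have [a ha] := (hardyP u).1 Hu.
have HTu := in_adjoint si rep HT lT cT Hu.
have [b hb'] := (hardyP _).1 HTu.
set X := hardy_dot u h; pose x := complex.Re X ^+ 2 + complex.Im X ^+ 2.
have xX : `|X| ^+ 2 = x%:C%C by rewrite add_Re2_Im2.
rewrite xX lecR mulrBr lerBrDr.
pose s N := \sum_(k < N) dotc (a k) (v k).
have sX : s @ \oo --> X.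
  rewrite (_ : s = series (fun k => dotc (a k) (v k))); first exact: hardy_dot_cvg.
  by apply/funext => N; rewrite /s /series /= big_mkord.
pose ss N := complex.Re (s N) * complex.Re (s N) + complex.Im (s N) * complex.Im (s N).
have ssX : ss @ \oo --> x.
  have h1 := cvg_complex_Re sX; have h2 := cvg_complex_Im sX.
  by rewrite /x !expr2; exact: (cvgD (cvgM h1 h1) (cvgM h2 h2)).
(* The truncated adjoints are known to converge only coefficient by coefficient, so M of them are
   kept while N tends to infinity, and M tends to infinity afterwards. *)
have fin M : x + c * \sum_(j < M) sqv (b j) <= c * sqn hardy_dot u.
  apply: (@ler_cvg_to _ _ eventually_filter _
    (fun N => ss N + c * \sum_(j < M) sqv (trunc_adj a N j)) (cst _) _ _ _ (cvg_cst _)).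
    have tc : (fun N => \sum_(j < M) sqv (trunc_adj a N j)) @ \oo --> \sum_(j < M) sqv (b j).
      apply: cvg_real_sum => j _; apply: cvg_sqv => i; exact: (Tmul_adj_coefs ha hb').
    exact: (cvgD ssX (cvgM (cvg_cst _) tc)).
  exists M => // N /= MN.
  have := hb a N; rewrite -/(s N) -add_Re2_Im2 lecR !expr2 -/(ss N) mulrBr lerBrDr => hN.
  apply: (@le_trans _ _ (ss N + c * \sum_(j < N) sqv (trunc_adj a N j))).
    rewrite lerD2l ler_wpM2l// -!(big_mkord xpredT (fun j => sqv (trunc_adj a N j))).
    rewrite [leRHS](big_cat_nat (leq0n M) MN)/= lerDl.
    by apply: sumr_ge0 => *; exact: sqv_ge0.
  by apply: (le_trans hN); rewrite ler_wpM2l//; exact: sqn_hardy_ge.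
apply: (@ler_cvg_to _ _ eventually_filter _ (fun M => x + c * series (fun j => sqv (b j)) M) (cst _) _ _ _ (cvg_cst _)).
  exact: (cvgD (cvg_cst _) (cvgM (cvg_cst _) (sqn_hardy_cvg hb'))).
by apply: nearW => M; rewrite /series /= big_mkord; exact: fin.
Qed.

End de_branges_rovnyak.

(** * Integration against a positive matrix measure *)

Section complex_measurability.
Context d (T : measurableType d) (R : realType).
Local Notation C := R[i].
Implicit Types f g : T -> C.

Definition cmeas f : Prop := measurable_fun setT (fun t => complex.Re (f t)) /\
  measurable_fun setT (fun t => complex.Im (f t)).

Lemma cmeas_ext f g : f =1 g -> cmeas f -> cmeas g.
Proof. by move=> /funext ->. Qed.

Lemma cmeas_cst c : cmeas (fun=> c).
Proof. by split; exact: measurable_cst. Qed.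

Lemma cmeas_ReIm (f1 f2 : T -> R) : measurable_fun setT f1 -> measurable_fun setT f2 ->
  cmeas (fun t => f1 t +i* f2 t)%C.
Proof. by split. Qed.

Lemma cmeasD f g : cmeas f -> cmeas g -> cmeas (fun t => f t + g t).
Proof.
move=> [f1 f2] [g1 g2]; split.
  rewrite (_ : (fun t => _) = (fun t => complex.Re (f t)) \+ (fun t => complex.Re (g t))).
    exact: measurable_funD.
  by apply/funext => t; rewrite raddfD.
rewrite (_ : (fun t => _) = (fun t => complex.Im (f t)) \+ (fun t => complex.Im (g t))).
  exact: measurable_funD.
by apply/funext => t; rewrite raddfD.
Qed.

Lemma cmeasM f g : cmeas f -> cmeas g -> cmeas (fun t => f t * g t).
Proof.
move=> [f1 f2] [g1 g2].
apply: (@cmeas_ext (fun t => (complex.Re (f t) * complex.Re (g t) - complex.Im (f t) * complex.Im (g t))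
  +i* (complex.Re (f t) * complex.Im (g t) + complex.Im (f t) * complex.Re (g t)))%C).
  by move=> t; case: (f t) (g t) => [a b] [a' b'].
apply: cmeas_ReIm.
  by apply: measurable_funB; exact: measurable_funM.
by apply: measurable_funD; exact: measurable_funM.
Qed.

Lemma cmeas_conj f : cmeas f -> cmeas (fun t => (f t)^*).
Proof.
move=> [f1 f2].
apply: (@cmeas_ext (fun t => (complex.Re (f t) -i* complex.Im (f t))%C)).
  by move=> t; case: (f t).
by apply: cmeas_ReIm => //; exact: measurable_funN.
Qed.

Lemma cmeas_sum (I : Type) (s : seq I) (P : pred I) (F : I -> T -> C) :
  (forall i, cmeas (F i)) -> cmeas (fun t => \sum_(i <- s | P i) F i t).
Proof.
move=> h; elim: s => [|i s IH].
  by apply: (@cmeas_ext (fun=> 0)); [move=> t; rewrite big_nil|exact: cmeas_cst].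
apply: (@cmeas_ext (fun t => (if P i then F i t else 0) + \sum_(j <- s | P j) F j t)).
  by move=> t; rewrite big_cons; case: ifP => // _; rewrite add0r.
by apply: cmeasD; [case: (P i); [exact: h|exact: cmeas_cst]|exact: IH].
Qed.

Lemma cmeasX f k : cmeas f -> cmeas (fun t => f t ^+ k).
Proof.
move=> h; elim: k => [|k IH]; first exact: cmeas_cst.
apply: (@cmeas_ext (fun t => f t * f t ^+ k)) => [t|]; last exact: cmeasM.
by rewrite [RHS]exprS.
Qed.

Lemma cmeas_cvg (F : nat -> T -> C) f : (forall k, cmeas (F k)) ->
  (forall t, (fun k => F k t) @ \oo --> f t) -> cmeas f.
Proof.
move=> h hf; split.
  apply: (@measurable_fun_cvg _ _ _ _ (fun k t => complex.Re (F k t))).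
    by move=> k; case: (h k).
  by move=> t _; exact: (cvg_complex_Re (hf t)).
apply: (@measurable_fun_cvg _ _ _ _ (fun k t => complex.Im (F k t))).
  by move=> k; case: (h k).
by move=> t _; exact: (cvg_complex_Im (hf t)).
Qed.

Lemma cmeas_indic (A : set T) f : measurable A -> cmeas f ->
  cmeas (fun t => (\1_A t)%:C%C * f t).
Proof.
move=> mA hf; apply: cmeasM => //; apply: cmeas_ReIm; last exact: measurable_cst.
exact: measurable_indic.
Qed.

End complex_measurability.

Section complex_integral.
Context d (T : measurableType d) (R : realType) (mu : {measure set T -> \bar R}).
Local Notation C := R[i].
Implicit Types (f g : T -> C) (A : set T).

Definition cintegrable A f : Prop := mu.-integrable A (EFin \o (fun t => complex.Re (f t))) /\
  mu.-integrable A (EFin \o (fun t => complex.Im (f t))).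

Definition Cint A f : C := Complex (\int[mu]_(t in A) complex.Re (f t)) (\int[mu]_(t in A) complex.Im (f t)).

Lemma CintegralE f : Cintegral mu f = Cint setT f. Proof. by []. Qed.

Lemma cintegrableD A f g : measurable A -> cintegrable A f -> cintegrable A g ->
  cintegrable A (fun t => f t + g t).
Proof.
move=> mA [f1 f2] [g1 g2]; split.
  apply: (eq_integrable mA) (integrableD mA f1 g1) => t _ /=.
  by rewrite raddfD.
by apply: (eq_integrable mA) (integrableD mA f2 g2) => t _ /=; rewrite raddfD.
Qed.

Lemma CintD A f g : measurable A -> cintegrable A f -> cintegrable A g ->
  Cint A (fun t => f t + g t) = Cint A f + Cint A g.
Proof.
move=> mA [f1 f2] [g1 g2]; rewrite /Cint; apply/eqP; rewrite eq_complex /=; apply/andP; split.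
  by rewrite -RintegralD//; apply/eqP/eq_Rintegral => t _; rewrite raddfD.
by rewrite -RintegralD//; apply/eqP/eq_Rintegral => t _; rewrite raddfD.
Qed.

Let ReZ (a : C) (z : C) : complex.Re (a * z) = complex.Re a * complex.Re z - complex.Im a * complex.Im z.
Proof. by case: a z => [? ?] [? ?]. Qed.
Let ImZ (a : C) (z : C) : complex.Im (a * z) = complex.Re a * complex.Im z + complex.Im a * complex.Re z.
Proof. by case: a z => [? ?] [? ?]. Qed.

Let intZ A (f : T -> R) (a : R) : measurable A -> mu.-integrable A (EFin \o f) ->
  mu.-integrable A (EFin \o (fun t => a * f t)).
Proof.
move=> mA hf; apply: (eq_integrable mA) (integrableZl mA a hf) => t _ /=.
by rewrite EFinM.
Qed.

Lemma cintegrableZ A f (a : C) : measurable A -> cintegrable A f ->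
  cintegrable A (fun t => a * f t).
Proof.
move=> mA [f1 f2]; split.
  apply: (eq_integrable mA) (integrableB mA (intZ (complex.Re a) mA f1) (intZ (complex.Im a) mA f2)) => t _ /=.
  by rewrite ReZ.
apply: (eq_integrable mA) (integrableD mA (intZ (complex.Re a) mA f2) (intZ (complex.Im a) mA f1)) => t _ /=.
by rewrite ImZ.
Qed.

Lemma CintZ A f (a : C) : measurable A -> cintegrable A f ->
  Cint A (fun t => a * f t) = a * Cint A f.
Proof.
move=> mA [f1 f2]; rewrite /Cint; apply/eqP; rewrite eq_complex ReZ ImZ /=; apply/andP; split.
  rewrite -!RintegralZl// -RintegralB//; [|exact: intZ|exact: intZ].
  by apply/eqP/eq_Rintegral => t _; rewrite ReZ.
rewrite -!RintegralZl// -RintegralD//; [|exact: intZ|exact: intZ].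
by apply/eqP/eq_Rintegral => t _; rewrite ImZ.
Qed.

Lemma cintegrable0 A : measurable A -> cintegrable A (fun=> 0).
Proof. by move=> mA; split; exact: integrable0. Qed.

Lemma Cint0 A : Cint A (fun=> 0) = 0.
Proof. by rewrite /Cint /Rintegral integral0. Qed.

Lemma cintegrable_sum A (I : Type) (s : seq I) (F : I -> T -> C) : measurable A ->
  (forall i, cintegrable A (F i)) -> cintegrable A (fun t => \sum_(i <- s) F i t).
Proof.
move=> mA h; elim: s => [|i s IH].
  rewrite (_ : (fun t => _) = (fun=> 0)); first exact: cintegrable0.
  by apply/funext => t; rewrite big_nil.
rewrite (_ : (fun t => _) = fun t => F i t + \sum_(j <- s) F j t); first exact: cintegrableD.
by apply/funext => t; rewrite big_cons.
Qed.

Lemma Cint_sum A (I : Type) (s : seq I) (F : I -> T -> C) : measurable A ->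
  (forall i, cintegrable A (F i)) ->
  Cint A (fun t => \sum_(i <- s) F i t) = \sum_(i <- s) Cint A (F i).
Proof.
move=> mA h; elim: s => [|i s IH].
  rewrite big_nil (_ : (fun t => _) = (fun=> 0)) ?Cint0//.
  by apply/funext => t; rewrite big_nil.
rewrite big_cons -IH -CintD//; last exact: cintegrable_sum.
by congr Cint; apply/funext => t; rewrite big_cons.
Qed.

Lemma Cint_conj f : cintegrable setT f -> Cint setT (fun t => (f t)^*) = (Cint setT f)^*.
Proof.
move=> [f1 f2]; rewrite /Cint; apply/eqP; rewrite eq_complex /=; apply/andP; split.
  by apply/eqP/eq_Rintegral => t _; case: (f t).
rewrite -mulN1r -RintegralZl//; apply/eqP/eq_Rintegral => t _.
by rewrite mulN1r; case: (f t).
Qed.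

Lemma cintegrable_bound f (g : T -> R) : cmeas f -> mu.-integrable setT (EFin \o g) ->
  (forall t, `|f t| <= (g t)%:C%C) -> cintegrable setT f.
Proof.
move=> [f1 f2] hg h; split.
  apply: (le_integrable measurableT) hg => [|t _ /=]; first exact/measurable_EFinP.
  rewrite lee_fin -lecR (le_trans (normc_ge_Re _))// (le_trans (h t))// lecR ler_norm//.
apply: (le_integrable measurableT) hg => [|t _ /=]; first exact/measurable_EFinP.
rewrite lee_fin -lecR; apply: (@le_trans _ _ `|f t|); last by rewrite (le_trans (h t))// lecR ler_norm.
rewrite normc_def lecR -sqrtr_sqr ler_wsqrtr// lerDr; exact: sqr_ge0.
Qed.

Lemma Cint_ge0 f : (forall t, 0 <= f t) -> 0 <= Cint setT f.
Proof.
move=> h; have him t : complex.Im (f t) = 0 by have := h t; rewrite lecE => /andP[/eqP].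
have hre t : 0 <= complex.Re (f t) by have := h t; rewrite lecE => /andP[].
rewrite lecE /Cint /=; apply/andP; split; last exact: Rintegral_ge0.
by under eq_Rintegral do rewrite him; rewrite /Rintegral integral0.
Qed.

Lemma ae_eq_Cint f g : cmeas f -> cmeas g -> {ae mu, forall t, f t = g t} -> Cint setT f = Cint setT g.
Proof.
move=> [f1 f2] [g1 g2] fg; rewrite /Cint /Rintegral; congr (fine _ +i* fine _)%C.
  apply: ae_eq_integral => //; [exact/measurable_EFinP|exact/measurable_EFinP|].
  by apply: filterS fg => t -> _.
apply: ae_eq_integral => //; [exact/measurable_EFinP|exact/measurable_EFinP|].
by apply: filterS fg => t -> _.
Qed.

Lemma ae_eq_integrable (f g : T -> R) : measurable_fun setT f -> measurable_fun setT g ->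
  {ae mu, forall t, f t = g t} -> mu.-integrable setT (EFin \o f) -> mu.-integrable setT (EFin \o g).
Proof.
move=> mf mg fg /integrableP[_ hf]; apply/integrableP; split; first exact/measurable_EFinP.
rewrite (@ae_eq_integral _ _ _ mu setT (fun t => `|(EFin \o f) t|)%E) //.
- by apply: measurableT_comp => //; exact/measurable_EFinP.
- by apply: measurableT_comp => //; exact/measurable_EFinP.
- by apply: filterS fg => t /= -> _.
Qed.

(** On the set where h < 0 the integral of - h is both nonnegative and nonpositive, so h vanishes
    almost everywhere there. *)
Lemma ae_ge0_of_integral_ge0 (h : T -> R) : mu.-integrable setT (EFin \o h) ->
  (forall A, measurable A -> 0 <= \int[mu]_(t in A) h t) -> {ae mu, forall t, 0 <= h t}.
Proof.
move=> ih hA; have mh : measurable_fun setT h by apply/measurable_EFinP; case/integrableP: ih.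
pose A := [set t | h t < 0].
have mA : measurable A.
  have mlt := measurable_fun_ltr mh (measurable_cst (0 : R)).
  have := @mlt measurableT [set true] I.
  by rewrite setTI; congr measurable; apply/seteqP; split=> t /=.
have iA : mu.-integrable A (EFin \o h) by exact: (integrableS measurableT).
have iNA : mu.-integrable A (EFin \o (fun t => -1 * h t)).
  by apply: (eq_integrable mA) (integrableZl mA (-1) iA) => t _ /=; rewrite EFinM.
have e0 : (\int[mu]_(t in A) `|(EFin \o h) t| = 0)%E.
  have -> : (\int[mu]_(t in A) `|(EFin \o h) t| = \int[mu]_(t in A) (-1 * h t)%:E)%E.
    by apply: eq_integral => t /[!inE] At; rewrite /= ltr0_norm// mulN1r.
  have fin : (\int[mu]_(t in A) (-1 * h t)%:E)%E \is a fin_num.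
    exact: (integrable_fin_num _ iNA).
  have le0 : \int[mu]_(t in A) (-1 * h t) <= 0.
    by rewrite RintegralZl// mulN1r oppr_le0 hA.
  have ge0 : 0 <= \int[mu]_(t in A) (-1 * h t).
    by apply: Rintegral_ge0 => t At; rewrite mulN1r oppr_ge0 ltW.
  rewrite -(fineK fin); congr (_%:E).
  by apply/eqP; rewrite eq_le le0 ge0.
have mhA : measurable_fun A (EFin \o h) by case/integrableP: iA.
have /(ae_eq_integral_abs mu mA mhA) := e0.
apply: filterS => t /= ht; rewrite leNgt; apply/negP => At.
by have := ht At => -[h0]; rewrite h0 ltxx in At.
Qed.

End complex_integral.

Section psd_matrices.
Context {R : realType} {n : nat}.
Local Notation C := R[i].
Implicit Types (A : 'M[C]_n) (u v : 'cV[C]_n).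

Definition mxip A u v := dotc (A *m u) v.

Lemma mxipDl A u v w : mxip A (u + v) w = mxip A u w + mxip A v w.
Proof. by rewrite /mxip mulmxDr (ipDl semi_inner_dotc). Qed.
Lemma mxipDr A u v w : mxip A w (u + v) = mxip A w u + mxip A w v.
Proof. by rewrite /mxip (ipDr semi_inner_dotc). Qed.
Lemma mxipZl A (a : C) u w : mxip A (a *: u) w = a * mxip A u w.
Proof. by rewrite /mxip -scalemxAr (ipZl semi_inner_dotc). Qed.
Lemma mxipZr A (a : C) u w : mxip A w (a *: u) = a^* * mxip A w u.
Proof. by rewrite /mxip (ipZr semi_inner_dotc). Qed.

Lemma mxip_delta A i j : mxip A (delta_mx j 0) (delta_mx i 0) = A i j.
Proof. by rewrite /mxip dotc_delta -colE mxE. Qed.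

(** Order in the complex numbers makes every (A w, w) real; Hermitian symmetry follows by
    polarisation at u + v and u + i v. *)
Lemma semi_inner_psd A : psdmx A -> semi_inner [set: 'cV[C]_n] (mxip A).
Proof.
move=> A0; split=> //.
- by move=> a u v w _ _ _; rewrite mxipDl mxipZl.
- move=> u v _ _.
  have im w : complex.Im (mxip A w w) = 0 by have := A0 w; rewrite lecE => /andP[/eqP].
  have := im (u + v); have := im (u + 'i%C *: v).
  rewrite !mxipDl !mxipDr !mxipZl !mxipZr; have := im u; have := im v.
  case: (mxip A u u) (mxip A v v) (mxip A u v) (mxip A v u) => [a a'] [b b'] [c c'] [d d'] /= h1 h2 h3 h4.
  by apply/eqP; rewrite eq_complex /=; apply/andP; split; apply/eqP; move: h1 h2 h3 h4 => /=; lra.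
- by move=> u _; exact: A0.
Qed.

Lemma psd_diag_ge0 A i : psdmx A -> 0 <= A i i.
Proof. by move=> A0; rewrite -mxip_delta; exact: A0. Qed.

Lemma psd_trace_ge0 A : psdmx A -> 0 <= \tr A.
Proof. by move=> A0; rewrite /mxtrace sumr_ge0// => i _; exact: psd_diag_ge0. Qed.

(** The diagonal vanishes, and Cauchy-Schwarz for the form of A bounds each entry by diagonal ones.
    This is the absolute continuity of the entries of [Om] with respect to its trace. *)
Lemma psd_trace0 A : psdmx A -> complex.Re (\tr A) = 0 -> A = 0.
Proof.
move=> A0 t0; have si := semi_inner_psd A0.
have trA : \tr A = 0.
  by rewrite -(RRe_real (ger0_real (psd_trace_ge0 A0))) t0.
have d0 i : A i i = 0.
  move: trA => /eqP; rewrite psumr_eq0; last by move=> j _; exact: psd_diag_ge0.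
  by move=> /allP h; apply/eqP; apply: h (mem_index_enum _).
apply/matrixP => i j; rewrite mxE -mxip_delta; apply/eqP; rewrite -normr_eq0 -sqrf_eq0 eq_le.
rewrite exprn_ge0// andbT.
have := cauchy_schwarz si (I : [set: 'cV[C]_n] (delta_mx j 0)) (I : [set: 'cV[C]_n] (delta_mx i 0)).
by rewrite /sqn !mxip_delta !d0 mul0r.
Qed.

(** Cauchy-Schwarz for the form of A gives |(A v)_i|^2 <= (A v, v) A_ii; sum over i. It bounds A v
    by the seminorm (A v, v), which is what L^2 convergence controls. *)
Lemma sqv_psd_le A v : psdmx A -> sqv (A *m v) <= sqn (mxip A) v * complex.Re (\tr A).
Proof.
move=> A0; have si := semi_inner_psd A0.
rewrite -lecR sqvE /mxtrace raddf_sum mulr_sumr rmorph_sum/=; apply: ler_sum => i _.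
have := cauchy_schwarz si (I : [set: 'cV[C]_n] v) (I : [set: 'cV[C]_n] (delta_mx i 0)).
by rewrite {1}/mxip dotc_delta [X in _ * X]/sqn mxip_delta.
Qed.

Lemma psd_le_sqv A v : psdmx A -> complex.Re (\tr A) <= 1 -> sqn (mxip A) v <= sqv v.
Proof.
move=> A0 t1; have si := semi_inner_psd A0.
have q0 : 0 <= sqn (mxip A) v by exact: (sqn_ge0 si).
have [->|qn0] := eqVneq (sqn (mxip A) v) 0; first exact: sqv_ge0.
have qp : 0 < sqn (mxip A) v by rewrite lt_def qn0.
have := cauchy_schwarz semi_inner_dotc (I : [set: 'cV[C]_n] (A *m v)) (I : [set: 'cV[C]_n] v).
rewrite -/(mxip A v v) -(sqnE si)// ger0_norm ?ler0c// -[X in X <= _](rmorphXn (real_complex R)) lecR.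
rewrite -/(sqv _) -/(sqv v) => h; rewrite -(ler_pM2l qp) -expr2 (le_trans h)//.
rewrite ler_wpM2r ?sqv_ge0// (le_trans (sqv_psd_le v A0))//.
by rewrite ler_piMr.
Qed.

Lemma sqv_psd_contraction A v : psdmx A -> complex.Re (\tr A) <= 1 ->
  sqv (A *m v) <= sqn (mxip A) v.
Proof.
move=> A0 t1; apply: (le_trans (sqv_psd_le v A0)); rewrite ler_piMr//.
exact: (sqn_ge0 (semi_inner_psd A0)).
Qed.

(** A countable dense set of vectors: positivity for each vector almost everywhere becomes
    positivity almost everywhere for all vectors, and the exceptional set is measurable. *)
Definition rat_vec (q : {ffun 'I_n -> rat * rat}) : 'cV[C]_n :=
  \col_i (ratr (q i).1 +i* ratr (q i).2)%C.

Lemma rat_cvg (x : R) : exists q : nat -> rat, (fun m => ratr (q m)) @ \oo --> x.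
Proof.
have ex m : exists q : rat, ratr q \in `]x - harmonic m, x + harmonic m[.
  have h : x - harmonic m < x + harmonic m.
    by rewrite ltrD2l -subr_gt0 opprK addr_gt0// /harmonic invr_gt0 ltr0n.
  by have [q hq] := rat_in_itvoo h; exists q.
have [q hq] := choice ex; exists q.
apply: (@squeeze_cvgr _ _ _ _ (fun m => x - harmonic m) (fun m => x + harmonic m)).
- by apply: nearW => m; have := hq m; rewrite in_itv /= => /andP[/ltW -> /ltW ->].
- rewrite -[X in _ --> X]subr0; exact: (cvgB (cvg_cst _) (@cvg_harmonic R)).
- rewrite -[X in _ --> X]addr0; exact: (cvgD (cvg_cst _) (@cvg_harmonic R)).
Qed.

Lemma cvg_mxip A (u : nat -> 'cV[C]_n) v : (forall i, (fun m => u m i 0) @ \oo --> v i 0) ->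
  (fun m => mxip A (u m) (u m)) @ \oo --> mxip A v v.
Proof.
move=> h; rewrite /mxip /dotc; apply: cvg_complex_sum => i _.
apply: cvgM; last by apply: cvg_complex_conj; exact: h.
rewrite (_ : (fun m => _) = fun m => \sum_j A i j * u m j 0); last first.
  by apply/funext => m; rewrite mxE.
rewrite mxE; apply: cvg_complex_sum => j _; exact: (cvgM (cvg_cst _) (h j)).
Qed.

Lemma psd_of_rat A : (forall q, 0 <= mxip A (rat_vec q) (rat_vec q)) -> psdmx A.
Proof.
move=> h v.
have [q1 h1] := choice (fun i => rat_cvg (complex.Re (v i 0))).
have [q2 h2] := choice (fun i => rat_cvg (complex.Im (v i 0))).
pose q m : {ffun 'I_n -> rat * rat} := [ffun i => (q1 i m, q2 i m)].
have c : (fun m => mxip A (rat_vec (q m)) (rat_vec (q m))) @ \oo --> mxip A v v.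
  apply: cvg_mxip => i; rewrite (_ : (fun m => _) = fun m => (ratr (q1 i m) +i* ratr (q2 i m))%C).
    by apply: cvg_complex; [exact: h1|exact: h2].
  by apply/funext => m; rewrite mxE ffunE.
have hr := cvg_complex_Re c; have hi := cvg_complex_Im c.
rewrite lecE; apply/andP; split.
  have e : (fun m => complex.Im (mxip A (rat_vec (q m)) (rat_vec (q m)))) = cst 0.
    by apply/funext => m; have := h (q m); rewrite lecE => /andP[/eqP].
  by rewrite e in hi; apply/eqP; exact: (cvg_unique _ hi (cvg_cst 0)).
apply: (@ler_cvg_to _ _ eventually_filter _ (cst 0) _ _ _ (cvg_cst 0) hr).
by apply: nearW => m; have := h (q m); rewrite lecE => /andP[].
Qed.

End psd_matrices.

(** * The matrix density of [Om] with respect to its trace *)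

Section density.
Context d (T : measurableType d) (R : realType) (n : nat).
Local Notation C := R[i].
Variable Om : mxmeasure T R n.
Local Notation mu := (trace_measure Om).
Local Notation W := (mxdensity Om).

Lemma entry_Re_dominated i j : entry_Re Om i j `<< mu.
Proof.
move=> N N0 A mA AN; have := N0 A mA AN; rewrite /trace_measure => -[h].
by rewrite /entry_Re (psd_trace0 (mxmeas_psd Om A) h) mxE.
Qed.

Lemma entry_Im_dominated i j : entry_Im Om i j `<< mu.
Proof.
move=> N N0 A mA AN; have := N0 A mA AN; rewrite /trace_measure => -[h].
by rewrite /entry_Im (psd_trace0 (mxmeas_psd Om A) h) mxE.
Qed.

Lemma density_integrable i j : cintegrable mu setT (fun t => W t i j).
Proof.
split.
  apply: (eq_integrable measurableT) (Radon_Nikodym_integrable (entry_Re_dominated i j)) => t _ /=.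
  by rewrite mxE /= fineK// Radon_Nikodym_fin_num//; exact: entry_Re_dominated.
apply: (eq_integrable measurableT) (Radon_Nikodym_integrable (entry_Im_dominated i j)) => t _ /=.
by rewrite mxE /= fineK// Radon_Nikodym_fin_num//; exact: entry_Im_dominated.
Qed.

Lemma density_cmeas i j : cmeas (fun t => W t i j).
Proof.
have [/integrableP[h1 _] /integrableP[h2 _]] := density_integrable i j.
by split; apply/measurable_EFinP.
Qed.

Lemma Cint_density A i j : measurable A -> Cint mu A (fun t => W t i j) = Om A i j.
Proof.
move=> mA; have e1 := Radon_Nikodym_integral (entry_Re_dominated i j) mA.
have e2 := Radon_Nikodym_integral (entry_Im_dominated i j) mA.
rewrite /Cint /Rintegral.
have -> : (\int[mu]_(t in A) (complex.Re (W t i j))%:E = entry_Re Om i j A)%E.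
  rewrite e1; apply: eq_integral => t _.
  by rewrite mxE /= fineK// Radon_Nikodym_fin_num//; exact: entry_Re_dominated.
have -> : (\int[mu]_(t in A) (complex.Im (W t i j))%:E = entry_Im Om i j A)%E.
  rewrite e2; apply: eq_integral => t _.
  by rewrite mxE /= fineK// Radon_Nikodym_fin_num//; exact: entry_Im_dominated.
by rewrite /entry_Re /entry_Im /=; case: (Om A i j).
Qed.

Lemma cintegrableS A (f : T -> C) : measurable A -> cintegrable mu setT f -> cintegrable mu A f.
Proof. by move=> mA [h1 h2]; split; apply: (integrableS measurableT). Qed.

Lemma mxipE (A : 'M[C]_n) (v w : 'cV[C]_n) :
  mxip A v w = \sum_i \sum_j (v j 0 * (w i 0)^*) * A i j.
Proof.
rewrite /mxip /dotc; apply: eq_bigr => i _; rewrite mxE mulr_suml.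
by apply: eq_bigr => j _; ring.
Qed.

Lemma Cint_mxip A (v w : 'cV[C]_n) : measurable A ->
  cintegrable mu A (fun t => mxip (W t) v w) /\
  Cint mu A (fun t => mxip (W t) v w) = mxip (Om A) v w.
Proof.
move=> mA; have iW i j : cintegrable mu A (fun t => (v j 0 * (w i 0)^*) * W t i j).
  by apply: cintegrableZ => //; apply: cintegrableS => //; exact: density_integrable.
have e : (fun t => mxip (W t) v w) = fun t => \sum_i \sum_j (v j 0 * (w i 0)^*) * W t i j.
  by apply/funext => t; rewrite mxipE.
rewrite e; split.
  by apply: cintegrable_sum => // i; exact: cintegrable_sum.
rewrite Cint_sum//; last by move=> i; exact: cintegrable_sum.
rewrite mxipE; apply: eq_bigr => i _; rewrite Cint_sum//; apply: eq_bigr => j _.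
rewrite CintZ ?Cint_density//; apply: cintegrableS => //; exact: density_integrable.
Qed.

(** The integral over each A is (Om(A) v, v) >= 0. The imaginary part is shown to be both
    nonnegative and nonpositive. *)
Lemma ae_density_ge0 (v : 'cV[C]_n) : {ae mu, forall t, 0 <= mxip (W t) v v}.
Proof.
have [[h1 h2] _] := Cint_mxip v v measurableT.
have re : {ae mu, forall t, 0 <= complex.Re (mxip (W t) v v)}.
  apply: ae_ge0_of_integral_ge0 => // A mA.
  have [_ /(congr1 (@complex.Re R)) /= ->] := Cint_mxip v v mA.
  by have := mxmeas_psd Om A v; rewrite lecE => /andP[].
have im : {ae mu, forall t, 0 <= complex.Im (mxip (W t) v v)}.
  apply: ae_ge0_of_integral_ge0 => // A mA.
  have [_ /(congr1 (@complex.Im R)) /= ->] := Cint_mxip v v mA.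
  by have := mxmeas_psd Om A v; rewrite lecE => /andP[/eqP ->].
have iNm : mu.-integrable setT (EFin \o (fun t => -1 * complex.Im (mxip (W t) v v))).
  by apply: (eq_integrable measurableT) (integrableZl measurableT (-1) h2) => t _ /=; rewrite EFinM.
have im' : {ae mu, forall t, 0 <= -1 * complex.Im (mxip (W t) v v)}.
  apply: ae_ge0_of_integral_ge0 => // A mA.
  have [[_ h2A] /(congr1 (@complex.Im R)) /= e] := Cint_mxip v v mA.
  rewrite RintegralZl// e.
  by have := mxmeas_psd Om A v; rewrite lecE => /andP[/eqP -> _]; rewrite mulr0.
apply: filterS3 re im im' => t a b c; rewrite lecE a andbT.
by apply/eqP; move: b c; rewrite mulN1r oppr_ge0 => b c; apply/eqP; rewrite eq_le b c.
Qed.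

(** The reference measure is the trace of [Om], so 1 - tr W integrates to 0 over every measurable
    set. *)
Lemma ae_density_trace : {ae mu, forall t, complex.Re (\tr (W t)) <= 1}.
Proof.
have tE t : \tr (W t) = \sum_i W t i i by [].
have it : cintegrable mu setT (fun t => \tr (W t)).
  by apply: cintegrable_sum => // i; exact: density_integrable.
have iN : mu.-integrable setT (EFin \o (fun t => -1 * complex.Re (\tr (W t)))).
  have [h _] := it.
  by apply: (eq_integrable measurableT) (integrableZl measurableT (-1) h) => t _ /=; rewrite EFinM.
have i1 : mu.-integrable setT (EFin \o (fun t => 1 + -1 * complex.Re (\tr (W t)))).
  have h := finite_measure_integrable_cst mu 1 measurableT.
  by apply: (eq_integrable measurableT) (integrableD measurableT h iN) => t _ /=; rewrite EFinD.
have : {ae mu, forall t, 0 <= 1 + -1 * complex.Re (\tr (W t))}.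
  apply: ae_ge0_of_integral_ge0 => // A mA.
  have h := finite_measure_integrable_cst mu 1 measurableT.
  have hA : mu.-integrable A (EFin \o cst 1) by exact: (integrableS measurableT).
  rewrite RintegralD//; last by apply: (integrableS measurableT).
  have [it1 _] := cintegrableS mA it.
  rewrite RintegralZl//.
  have -> : \int[mu]_(t in A) 1 = complex.Re (\tr (Om A)).
    by rewrite Rintegral_cst// mul1r.
  have : Cint mu A (fun t => \tr (W t)) = \tr (Om A).
    rewrite /mxtrace Cint_sum//; last by move=> i; apply: cintegrableS => //; exact: density_integrable.
    by apply: eq_bigr => i _; exact: Cint_density.
  by move=> /(congr1 (@complex.Re R)) /= ->; rewrite mulN1r subrr.
by apply: filterS => t; lra.
Qed.

Definition good_density (t : T) : Prop := psdmx (W t) /\ complex.Re (\tr (W t)) <= 1.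

Lemma ae_good_density : {ae mu, forall t, good_density t}.
Proof.
have h : {ae mu, forall t k, if unpickle k is Some q then
    0 <= mxip (W t) (rat_vec q) (rat_vec q) : Prop else True}.
  apply: ae_foralln => k; case: (unpickle k) => [q|]; first exact: ae_density_ge0.
  by apply: nearW.
apply: filterS2 h ae_density_trace => t a b; split => //.
by apply: psd_of_rat => q; have := a (pickle q); rewrite pickleK.
Qed.

Lemma measurable_good_density : measurable [set t | good_density t].
Proof.
have mle (f g : T -> R) : measurable_fun setT f -> measurable_fun setT g -> measurable [set t | f t <= g t].
  move=> mf mg; have m := measurable_fun_ler mf mg.
  have := @m measurableT [set true] I.
  by rewrite setTI; congr measurable; apply/seteqP; split=> t /=.
have mip v : cmeas (fun t => mxip (W t) v v).
  apply: (@cmeas_ext _ _ _ (fun t => \sum_i \sum_j (v j 0 * (v i 0)^*) * W t i j)).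
    by move=> t; rewrite mxipE.
  apply: cmeas_sum => i; apply: cmeas_sum => j.
  by apply: cmeasM; [exact: cmeas_cst|exact: density_cmeas].
pose S k := if unpickle k is Some q then
  [set t | 0 <= mxip (W t) (rat_vec q) (rat_vec q)] else setT.
have mS k : measurable (S k).
  rewrite /S; case: (unpickle k) => [q|]; last exact: measurableT.
  rewrite (_ : [set t | _] = [set t | 0 <= complex.Re (mxip (W t) (rat_vec q) (rat_vec q))] `&`
     ([set t | 0 <= complex.Im (mxip (W t) (rat_vec q) (rat_vec q))] `&`
      [set t | complex.Im (mxip (W t) (rat_vec q) (rat_vec q)) <= 0])).
    have [m1 m2] := mip (rat_vec q).
    by apply: measurableI; [|apply: measurableI]; apply: mle => //; exact: measurable_cst.
  apply/seteqP; split => t /=; rewrite lecE.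
    by move=> /andP[/eqP -> ->].
  by move=> [-> [a b]]; rewrite andbT eq_le a b.
have mtr : measurable [set t | complex.Re (\tr (W t)) <= 1].
  apply: mle; last exact: measurable_cst.
  have [] // : cmeas (fun t => \tr (W t)).
  by apply: cmeas_sum => i; exact: density_cmeas.
rewrite (_ : [set t | _] = (\bigcap_k S k) `&` [set t | complex.Re (\tr (W t)) <= 1]).
  by apply: measurableI => //; exact: bigcapT_measurable.
apply/seteqP; split => t /=.
  move=> [h1 h2]; split => // k _; rewrite /S; case: (unpickle k) => // q; exact: h1.
move=> [h1 h2]; split => //; apply: psd_of_rat => q.
by have := h1 (pickle q) I; rewrite /S pickleK.
Qed.

(* Corrected on a null set, so that the pointwise bounds hold everywhere. *)
Definition density' (t : T) : 'M[C]_n := if `[< good_density t >] then W t else 0.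

Lemma density'_psd t : psdmx (density' t).
Proof.
rewrite /density'; case: asboolP => [[]//|_] v.
by rewrite mul0mx (ip0l semi_inner_dotc).
Qed.

Lemma density'_trace t : complex.Re (\tr (density' t)) <= 1.
Proof.
rewrite /density'; case: asboolP => [[]//|_].
by rewrite mxtrace0.
Qed.

Lemma density'_cmeas i j : cmeas (fun t => density' t i j).
Proof.
apply: (@cmeas_ext _ _ _ (fun t => (\1_[set t | good_density t] t)%:C%C * W t i j)).
  move=> t; rewrite /density' indicE; case: asboolP => h.
    by rewrite mem_set// mul1r.
  by rewrite memNset// mul0r mxE.
apply: cmeas_indic; [exact: measurable_good_density|exact: density_cmeas].
Qed.

Lemma ae_density' : {ae mu, forall t, W t = density' t}.
Proof.
by apply: filterS ae_good_density => t h; rewrite /density'; case: asboolP.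
Qed.

End density.

(** * Solving A x = y for a positive A by an explicit iteration *)

Section landweber_iteration.
Context {R : realType} {n : nat}.
Local Notation C := R[i].
Variable A : 'M[C]_n.
Hypothesis A0 : psdmx A.
Hypothesis A1 : complex.Re (\tr A) <= 1.
Let si := semi_inner_psd A0.
Let sid := @semi_inner_dotc R n.
Implicit Types u v w y z : 'cV[C]_n.

(** Partial sums of the Neumann series sum_i (1 - A)^i y for a solution of A x = y. Being polynomial
    in A and y, they are measurable when A and y depend measurably on a point, and so is their
    limit, whereas an arbitrary choice of solutions need not be. *)
Definition landweber (A : 'M[C]_n) y j := \sum_(i < j) iter i (fun v => v - A *m v) y.

Local Notation B := (fun v => v - A *m v).

Lemma psd_symmetric u v : dotc (A *m u) v = dotc u (A *m v).
Proof.
have := siC si (I : [set: 'cV[C]_n] v) (I : [set: 'cV[C]_n] u).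
by rewrite /mxip => ->; rewrite -(siC sid).
Qed.

Lemma psd_kernel_sqr v : A *m (A *m v) = 0 -> A *m v = 0.
Proof.
move=> h; apply: sqv_eq0; rewrite /sqv /sqn psd_symmetric h.
by rewrite (ip0r sid).
Qed.

(** A positive A has A (A v) = 0 only if A v = 0, so its range meets its kernel trivially and A and
    A^2 have the same rank. Transposes turn column spaces into the row spaces that [submx]
    compares. *)
Lemma psd_range_sqr : (A^T <= (A *m A)^T)%MS.
Proof.
have le1 : ((A *m A)^T <= A^T)%MS by rewrite trmx_mul submxMl.
rewrite -(geq_leqif (mxrank_leqif_sup le1)) trmx_mul.
rewrite -[leqLHS](mxrank_mul_ker A^T A^T).
suff -> : (A^T :&: kermx A^T)%MS = 0 by rewrite mxrank0 addn0.
apply/eqP/rowV0P => v; rewrite sub_capmx => /andP[/submxP[w ->] /sub_kermxP h].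
apply/trmx_inj; rewrite trmx0 trmx_mul trmxK.
apply: psd_kernel_sqr.
by apply/trmx_inj; rewrite trmx0 !trmx_mul trmxK.
Qed.

Lemma cvg_mulmx_entry (M : 'M[C]_n) (u : nat -> 'cV[C]_n) v i :
  (forall j, (fun m => u m j 0) @ \oo --> v j 0) ->
  (fun m => (M *m u m) i 0) @ \oo --> (M *m v) i 0.
Proof.
move=> h; rewrite (_ : (fun m => _) = fun m => \sum_j M i j * u m j 0); last first.
  by apply/funext => m; rewrite mxE.
rewrite mxE; apply: cvg_complex_sum => j _; exact: (cvgM (cvg_cst _) (h j)).
Qed.

(** The range of A^2 is cut out by the linear equations K^T y = 0, which pass to the limit; every A
    u_m satisfies them since A and A^2 have the same range. *)
Lemma psd_closed_range (u : nat -> 'cV[C]_n) y :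
  (forall i, (fun m => (A *m u m) i 0) @ \oo --> y i 0) ->
  exists w, A *m (A *m w) = y.
Proof.
move=> h; pose K := cokermx (A *m A)^T.
have Ku m : (K^T *m (A *m u m)) = 0.
  apply/trmx_inj; rewrite trmx0 trmx_mul trmxK; apply/eqP.
  rewrite -submxE trmx_mul; apply: submx_trans psd_range_sqr.
  exact: submxMl.
have : K^T *m y = 0.
  apply/matrixP => i j; rewrite ord1 [RHS]mxE.
  have c := @cvg_mulmx_entry K^T (fun m => A *m u m) y i h.
  apply: (cvg_complex_uniq c).
  rewrite (_ : (fun m => _) = cst 0); first exact: cvg_cst.
  by apply/funext => m; rewrite Ku mxE.
move=> /(congr1 trmx); rewrite trmx0 trmx_mul trmxK => /eqP; rewrite -submxE => /submxP[v hv].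
exists v^T; apply/trmx_inj; rewrite hv !trmx_mul trmxK mulmxA.
by [].
Qed.

Lemma iterB_comm i v : iter i B (A *m v) = A *m iter i B v.
Proof. by elim: i => //= i ->; rewrite mulmxBr. Qed.

Lemma landweber_telescope z j : landweber A (A *m z) j = z - iter j B z.
Proof.
rewrite /landweber; elim: j => [|j IH]; first by rewrite big_ord0 subrr.
rewrite big_ord_recr /= IH iterB_comm opprD opprK addrA.
by [].
Qed.

(** From |A v|^2 <= (A v, v) one gets |v|^2 - |v - A v|^2 = 2 (A v, v) - |A v|^2 >= |A v|^2, and the
    sum telescopes. *)
Lemma iterB_range_decay w N : \sum_(j < N) sqv (A *m iter j B w) <= sqv w.
Proof.
have step v : sqv (A *m v) <= sqv v - sqv (v - A *m v).
  have h := sqv_psd_contraction v A0 A1.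
  rewrite [X in _ <= _ - X]/sqv /sqn (ipBr sid)// !(ipBl sid)// -psd_symmetric.
  rewrite !raddfB/=; move: h; rewrite /sqv /sqn /mxip -!psd_symmetric; lra.
suff h : \sum_(j < N) sqv (A *m iter j B w) <= sqv w - sqv (iter N B w).
  by have := sqv_ge0 (iter N B w); lra.
elim: N => [|N IH]; first by rewrite big_ord0 subrr.
rewrite big_ord_recr /=; have := step (iter N B w); lra.
Qed.

Lemma iterB_range_cvg w i : (fun j => (iter j B (A *m w)) i 0) @ \oo --> (0 : C).
Proof.
have c : cvgn (series (fun j => sqv (A *m iter j B w))).
  by apply: (@l2_of_bounded _ _ (fun j => A *m iter j B w) (sqv w)) => N; exact: iterB_range_decay.
have c0 := cvg_series_cvg_0 c.
apply: (@complex_squeeze _ _ _ (fun j => Num.sqrt (sqv (A *m iter j B w)))).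
  apply: nearW => j; rewrite subr0 iterB_comm -(@ler_pXn2r _ 2)// ?nnegrE ?ler0c ?sqrtr_ge0//.
  rewrite -[leRHS](rmorphXn (real_complex R)) sqr_sqrtr ?sqv_ge0//.
  exact: entry_le_sqv.
rewrite -[X in _ --> X](sqrtr0 R).
exact: (cvg_comp _ _ c0 (@sqrt_continuous R 0)).
Qed.

(** Writing y = A (A w), the partial sums telescope to A w - (1 - A)^j (A w), whose last term tends
    to 0: the iteration selects the solution lying in the range of A. *)
Lemma landweber_cvg (u : nat -> 'cV[C]_n) y :
  (forall i, (fun m => (A *m u m) i 0) @ \oo --> y i 0) ->
  exists2 x, A *m x = y & forall i, (fun j => landweber A y j i 0) @ \oo --> x i 0.
Proof.
move=> /psd_closed_range[w <-]; exists (A *m w) => // i.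
rewrite (_ : (fun j => _) = fun j => (A *m w) i 0 - (iter j B (A *m w)) i 0).
  rewrite -[X in _ --> X]subr0; exact: (cvgB (cvg_cst _) (iterB_range_cvg w i)).
by apply/funext => j; rewrite landweber_telescope !mxE.
Qed.

(** Only the images A u_l converge, yet with v = u_k - x the number Q = (A v, v) is the limit of (A
    (u_k - u_l), v). Cauchy-Schwarz bounds it by sqrt (e Q), so Q <= e. *)
Lemma psd_limit_bound (u : nat -> 'cV[C]_n) x k (e : R) :
  (forall i, (fun m => (A *m u m) i 0) @ \oo --> (A *m x) i 0) ->
  (forall l, (k <= l)%N -> sqn (mxip A) (u l - u k) <= e) ->
  sqn (mxip A) (u k - x) <= e.
Proof.
move=> h hk; have e0 : 0 <= e by apply: le_trans (hk k (leqnn k)); exact: (sqn_ge0 si).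
set v := u k - x; set Q := sqn (mxip A) v.
have Q0 : 0 <= Q by exact: (sqn_ge0 si).
have lim : (fun l => mxip A (u k - u l) v) @ \oo --> mxip A v v.
  rewrite /mxip /dotc; apply: cvg_complex_sum => i _; apply: cvgM; last exact: cvg_cst.
  rewrite (_ : (fun l => _) = fun l => (A *m u k) i 0 - (A *m u l) i 0); last first.
    by apply/funext => l; rewrite mulmxBr !mxE.
  have -> : (A *m v) i 0 = (A *m u k) i 0 - (A *m x) i 0 by rewrite mulmxBr !mxE.
  exact: (cvgB (cvg_cst _) (h i)).
have b := cvg_complex_norm lim.
have : `|mxip A v v| <= (Num.sqrt (e * Q))%:C%C.
  apply: b; exists k => // l /= kl.
  rewrite -(@ler_pXn2r _ 2)// ?nnegrE ?ler0c ?sqrtr_ge0//.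
  rewrite -[leRHS](rmorphXn (real_complex R)) sqr_sqrtr ?mulr_ge0//.
  rewrite (le_trans (cauchy_schwarz si _ _))// lecR ler_wpM2r//.
  apply: le_trans (hk l kl).
  by rewrite /sqn -opprB (ipNl si)// (ipNr si)// opprK.
rewrite -(sqnE si)// ger0_norm ?ler0c// lecR -/Q => hQ.
have {}hQ : Q ^+ 2 <= e * Q.
  by rewrite -[leRHS](sqr_sqrtr (mulr_ge0 e0 Q0)) lerXn2r// nnegrE sqrtr_ge0.
rewrite leNgt; apply/negP => eQ; nra.
Qed.

End landweber_iteration.

(** * The space L^2 of a matrix measure and its completeness *)

Section L2_space.
Context d (T : measurableType d) (R : realType) (n : nat).
Local Notation C := R[i].
Variable Om : mxmeasure T R n.
Local Notation mu := (trace_measure Om).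
Local Notation W := (density' Om).
Implicit Types f g h : T -> 'cV[C]_n.

Let siW t := semi_inner_psd (density'_psd Om t).

Definition qd t (v : 'cV[C]_n) : R := sqn (mxip (W t)) v.

Lemma qd_ge0 t v : 0 <= qd t v. Proof. exact: (sqn_ge0 (siW t)). Qed.

Lemma cmeas_mxip (M : T -> 'M[C]_n) f g : (forall i j, cmeas (fun t => M t i j)) ->
  cvmeasurable f -> cvmeasurable g -> cmeas (fun t => mxip (M t) (f t) (g t)).
Proof.
move=> hM hf hg.
apply: (@cmeas_ext _ _ _ (fun t => \sum_i \sum_j (f t j 0 * (g t i 0)^*) * M t i j)).
  by move=> t; rewrite mxipE.
apply: cmeas_sum => i; apply: cmeas_sum => j; apply: cmeasM => //.
by apply: cmeasM; [exact: hf|apply: cmeas_conj; exact: hg].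
Qed.

Lemma cmeas_mxip' f g : cvmeasurable f -> cvmeasurable g ->
  cmeas (fun t => mxip (W t) (f t) (g t)).
Proof. by apply: cmeas_mxip => i j; exact: density'_cmeas. Qed.

Lemma measurable_qd f : cvmeasurable f -> measurable_fun setT (fun t => qd t (f t)).
Proof. by move=> hf; have [] := cmeas_mxip' hf hf. Qed.

Lemma L2dotE f g : cvmeasurable f -> cvmeasurable g ->
  L2dot Om f g = Cint mu setT (fun t => mxip (W t) (f t) (g t)).
Proof.
move=> hf hg; rewrite /L2dot CintegralE; apply: ae_eq_Cint.
- by apply: cmeas_mxip => // i j; exact: density_cmeas.
- exact: cmeas_mxip'.
- by apply: filterS (ae_density' Om) => t h; rewrite /mxip h.
Qed.

Lemma L2spaceE f : L2space Om f <->
  cvmeasurable f /\ mu.-integrable setT (EFin \o (fun t => qd t (f t))).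
Proof.
split=> -[hf hi]; split => //.
  apply: ae_eq_integrable hi.
  - by have [] := cmeas_mxip (density_cmeas Om) hf hf.
  - exact: measurable_qd.
  - by apply: filterS (ae_density' Om) => t e; rewrite /qd /sqn /mxip e.
apply: (ae_eq_integrable (f := fun t => qd t (f t)) (g := fun t => complex.Re (dotc (mxdensity Om t *m f t) (f t)))) => //.
- exact: measurable_qd.
- by have [] := cmeas_mxip (density_cmeas Om) hf hf.
- by apply: filterS (ae_density' Om) => t e; rewrite /qd /sqn /mxip e.
Qed.

Lemma L2_measurable f : L2space Om f -> cvmeasurable f. Proof. by case. Qed.

Lemma cvmeasurable_lin (a : C) f g : cvmeasurable f -> cvmeasurable g -> cvmeasurable (a *: f + g).
Proof.
move=> hf hg i; apply: (@cmeas_ext _ _ _ (fun t => a * f t i 0 + g t i 0)).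
  by move=> t; rewrite !mxE.
by apply: cmeasD; [apply: cmeasM; [exact: cmeas_cst|exact: hf]|exact: hg].
Qed.

Lemma mxip_le t (u v : 'cV[C]_n) : `|mxip (W t) u v| <= (qd t u + qd t v)%:C%C.
Proof.
rewrite (le_trans (cauchy_schwarz_sqrt (siW t) _ _))// lecR -/(qd t u) -/(qd t v).
have hu := qd_ge0 t u; have hv := qd_ge0 t v.
have := sqr_ge0 (Num.sqrt (qd t u) - Num.sqrt (qd t v)).
have := sqr_sqrtr hu; have := sqr_sqrtr hv.
have := sqrtr_ge0 (qd t u); have := sqrtr_ge0 (qd t v); nra.
Qed.

Lemma L2_cintegrable f g : L2space Om f -> L2space Om g ->
  cintegrable mu setT (fun t => mxip (W t) (f t) (g t)).
Proof.
move=> /L2spaceE[hf i1] /L2spaceE[hg i2].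
apply: (@cintegrable_bound _ _ _ _ _ (fun t => qd t (f t) + qd t (g t))).
- exact: cmeas_mxip'.
- by apply: (eq_integrable measurableT) (integrableD measurableT i1 i2) => t _ /=; rewrite EFinD.
- by move=> t; exact: mxip_le.
Qed.

Lemma L2_of_bound f (b : T -> R) : cvmeasurable f -> mu.-integrable setT (EFin \o b) ->
  (forall t, qd t (f t) <= b t) -> L2space Om f.
Proof.
move=> hf hb h; apply/L2spaceE; split => //.
apply: (le_integrable measurableT) hb => [|t _ /=].
  by apply/measurable_EFinP; exact: measurable_qd.
rewrite lee_fin ger0_norm ?qd_ge0// (le_trans (h t))// ler_norm//.
Qed.

Lemma integrableZ_real (c : R) (b : T -> R) : mu.-integrable setT (EFin \o b) ->
  mu.-integrable setT (EFin \o (fun t => c * b t)).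
Proof.
by move=> hb; apply: (eq_integrable measurableT) (integrableZl measurableT c hb) => t _ /=; rewrite EFinM.
Qed.

Lemma integrableD_real (b c : T -> R) : mu.-integrable setT (EFin \o b) ->
  mu.-integrable setT (EFin \o c) -> mu.-integrable setT (EFin \o (fun t => b t + c t)).
Proof.
by move=> hb hc; apply: (eq_integrable measurableT) (integrableD measurableT hb hc) => t _ /=; rewrite EFinD.
Qed.

Lemma semi_inner_L2 : semi_inner (L2space Om) (L2dot Om).
Proof.
have HP a f g : L2space Om f -> L2space Om g -> L2space Om (a *: f + g).
  move=> /L2spaceE[hf i1] /L2spaceE[hg i2].
  apply: (@L2_of_bound _ (fun t => 2 * (complex.Re `|a|) ^+ 2 * qd t (f t) + 2 * qd t (g t))).
  - exact: cvmeasurable_lin.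
  - by apply: integrableD_real; exact: integrableZ_real.
  - move=> t; apply: (le_trans (sqnD2 (siW t) (I : [set: 'cV[C]_n] (a *: f t)) I)).
    rewrite lerD2r -mulrA ler_pM2l// -lecR (sqnZ (siW t))// normc_real rmorphM/= rmorphXn//.
split => //.
- apply: (@L2_of_bound _ (cst 0)).
  + by move=> i; apply: (@cmeas_ext _ _ _ (fun=> 0)); [move=> t; rewrite mxE|exact: cmeas_cst].
  + exact: finite_measure_integrable_cst.
  + by move=> t; rewrite /qd /sqn (ip0l (siW t)).
- move=> a f g h Hf Hg Hh; rewrite !L2dotE; try exact: L2_measurable.
    2: exact: L2_measurable (HP a _ _ Hf Hg).
  rewrite -CintZ//; last exact: L2_cintegrable.
  rewrite -CintD//; last exact: L2_cintegrable.
    by congr Cint; apply/funext => t; rewrite mxipDl mxipZl.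
  by apply: cintegrableZ => //; exact: L2_cintegrable.
- move=> f g Hf Hg; rewrite !L2dotE; try exact: L2_measurable.
  rewrite -Cint_conj; last exact: L2_cintegrable.
  by congr Cint; apply/funext => t; exact: (siC (siW t)).
- move=> f Hf; rewrite L2dotE; try exact: L2_measurable.
  by apply: Cint_ge0 => t; exact: (si_ge0 (siW t)).
Qed.

Lemma sqn_L2E f : cvmeasurable f -> sqn (L2dot Om) f = \int[mu]_t qd t (f t).
Proof. by move=> hf; rewrite /sqn L2dotE. Qed.

Let si := semi_inner_L2.

Section completeness.
Variable u : nat -> T -> 'cV[C]_n.
Hypothesis Hu : forall m, L2space Om (u m).
Hypothesis hu : forall m, sqn (L2dot Om) (u m.+1 - u m) <= 4^-1 ^+ m.

Let du m t := qd t (u m.+1 t - u m t).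
(** The weights 2^m are those of [sqn_telescope]. Since the increments are at most 4^-m in square
    norm, the weighted series has integral at most sum_m 2^-m and is finite almost everywhere. *)
Let w m t : R := 2 ^+ m * du m t.
Let g t : \bar R := (\sum_(m <oo) (w m t)%:E)%E.
Let gam t : R := fine (g t).
Let F := [set t | (g t < +oo)%E].

Let w_ge0 m t : 0 <= w m t.
Proof. by rewrite mulr_ge0 ?exprn_ge0 ?qd_ge0. Qed.

Let Hdu m : L2space Om (u m.+1 - u m). Proof. exact: (siB si). Qed.

Let mw m : measurable_fun setT (EFin \o w m).
Proof.
apply/measurable_EFinP; apply: measurable_funM; first exact: measurable_cst.
exact: (measurable_qd (L2_measurable (Hdu m))).
Qed.

Let mg : measurable_fun setT g.
Proof.
have h0 m t : setT t -> xpredT m -> (0 <= (EFin \o w m) t)%E by rewrite lee_fin w_ge0.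
exact: (ge0_emeasurable_sum h0 (fun m _ => mw m)).
Qed.

Let int_g : (\int[mu]_t g t < +oo)%E.
Proof.
rewrite integral_nneseries//; last by move=> m t _; rewrite lee_fin w_ge0.
apply: (@le_lt_trans _ _ (\sum_(m <oo) ((geometric 1 2^-1 m)%:E))%E).
  apply: lee_nneseries => [m _ _|m _].
    by apply: integral_ge0 => t _; rewrite lee_fin w_ge0.
  have [_ id] := (L2spaceE (u m.+1 - u m)).1 (Hdu m).
  have iw : mu.-integrable setT (EFin \o w m) by exact: integrableZ_real.
  rewrite -(fineK (integrable_fin_num _ iw))// lee_fin.
  rewrite -[fine _]/(\int[mu]_t (2 ^+ m * du m t)) RintegralZl//.
  have := hu m; rewrite sqn_L2E; last exact: L2_measurable.
  rewrite /geometric /= mul1r => h.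
  apply: (@le_trans _ _ (2 ^+ m * 4^-1 ^+ m)); first by rewrite ler_wpM2l// exprn_ge0.
  by rewrite -exprMn; apply: lerXn2r; rewrite ?nnegrE; lra.
have gc : series (geometric 1 2^-1) @ \oo --> (1 / (1 - 2^-1) : R).
  by apply: cvg_geometric_series; rewrite ger0_norm; lra.
suff -> : (\sum_(m <oo) ((geometric 1 2^-1 m : R)%:E))%E = (1 / (1 - 2^-1) : R)%:E by rewrite ltry.
apply/cvg_lim => //.
rewrite (_ : (fun m => _) = EFin \o series (geometric 1 2^-1)).
  by apply: cvg_EFin; [exact: nearW|exact: gc].
by apply/funext => m /=; rewrite /series /= sumEFin.
Qed.

Let g_ge0 t : (0 <= g t)%E.
Proof. by apply: nneseries_ge0 => m _ _; rewrite lee_fin w_ge0. Qed.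

Let ig : mu.-integrable setT g.
Proof.
apply/integrableP; split => //.
by under eq_integral do rewrite gee0_abs//.
Qed.

Let mF : measurable F.
Proof.
by rewrite -[F]setTI; exact: emeasurable_fun_infty_o.
Qed.

Let ae_F : {ae mu, forall t, F t}.
Proof.
apply: filterS (integrable_ae measurableT ig) => t /(_ I).
by rewrite ge0_fin_numE.
Qed.

Let gam_ge0 t : 0 <= gam t. Proof. by rewrite fine_ge0. Qed.

Let igam : mu.-integrable setT (EFin \o gam).
Proof.
apply: (le_integrable measurableT) ig => [|t _ /=].
  by apply/measurable_EFinP; apply: measurableT_comp => //; exact: fine_measurable.
rewrite ger0_norm// gee0_abs//.
have [fg|] := boolP (g t \is a fin_num); first by rewrite fineK.
by rewrite ge0_fin_numE// ltey negbK => /eqP ->; rewrite leey.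
Qed.

Let partial_le t N m : F t -> \sum_(m <= i < N) w i t <= gam t.
Proof.
move=> Ft; rewrite -lee_fin fineK ?ge0_fin_numE//.
have h : (\sum_(0 <= i < N) (w i t)%:E <= g t)%E.
  by apply: nneseries_lim_ge => k _; rewrite lee_fin w_ge0.
apply: le_trans h; rewrite sumEFin lee_fin.
have [mN|mN] := leqP m N; last by rewrite big_geq ?(ltnW mN)// sumr_ge0.
by rewrite [leRHS](big_cat_nat (leq0n m) mN)/= lerDr sumr_ge0.
Qed.

(** Set to 0 off the set of finiteness, so that the Cauchy estimate holds at every point and limits
    can be taken without exceptions. *)
Let ut m t : 'cV[C]_n := (\1_F t)%:C%C *: u m t.

Let utF m t : F t -> ut m t = u m t.
Proof. by move=> Ft; rewrite /ut indicE mem_set// scale1r. Qed.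

Let utN m t : ~ F t -> ut m t = 0.
Proof. by move=> Ft; rewrite /ut indicE memNset// scale0r. Qed.

Let ut_meas m : cvmeasurable (ut m).
Proof.
move=> i; apply: (@cmeas_ext _ _ _ (fun t => (\1_F t)%:C%C * u m t i 0)).
  by move=> t; rewrite mxE.
by apply: cmeas_indic => //; exact: (L2_measurable (Hu m)).
Qed.

Let ut_cauchy t k l : (k <= l)%N -> qd t (ut l t - ut k t) <= 2 * 2^-1 ^+ k * gam t.
Proof.
move=> kl; have [Ft|nFt] := pselect (F t); last first.
  rewrite !utN// subrr /qd /sqn (ip0l (siW t))//= mulr_ge0// mulr_ge0// exprn_ge0//.
rewrite !utF//; apply: (le_trans (@sqn_telescope _ _ _ _ (siW t) (u ^~ t) k l (fun=> I) kl)).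
by rewrite ler_wpM2l ?mulr_ge0 ?exprn_ge0//; exact: partial_le.
Qed.

Let entry_cvg t i : cvgn (fun m => (W t *m ut m t) i 0).
Proof.
(* Squared increments decay like 2^-m, hence the increments themselves with ratio sqrt (1/2). *)
pose x m := (W t *m ut m t) i 0; pose q : R := Num.sqrt 2^-1.
have q2 : q ^+ 2 = 2^-1 by rewrite sqr_sqrtr.
have q0 : 0 <= q by exact: sqrtr_ge0.
have q1 : q < 1 by rewrite -(@ltr_pXn2r _ 2)// ?nnegrE// q2 expr1n; lra.
have : cvgn (series (fun m => x m.+1 - x m)).
  apply: (@series_abs_cvg _ _ (geometric (Num.sqrt (2 * gam t)) q)); last first.
    by apply: is_cvg_geometric_series; rewrite ger0_norm.
  move=> m; rewrite -(@ler_pXn2r _ 2)// ?nnegrE ?ler0c ?mulr_ge0 ?sqrtr_ge0 ?exprn_ge0//.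
  rewrite -[leRHS](rmorphXn (real_complex R)) /geometric /= exprMn sqr_sqrtr ?mulr_ge0//.
  rewrite exprAC q2.
  have -> : x m.+1 - x m = (W t *m (ut m.+1 t - ut m t)) i 0 by rewrite mulmxBr [RHS]mxE [X in _ = _ + X]mxE.
  rewrite (le_trans (entry_le_sqv _ _))// lecR.
  apply: (le_trans (sqv_psd_contraction _ (density'_psd Om t) (density'_trace Om t))).
  by rewrite -mulrA [gam t * _]mulrC mulrA; exact: ut_cauchy.
move=> /cvg_ex[l hl]; apply/cvg_ex; exists (x 0%N + l).
rewrite (_ : (fun m => _) = fun m => x 0%N + series (fun m => x m.+1 - x m) m).
  exact: (cvgD (cvg_cst _) hl).
by apply/funext => m; rewrite /series /= telescope_sumr// addrC subrK.
Qed.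

Let y t : 'cV[C]_n := \col_i limn (fun m => (W t *m ut m t) i 0).

Let y_cvg t i : (fun m => (W t *m ut m t) i 0) @ \oo --> y t i 0.
Proof. by rewrite mxE; exact: entry_cvg. Qed.

Let cmeas_mulmx (M : T -> 'M[C]_n) f i : (forall i j, cmeas (fun t => M t i j)) ->
  cvmeasurable f -> cmeas (fun t => (M t *m f t) i 0).
Proof.
move=> hM hf; apply: (@cmeas_ext _ _ _ (fun t => \sum_j M t i j * f t j 0)).
  by move=> t; rewrite mxE.
by apply: cmeas_sum => j; apply: cmeasM => //; exact: hf.
Qed.

Let y_meas : cvmeasurable y.
Proof.
move=> i; apply: (cmeas_cvg (F := fun m t => (W t *m ut m t) i 0)) => [m|t].
  by apply: cmeas_mulmx => //; exact: density'_cmeas.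
exact: y_cvg.
Qed.

Let iter_meas j : cvmeasurable (fun t => iter j (fun v => v - W t *m v) (y t)).
Proof.
elim: j => // j IH i /=.
apply: (@cmeas_ext _ _ _ (fun t => iter j (fun v => v - W t *m v) (y t) i 0 +
   (-1) * (W t *m iter j (fun v => v - W t *m v) (y t)) i 0)).
  by move=> t; rewrite !mxE mulN1r.
apply: cmeasD; first exact: IH.
apply: cmeasM; first exact: cmeas_cst.
by apply: cmeas_mulmx => //; exact: density'_cmeas.
Qed.

(** A Riesz-Fischer argument for a degenerate weight. The limit y(t) of W(t) u_m(t) exists, the
    Landweber iteration solves W(t) x(t) = y(t) measurably, and [psd_limit_bound] carries the Cauchy
    estimate over to x; integrating it gives convergence. *)
Lemma L2_complete_limit : exists2 x, L2space Om x & (fun m => sqn (L2dot Om) (x - u m)) @ \oo --> (0 : R).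
Proof.
have ex t : exists x, (W t *m x = y t) /\ forall i, (fun j => landweber (W t) (y t) j i 0) @ \oo --> x i 0.
  have [x h1 h2] := landweber_cvg (density'_psd Om t) (density'_trace Om t) (@y_cvg t).
  by exists x.
have [x hx] := choice ex.
have xm : cvmeasurable x.
  move=> i; apply: (cmeas_cvg (F := fun j t => landweber (W t) (y t) j i 0)) => [j|t].
    apply: (@cmeas_ext _ _ _ (fun t => \sum_(k < j) iter k (fun v => v - W t *m v) (y t) i 0)).
      by move=> t; rewrite /landweber summxE.
    by apply: cmeas_sum => k; exact: iter_meas.
  by have [_ h] := hx t; exact: h.
have bnd t k : qd t (ut k t - x t) <= 2 * 2^-1 ^+ k * gam t.
  apply: (@psd_limit_bound _ _ _ (density'_psd Om t) (ut ^~ t)).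
    by move=> i; have [-> _] := hx t; exact: y_cvg.
  by move=> l; exact: ut_cauchy.
have qN t v : qd t (- v) = qd t v.
  by rewrite /qd /sqn (ipNl (siW t))// (ipNr (siW t))// opprK.
have L2x : L2space Om x.
  have [_ i0] := (L2spaceE _).1 (Hu 0%N).
  apply: (@L2_of_bound _ (fun t => 2 * (2 * gam t) + 2 * qd t (u 0%N t))) => //.
    by apply: integrableD_real; apply: integrableZ_real => //; exact: integrableZ_real.
  move=> t; have -> : x t = (x t - ut 0%N t) + ut 0%N t by rewrite subrK.
  apply: (le_trans (sqnD2 (siW t) (I : [set: 'cV[C]_n] (x t - ut 0%N t)) I)).
  apply: lerD; rewrite ler_pM2l//.
    by rewrite -opprB -/(qd t _) qN; have := bnd t 0%N; rewrite expr0 mulr1.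
  have [Ft|nFt] := pselect (F t); first by rewrite utF.
  by rewrite utN// /sqn (ip0l (siW t))//=; exact: qd_ge0.
exists x => //.
pose c := \int[mu]_t gam t.
apply: (@squeeze_cvgr _ _ _ _ (cst 0) (fun m => 2 * c * 2^-1 ^+ m)).
- apply: nearW => m; have Hd := siB si L2x (Hu m); apply/andP; split.
    exact: (sqn_ge0 si Hd).
  have ed : sqn (L2dot Om) (x - u m) = \int[mu]_t qd t (ut m t - x t).
    rewrite sqn_L2E; last exact: L2_measurable.
    have md : cvmeasurable (x - u m) by exact: L2_measurable.
    have me : cvmeasurable (fun t => ut m t - x t).
      have := cvmeasurable_lin (-1) xm (ut_meas m).
      by congr cvmeasurable; apply/funext => t /=; rewrite scaleN1r addrC.
    rewrite /Rintegral; congr fine; apply: ae_eq_integral => //.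
    - by apply/measurable_EFinP; exact: (measurable_qd md).
    - by apply/measurable_EFinP; exact: (measurable_qd me).
    - by apply: filterS ae_F => t Ft _; rewrite utF// -qN opprB.
  rewrite ed mulrAC -(RintegralZl _ measurableT igam).
  apply: le_Rintegral; [exact: measurableT| | |by move=> t _; exact: bnd].
  + have me : cvmeasurable (fun t => ut m t - x t).
      have := cvmeasurable_lin (-1) xm (ut_meas m).
      by congr cvmeasurable; apply/funext => t /=; rewrite scaleN1r addrC.
    have i2 := integrableZ_real (2 * 2^-1 ^+ m) igam.
    by have [] := (L2spaceE _).1 (L2_of_bound me i2 (fun t => bnd t m)).
  + exact: integrableZ_real.
- exact: cvg_cst.
- rewrite -[X in _ --> X](mulr0 (2 * c)); apply: cvgM; first exact: cvg_cst.
  by apply: cvg_expr; rewrite ger0_norm ?invr_ge0//; lra.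
Qed.

End completeness.

Lemma L2_complete : fast_complete (L2space Om) (L2dot Om).
Proof. by move=> u Hu hu; exact: L2_complete_limit. Qed.

End L2_space.

(** * The spaces L^2 and H^2 on the circle *)

Section circle_functions.
Context {R : realType}.
Local Notation C := R[i].
Local Notation circ := (borel_circle R).

Lemma cval_norm (x : circ) : `|cval x| = 1.
Proof. by have := set_mem (valP (x : circle R)). Qed.

Lemma cval_conjK (x : circ) : (cval x)^* * cval x = 1.
Proof. by rewrite mulrC -normCK cval_norm expr1n. Qed.

Lemma cval_continuous : continuous (fun x : circle R => set_val x : C).
Proof. exact: (@initial_continuous (circle R) C set_val). Qed.

Lemma continuous_measurable (f : circle R -> R) : continuous f ->
  measurable_fun setT (f : circ -> R).
Proof.
move=> /continuousP cf; apply: (measurability _ (RGenOpens.measurableE R)).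
move=> _ [_ [a [b ->] <-]]; rewrite setTI; apply: sub_sigma_algebra.
by apply: cf; exact: interval_open.
Qed.

Lemma nbhs_norm_lt (z : C) (e : R) : 0 < e -> nbhs z (fun w : C => `|z - w| < e%:C%C).
Proof.
move=> e0; apply/(@nbhs_ballP C C^o); exists (e%:C)%C => /=; first by rewrite ltcR.
by move=> w.
Qed.

Lemma Re_continuous : continuous (fun z : C => complex.Re z).
Proof.
move=> z; apply/(@cvgrPdist_lt _ _ _ (nbhs z) (nbhs_filter z)) => e e0.
apply: (@filterS _ (nbhs z) (nbhs_filter z) _ _ _ (nbhs_norm_lt z e0)) => w h.
by rewrite -raddfB -ltcR; exact: le_lt_trans (normc_ge_Re _) h.
Qed.

Lemma Im_continuous : continuous (fun z : C => complex.Im z).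
Proof.
move=> z; apply/(@cvgrPdist_lt _ _ _ (nbhs z) (nbhs_filter z)) => e e0.
apply: (@filterS _ (nbhs z) (nbhs_filter z) _ _ _ (nbhs_norm_lt z e0)) => w h.
rewrite -raddfB -ltcR; apply: le_lt_trans h.
rewrite normc_def lecR -sqrtr_sqr ler_wsqrtr// lerDr; exact: sqr_ge0.
Qed.

Lemma cmeas_cval : cmeas (@cval R).
Proof.
split; apply: continuous_measurable => x.
  exact: (continuous_comp (@cval_continuous x) (@Re_continuous _)).
exact: (continuous_comp (@cval_continuous x) (@Im_continuous _)).
Qed.

Definition cauchy_kernel (z : C) (x : circ) : C := (1 - (cval x)^* * z)^-1.

Lemma kernel_denom_neq0 (z : C) (x : circ) : `|z| < 1 -> 1 - (cval x)^* * z != 0.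
Proof.
move=> z1; rewrite subr_eq0; apply/eqP => /(congr1 Num.norm).
by rewrite normr1 normrM norm_conjC cval_norm mul1r => e; rewrite -e ltxx in z1.
Qed.

Lemma cauchy_kernel_norm (z : C) (x : circ) : `|z| < 1 -> `|cauchy_kernel z x| <= (1 - `|z|)^-1.
Proof.
move=> z1; rewrite /cauchy_kernel normfV lef_pV2 ?posrE ?normr_gt0 ?kernel_denom_neq0// ?subr_gt0//.
have := lerB_normD 1 (- ((cval x)^* * z)); rewrite normrN normr1 normrM norm_conjC cval_norm mul1r.
by [].
Qed.

Lemma cauchy_kernel_tail (z : C) (x : circ) N : `|z| < 1 ->
  cauchy_kernel z x - \sum_(k < N) ((cval x)^* * z) ^+ k = ((cval x)^* * z) ^+ N * cauchy_kernel z x.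
Proof.
move=> z1; have nz := kernel_denom_neq0 x z1; apply: (mulIf nz).
rewrite mulrBl /cauchy_kernel mulVf// -mulrA mulVf// mulr1.
by rewrite [X in _ - X]mulrC -[1 - (cval x)^* * z]opprB mulNr -subrX1 opprB opprB addrC subrK.
Qed.

Lemma cauchy_kernel_tail_norm (z : C) (x : circ) N : `|z| < 1 ->
  `|cauchy_kernel z x - \sum_(k < N) ((cval x)^* * z) ^+ k| <= `|z| ^+ N * (1 - `|z|)^-1.
Proof.
move=> z1; rewrite cauchy_kernel_tail// normrM normrX normrM norm_conjC cval_norm mul1r.
by rewrite ler_wpM2l ?exprn_ge0//; exact: cauchy_kernel_norm.
Qed.

Lemma kernel_bound_cvg (z : C) : `|z| < 1 -> exists2 b : nat -> R,
  b @ \oo --> (0 : R) & forall N, `|z| ^+ N * (1 - `|z|)^-1 = (b N)%:C%C.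
Proof.
rewrite normc_real; set r := complex.Re _ => r1'.
have r1 : r < 1 by rewrite -ltcR.
have r0 : 0 <= r by rewrite -ler0c -normc_real.
exists (fun N => (1 - r)^-1 * r ^+ N).
  rewrite -[X in _ --> X](mulr0 (1 - r)^-1); apply: cvgM; first exact: cvg_cst.
  by apply: cvg_expr; rewrite ger0_norm.
by move=> N; rewrite mulrC rmorphM/= fmorphV/= rmorphB/= rmorphXn.
Qed.

Lemma cmeas_kernel_psum (z : C) N : cmeas (fun x : circ => \sum_(k < N) ((cval x)^* * z) ^+ k).
Proof.
apply: cmeas_sum => k; apply: cmeasX; apply: cmeasM; last exact: cmeas_cst.
by apply: cmeas_conj; exact: cmeas_cval.
Qed.

Lemma cmeas_kernel (z : C) : `|z| < 1 -> cmeas (cauchy_kernel z).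
Proof.
move=> z1; apply: (cmeas_cvg (F := fun N x => \sum_(k < N) ((cval x)^* * z) ^+ k)).
  by move=> N; exact: cmeas_kernel_psum.
move=> x; have [b b0 hb] := kernel_bound_cvg z1.
apply: (complex_squeeze _ b0); apply: nearW => N.
by rewrite distrC -hb; exact: cauchy_kernel_tail_norm.
Qed.

End circle_functions.

Section L2_circle.
Context {R : realType} {n : nat}.
Local Notation C := R[i].
Local Notation circ := (borel_circle R).
Variable Om : mxmeasure (borel_circle R) R n.
Implicit Types f g h : circ -> 'cV[C]_n.
Let si := semi_inner_L2 Om.

Definition scal (phi : circ -> C) f : circ -> 'cV[C]_n := fun x => phi x *: f x.

Lemma L2dot_scal phi f g : L2dot Om (scal phi f) g = L2dot Om f (scal (fun x => (phi x)^*) g).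
Proof.
congr Cintegral; apply/funext => x; rewrite /scal -scalemxAr.
by rewrite (ipZl semi_inner_dotc)// (ipZr semi_inner_dotc)// conjCK.
Qed.

Lemma cvmeasurable_scal phi f : cmeas phi -> cvmeasurable f -> cvmeasurable (scal phi f).
Proof.
move=> hp hf i; apply: (@cmeas_ext _ _ _ (fun x => phi x * f x i 0)).
  by move=> x; rewrite mxE.
by apply: cmeasM => //; exact: hf.
Qed.

Lemma L2_scal phi f (M : R) : cmeas phi -> L2space Om f -> (forall x, `|phi x| <= M%:C%C) ->
  L2space Om (scal phi f) /\ sqn (L2dot Om) (scal phi f) <= M ^+ 2 * sqn (L2dot Om) f.
Proof.
move=> hp Hf hM; have [mf qf] := (L2spaceE Om f).1 Hf.
have ms := cvmeasurable_scal hp mf.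
have bd x : qd Om x (scal phi f x) <= M ^+ 2 * qd Om x (f x).
  rewrite -lecR (sqnZ (semi_inner_psd (density'_psd Om x)))// rmorphM/=.
  rewrite ler_wpM2r//; first by rewrite ler0c; exact: (sqn_ge0 (semi_inner_psd (density'_psd Om x))).
  have M0 : 0 <= M%:C%C :> C by rewrite (le_trans _ (hM x)).
  by rewrite rmorphXn/= lerXn2r// nnegrE.
have i2 := integrableZ_real (M ^+ 2) qf.
have HL := L2_of_bound ms i2 bd; split => //.
have [_ i1] := (L2spaceE _ _).1 HL.
by rewrite !sqn_L2E// -RintegralZl//; apply: le_Rintegral.
Qed.

Lemma L2_cst (v : 'cV[C]_n) : L2space Om (cst v).
Proof.
apply: (@L2_of_bound _ _ _ _ _ _ (cst (sqv v))).
- by move=> i; exact: cmeas_cst.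
- exact: finite_measure_integrable_cst.
- move=> x; apply: psd_le_sqv; [exact: density'_psd|exact: density'_trace].
Qed.

Definition monom k (v : 'cV[C]_n) : circ -> 'cV[C]_n := scal (fun x => cval x ^+ k) (cst v).

Lemma L2_monom k v : L2space Om (monom k v).
Proof.
apply: (proj1 (@L2_scal _ _ 1 _ (L2_cst v) _)); first exact: cmeasX (@cmeas_cval R).
by move=> x; rewrite normrX cval_norm expr1n.
Qed.

Lemma Zop_scal f : Zop f = scal (@cval R) f. Proof. by []. Qed.

Lemma L2_Zop f : L2space Om f -> L2space Om (Zop f).
Proof.
move=> Hf; apply: (proj1 (@L2_scal _ _ 1 (@cmeas_cval R) Hf _)) => x.
by rewrite cval_norm.
Qed.

Lemma Zop_isometry f g : L2dot Om (Zop f) (Zop g) = L2dot Om f g.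
Proof.
rewrite !Zop_scal L2dot_scal; congr (L2dot Om f _); apply/funext => x.
by rewrite /scal scalerA cval_conjK scale1r.
Qed.

Lemma Zop_monom k v : Zop (monom k v) = monom k.+1 v.
Proof. by apply/funext => x; rewrite /Zop /monom /scal scalerA exprS. Qed.

Lemma vpolynomialE (p : circ -> 'cV[C]_n) : vpolynomial p <->
  exists m (a : nat -> 'cV[C]_n), p = \sum_(k < m) monom k (a k).
Proof.
have e m (a : nat -> 'cV[C]_n) : \sum_(k < m) monom k (a k) = fun x => \sum_(k < m) cval x ^+ k *: a k.
  by apply/funext => x; rewrite fct_sumE.
by split=> -[m [a ->]]; exists m, a; rewrite e.
Qed.

Lemma vpolynomial_monom k v : vpolynomial (monom k v).
Proof.
apply/vpolynomialE; exists k.+1, (fun j => if j == k then v else 0).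
rewrite big_ord_recr /= eqxx big1 ?add0r// => j _.
rewrite ifN; last by rewrite neq_ltn ltn_ord.
by apply/funext => x; rewrite /monom /scal scaler0.
Qed.

Lemma monom_lin k (a : C) (u v : 'cV[C]_n) : monom k (a *: u + v) = a *: monom k u + monom k v.
Proof.
apply/funext => x; rewrite /monom /scal.
rewrite [RHS](_ : _ = a *: (cval x ^+ k *: u) + cval x ^+ k *: v)//.
by rewrite scalerDr !scalerA mulrC.
Qed.

Lemma vpolynomial_lin (a : C) p q : vpolynomial p -> vpolynomial q ->
  vpolynomial (a *: p + q : circ -> 'cV[C]_n).
Proof.
move=> /vpolynomialE[m [b ->]] /vpolynomialE[m' [b' ->]]; apply/vpolynomialE.
have pad r (c : nat -> 'cV[C]_n) N : (r <= N)%N ->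
    \sum_(k < r) monom k (c k) = \sum_(k < N) monom k (if (k < r)%N then c k else 0).
  move=> rN; rewrite (big_ord_widen N (fun k => monom k (c k)) rN) big_mkcond.
  apply: eq_bigr => k _; case: ifP => // _.
  by apply/funext => x; rewrite /monom /scal scaler0.
exists (maxn m m'), (fun k => a *: (if (k < m)%N then b k else 0) + (if (k < m')%N then b' k else 0)).
rewrite (pad m b (maxn m m')) ?leq_maxl// (pad m' b' (maxn m m')) ?leq_maxr//.
by rewrite scaler_sumr -big_split; apply: eq_bigr => k _; rewrite monom_lin.
Qed.

Lemma L2_vpolynomial p : vpolynomial p -> L2space Om p.
Proof. by move=> /vpolynomialE[m [a ->]]; apply: (si_sum si) => k; exact: L2_monom. Qed.

Lemma vpolynomial_Zop p : vpolynomial p -> vpolynomial (Zop p : circ -> 'cV[C]_n).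
Proof.
move=> /vpolynomialE[m [a ->]]; apply/vpolynomialE.
exists m.+1, (fun k => if k is k'.+1 then a k' else 0).
rewrite big_ord_recl /= [X in _ = X + _](_ : _ = 0) ?add0r; last first.
  by apply/funext => x; rewrite /monom /scal scaler0.
transitivity (\sum_(k < m) Zop (monom k (a k))); last first.
  by apply: eq_bigr => k _; rewrite Zop_monom.
by apply/funext => x; rewrite /Zop !fct_sumE scaler_sumr.
Qed.

Lemma H2spaceE f : H2space Om f <->
  L2space Om f /\ forall eps : R, 0 < eps -> exists2 p, vpolynomial p & sqn (L2dot Om) (f - p) < eps.
Proof.
split=> -[Hf h]; split => // eps e0.
  have [p hp h2] := h (Num.sqrt eps) (ltac:(by rewrite sqrtr_gt0)).
  by exists p => //; rewrite -(ltr_sqrt _ e0).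
have [p hp h2] := h (eps ^+ 2) (ltac:(by rewrite exprn_gt0)).
exists p => //; rewrite /L2norm -[eps]ger0_norm ?ltW// -sqrtr_sqr ltr_sqrt// exprn_gt0//.
Qed.

Lemma H2_L2 f : H2space Om f -> L2space Om f. Proof. by case. Qed.

Lemma H2_vpolynomial p : vpolynomial p -> H2space Om p.
Proof.
move=> hp; apply/H2spaceE; split; first exact: L2_vpolynomial.
move=> e e0; exists p => //; rewrite subrr /sqn (ip0l si)//; exact: (si0 si).
Qed.

Lemma semi_inner_H2 : semi_inner (H2space Om) (L2dot Om).
Proof.
split.
- apply: H2_vpolynomial; apply/vpolynomialE; exists 0%N, (fun=> 0); by rewrite big_ord0.
- move=> a f g /H2spaceE[Hf hf] /H2spaceE[Hg hg]; apply/H2spaceE; split; first exact: (siP si).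
  move=> e e0; pose c := complex.Re `|a| ^+ 2.
  have c0 : 0 <= c by exact: sqr_ge0.
  have c1 : 0 < 4 * (c + 1) by lra.
  (* The 1 added to c = |a|^2 covers a = 0; the two errors then contribute at most e/2 each after
     the factor 2 of [sqnD2]. *)
  have [p hp h1] := hf (e / (4 * (c + 1))) (divr_gt0 e0 c1).
  have [q hq h2] := hg (e / 4) (ltac:(by lra)).
  exists (a *: p + q); first exact: vpolynomial_lin.
  have Hp := L2_vpolynomial hp; have Hq := L2_vpolynomial hq.
  have -> : a *: f + g - (a *: p + q) = a *: (f - p) + (g - q).
    by rewrite scalerBr opprD addrACA.
  have Hd1 := siB si Hf Hp; have Hd2 := siB si Hg Hq.
  apply: (le_lt_trans (sqnD2 si (siZ si a Hd1) Hd2)).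
  have e1 : sqn (L2dot Om) (a *: (f - p)) = c * sqn (L2dot Om) (f - p).
    by apply: complexI; rewrite (sqnZ si)// normc_real rmorphM/= rmorphXn.
  rewrite e1.
  have h3 : c * sqn (L2dot Om) (f - p) <= e / 4.
    apply: (@le_trans _ _ (c * (e / (4 * (c + 1))))); first by rewrite ler_wpM2l// ltW.
    rewrite mulrA ler_pdivrMr// -[e / 4 * _]mulrA.
    have : 4^-1 * (4 * (c + 1)) = c + 1 by field.
    by move=> ->; rewrite mulrDr mulr1 [c * e]mulrC lerDl ltW.
  by move: h2 h3; move: (sqn _ (g - q)) (sqn _ (f - p)) => x y h2 h3; lra.
- by move=> a f g h Hf Hg Hh; apply: (siPl si); exact: H2_L2.
- by move=> f g Hf Hg; apply: (siC si); exact: H2_L2.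
- by move=> f Hf; apply: (si_ge0 si); exact: H2_L2.
Qed.

Lemma H2_complete : fast_complete (H2space Om) (L2dot Om).
Proof.
move=> u Hu hu; have [g Hg hg] := L2_complete (fun m => H2_L2 (Hu m)) hu.
exists g => //; apply/H2spaceE; split => // e e0.
have e4 : 0 < e / 4 by lra.
move/cvgrPdist_lt: (hg) => /(_ _ e4)[N _ /(_ N (leqnn N))].
rewrite /= sub0r normrN => hN.
have [_ /(_ _ e4)[p hp hp']] := (H2spaceE _).1 (Hu N).
exists p => //; have HuN := H2_L2 (Hu N); have Hp := L2_vpolynomial hp.
have -> : g - p = (g - u N) + (u N - p) by rewrite addrA subrK.
apply: (le_lt_trans (sqnD2 si (siB si Hg HuN) (siB si HuN Hp))).
have := le_lt_trans (ler_norm _) hN.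
by move: hp' => {hN hg}; move: (sqn _ (u N - p)) (sqn _ (g - u N)) => x y; lra.
Qed.

Lemma H2_Zop f : H2space Om f -> H2space Om (Zop f).
Proof.
move=> /H2spaceE[Hf hf]; apply/H2spaceE; split; first exact: L2_Zop.
move=> e /hf[p hp h]; exists (Zop p); first exact: vpolynomial_Zop.
have -> : Zop f - Zop p = Zop (f - p).
  by apply/funext => x; rewrite /Zop /= scalerBr.
by rewrite /sqn Zop_isometry.
Qed.

Lemma Zop_lin (a : C) f g : Zop (a *: f + g) = a *: Zop f + Zop g :> (circ -> 'cV[C]_n).
Proof.
apply/funext => x; rewrite /Zop.
rewrite [RHS](_ : _ = a *: (cval x *: f x) + cval x *: g x)//.
rewrite [X in _ *: X](_ : _ = a *: f x + g x)//.
by rewrite scalerDr !scalerA mulrC.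
Qed.

Lemma Yadj_spec h : H2space Om h ->
  H2space Om (Yadj Om h) /\ forall u, H2space Om u -> L2dot Om (Zop u) h = L2dot Om u (Yadj Om h).
Proof.
move=> Hh; apply: adjoint_spec; have si' := semi_inner_H2.
have [||u Hu|g Hg hg] := riesz si' H2_complete (phi := fun u => L2dot Om (Zop u) h) (M := sqn (L2dot Om) h).
- move=> a u v Hu Hv; rewrite Zop_lin.
  exact: (siPl si' a (H2_Zop Hu) (H2_Zop Hv) Hh).
- exact: (sqn_ge0 si' Hh).
- have := cauchy_schwarz si' (H2_Zop Hu) Hh; rewrite [X in (X * _)%:C%C](_ : _ = sqn (L2dot Om) u).
    by rewrite mulrC.
  by rewrite /sqn Zop_isometry.
- by exists g.
Qed.

(** The geometric partial sums of the Cauchy kernel converge uniformly on the circle, so their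
    products with f converge in L^2, and pairing with a constant is continuous. *)
Lemma evaluation_series f (v : 'cV[C]_n) z : L2space Om f -> `|z| < 1 ->
  cpseries (fun k => L2dot Om f (monom k v)) z @ \oo --> L2dot Om (scal (cauchy_kernel z) f) (cst v).
Proof.
move=> Hf z1; have [b b0 hb] := kernel_bound_cvg z1.
pose psi N x := cauchy_kernel z x - \sum_(k < N) ((cval x)^* * z) ^+ k.
have mpsi N : cmeas (psi N).
  apply: (@cmeas_ext _ _ _ (fun x => cauchy_kernel z x + (-1) * \sum_(k < N) ((cval x)^* * z) ^+ k)).
    by move=> x; rewrite mulN1r.
  apply: cmeasD; first exact: cmeas_kernel.
  by apply: cmeasM; [exact: cmeas_cst|exact: cmeas_kernel_psum].
have psib N x : `|psi N x| <= (b N)%:C%C by rewrite -hb; exact: cauchy_kernel_tail_norm.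
have Lk N : L2space Om (scal (psi N) f) by have [] := L2_scal (mpsi N) Hf (psib N).
have b_ge0 N : 0 <= b N by rewrite -ler0c (le_trans _ (psib N point)).
have Lc := L2_cst v.
have Lm k : L2space Om (scal (fun x => ((cval x)^* * z) ^+ k) f).
  apply: (proj1 (@L2_scal _ _ 1 _ Hf _)).
    apply: cmeasX; apply: cmeasM; last exact: cmeas_cst.
    by apply: cmeas_conj; exact: cmeas_cval.
  move=> x; rewrite normrX normrM norm_conjC cval_norm mul1r exprn_ile1// ltW//.
apply: (@complex_squeeze _ _ _ (fun N => b N * (Num.sqrt (sqn (L2dot Om) f) * Num.sqrt (sqn (L2dot Om) (cst v))))); last first.
  by rewrite -[X in _ --> X](mul0r (Num.sqrt (sqn (L2dot Om) f) * Num.sqrt (sqn (L2dot Om) (cst v)))); apply: cvgM => //; exact: cvg_cst.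
apply: nearW => N; rewrite distrC.
have sE : cpseries (fun k => L2dot Om f (monom k v)) z N =
    L2dot Om (\sum_(k < N) scal (fun x => ((cval x)^* * z) ^+ k) f) (cst v).
  rewrite (ip_suml si)// /cpseries /series /= big_mkord; apply: eq_bigr => k _.
  have -> : scal (fun x => ((cval x)^* * z) ^+ k) f = z ^+ k *: scal (fun x => ((cval x)^*) ^+ k) f.
    apply/funext => x; rewrite /scal [RHS](_ : _ = z ^+ k *: ((cval x)^* ^+ k *: f x))//.
    by rewrite scalerA exprMn mulrC.
  have Lx : L2space Om (scal (fun x => ((cval x)^*) ^+ k) f).
    apply: (proj1 (@L2_scal _ _ 1 _ Hf _)).
      by apply: cmeasX; apply: cmeas_conj; exact: cmeas_cval.
    by move=> x; rewrite normrX norm_conjC cval_norm expr1n.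
  rewrite (ipZl si)// L2dot_scal; congr (_ * L2dot Om f _).
  by apply/funext => x; rewrite /monom /scal rmorphXn/= conjCK.
have Ls : L2space Om (\sum_(k < N) scal (fun x => ((cval x)^* * z) ^+ k) f) by exact: (si_sum si).
have Lck : L2space Om (scal (cauchy_kernel z) f).
  have -> : scal (cauchy_kernel z) f = scal (psi 0%N) f.
    by apply/funext => x; rewrite /scal /psi big_ord0 subr0.
  exact: Lk.
rewrite sE -(ipBl si)//.
have -> : scal (cauchy_kernel z) f - \sum_(k < N) scal (fun x => ((cval x)^* * z) ^+ k) f = scal (psi N) f.
  by apply/funext => x; rewrite /scal /psi /= fct_sumE scalerBl scaler_suml.
rewrite (le_trans (cauchy_schwarz_sqrt si (Lk N) Lc))// lecR mulrA ler_wpM2r ?sqrtr_ge0//.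
have [_ h] := L2_scal (mpsi N) Hf (psib N).
rewrite (le_trans (ler_wsqrtr h))// sqrtrM ?sqr_ge0// sqrtr_sqr ger0_norm//.
Qed.

End L2_circle.

(** * The Herglotz kernel *)

Section matrix_identities.
Context {R : realType}.
Local Notation C := R[i].

Lemma adjmxD n (A B : 'M[C]_n) : adjmx (A + B) = adjmx A + adjmx B.
Proof. by rewrite /adjmx map_mxD linearD. Qed.

Lemma adjmxM n (A B : 'M[C]_n) : adjmx (A *m B) = adjmx B *m adjmx A.
Proof. by rewrite /adjmx map_mxM trmx_mul. Qed.

Lemma adjmxN n (A : 'M[C]_n) : adjmx (- A) = - adjmx A.
Proof. by rewrite /adjmx map_mxN linearN. Qed.

Lemma adjmx1 n : adjmx 1%:M = 1%:M :> 'M[C]_n.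
Proof. by rewrite /adjmx map_mx1 trmx1. Qed.

Lemma adjmx_unit n (A : 'M[C]_n) : A \in unitmx -> adjmx A \in unitmx.
Proof. by rewrite /adjmx unitmx_tr map_unitmx. Qed.

(** Placing blocks side by side makes a sum of several products, each with an adjoint, a single such
    product; the uniqueness of coefficients is then applied once. *)
Lemma power_series_row_mx p q s (a : nat -> 'M[C]_(p, q)) (b : nat -> 'M[C]_(p, s)) F G :
  power_series_on_disc a F -> power_series_on_disc b G ->
  power_series_on_disc (fun k => row_mx (a k) (b k)) (fun w => row_mx (F w) (G w)).
Proof.
move=> /power_seriesP ha /power_seriesP hb; apply/power_seriesP => w i j.
rewrite mxE; case: splitP => l jl.
  have e : (fun k => row_mx (a k) (b k) i j) = fun k => a k i l.
    by apply/funext => k; rewrite (_ : j = lshift s l) ?row_mxEl//; exact: val_inj.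
  by rewrite e; exact: ha.
have e : (fun k => row_mx (a k) (b k) i j) = fun k => b k i l.
  by apply/funext => k; rewrite (_ : j = rshift q l) ?row_mxEr//; exact: val_inj.
by rewrite e; exact: hb.
Qed.

Lemma sesqui_power_series_uniq p q (x y : nat -> 'M[C]_(p, q)) X Y :
  power_series_on_disc x X -> power_series_on_disc y Y ->
  (forall w, X w *m (map_mx Num.conj (Y w))^T = 0) ->
  forall j k, x j *m (map_mx Num.conj (y k))^T = 0.
Proof.
move=> hx hy h j k; have bx := power_series_pbounded hx; have by_ := power_series_pbounded hy.
move/power_seriesP: hx => hx; move/power_seriesP: hy => hy.
apply/matrixP => i l; rewrite !mxE.
(* The scalar lemma takes functions on all of [R[i]]; the value off the disc is 0. *)
pose at_ (F : disc R -> 'M[C]_(p, q)) i m (z : C) :=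
  if pselect (exists w : disc R, dval w = z) is left e then F (projT1 (cid e)) i m else 0.
have atE F i' m (z : C) (w : disc R) : dval w = z -> at_ F i' m z = F w i' m.
  move=> wz; rewrite /at_; case: pselect => [e|[]]; last by exists w.
  case: cid => w' /= w'z; congr (F _ i' m); apply: val_inj.
  by rewrite -[LHS]/(dval w') -[RHS]/(dval w) w'z wz.
transitivity (\sum_m x j i m * (y k l m)^*).
  by apply: eq_bigr => m _; rewrite !mxE.
apply: (@sesqui_pseries_uniq _ _ (fun m j => x j i m) (fun m k => y k l m)
  (fun m => at_ X i m) (fun m => at_ Y l m)).
- by move=> m; exact: bx.
- by move=> m; exact: by_.
- by move=> m z /disc_ex[w wz]; rewrite (atE _ _ _ _ _ wz) -wz; exact: hx.
- by move=> m z /disc_ex[w wz]; rewrite (atE _ _ _ _ _ wz) -wz; exact: hy.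
- move=> z /disc_ex[w wz]; have /matrixP/(_ i l) := h w; rewrite !mxE => h0; rewrite -[RHS]h0.
  by apply: eq_bigr => m _; rewrite !mxE !(atE _ _ _ _ _ wz).
Qed.

Lemma dotc_suml n (I : Type) (r : seq I) (P : pred I) (F : I -> 'cV[C]_n) v :
  dotc (\sum_(i <- r | P i) F i) v = \sum_(i <- r | P i) dotc (F i) v.
Proof.
apply: (big_morph (fun u => dotc u v)) => [u w|]; last exact: (ip0l semi_inner_dotc).
exact: (ipDl semi_inner_dotc).
Qed.

Lemma dotcC n (u v : 'cV[C]_n) : dotc u v = (dotc v u)^*.
Proof. exact: (siC semi_inner_dotc). Qed.

Lemma dotc_sumr n (I : Type) (r : seq I) (P : pred I) (F : I -> 'cV[C]_n) v :
  dotc v (\sum_(i <- r | P i) F i) = \sum_(i <- r | P i) dotc v (F i).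
Proof.
rewrite dotcC dotc_suml rmorph_sum; apply: eq_bigr => i _.
by rewrite [RHS]dotcC.
Qed.

Lemma dotc_adjmxl n (A : 'M[C]_n) u v : dotc (adjmx A *m u) v = dotc u (A *m v).
Proof. by rewrite dotc_adjmx adjmxK. Qed.

Lemma orthonormal_expansion n (e : 'I_n -> 'cV[C]_n) x : orthonormal_basis e ->
  \sum_i dotc x (e i) *: e i = x.
Proof.
move=> onb; pose U : 'M[C]_n := \matrix_(i, j) e j i 0.
have UU : adjmx U *m U = 1%:M.
  apply/matrixP => i j; rewrite !mxE eq_sym -(onb j i) /dotc; apply: eq_bigr => k _.
  by rewrite !mxE mulrC.
transitivity (U *m (adjmx U *m x)); last by rewrite mulmxA (mulmx1C UU) mul1mx.
apply/matrixP => k l; rewrite ord1 summxE [in RHS]mxE.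
apply: eq_bigr => i _; rewrite mxE [U k i]mxE mulrC; congr (_ * _).
by rewrite [RHS]mxE /dotc; apply: eq_bigr => m _; rewrite !mxE mulrC.
Qed.

End matrix_identities.

(** * Truncated Toeplitz operators *)

Section triangular_sums.
Context {R : realType} {n : nat}.
Local Notation C := R[i].

Lemma triangular_reindex (V : nmodType) (F : nat -> nat -> V) j k N : (j <= k < N)%N ->
  \sum_(i < (k - j).+1) F i (k - j - i)%N = \sum_(m < N | (j <= m <= k)%N) F (k - m)%N (m - j)%N.
Proof.
move=> /andP[jk kN].
rewrite (reindex_inj rev_ord_inj) /=.
rewrite (eq_bigr (fun i : 'I_(k - j).+1 => F (k - j - i)%N i)); last first.
  by move=> i _; congr F; have := ltn_ord i; lia.
rewrite -(big_mkord xpredT (fun i => F (k - j - i)%N i)).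
rewrite -(big_mkord (fun m => (j <= m <= k)%N) (fun m => F (k - m)%N (m - j)%N)).
have jN : (j <= N)%N by lia.
have jk1 : (j <= k.+1)%N by lia.
rewrite (big_cat_nat (leq0n j) jN) /=.
rewrite [X in _ = X + _]big_nat_cond [X in _ = X + _]big1 ?add0r; last by move=> m; lia.
rewrite (big_cat_nat jk1 kN) /=.
rewrite [X in _ = _ + X]big_nat_cond [X in _ = _ + X]big1 ?addr0; last by move=> m; lia.
rewrite [RHS]big_nat_cond [RHS](eq_bigl (fun m => (j <= m < k.+1)%N)); last by move=> m; lia.
have := big_addn 0 k.+1 j xpredT (fun m => F (k - m)%N (m - j)%N); rewrite -big_nat add0n => ->.
rewrite subSn//.
by apply: eq_bigr => i _; congr F; lia.
Qed.

Lemma trunc_adjE (B : nat -> 'M[C]_n) u N j :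
  trunc_adj B u N j = \sum_(k < N | (j <= k)%N) adjmx (B (k - j)%N) *m u k.
Proof. by rewrite /trunc_adj (@big_nat_widenl _ _ _ _ 0)// big_mkord; exact: eq_bigl. Qed.

(** The rule (T_A T_B)^* = T_B^* T_A^* survives truncation exactly: an adjoint only lowers indices,
    so sequences supported below N stay so. *)
Lemma trunc_adj_mconv (A B : nat -> 'M[C]_n) u N j :
  trunc_adj (mconv A B) u N j = trunc_adj B (trunc_adj A u N) N j.
Proof.
rewrite !trunc_adjE; under [RHS]eq_bigr do rewrite trunc_adjE mulmx_sumr.
rewrite [RHS](exchange_big_dep (fun k : 'I_N => (j <= k)%N)) /=; last first.
  by move=> m k jm mk; exact: leq_trans jm mk.
apply: eq_bigr => k jk.
rewrite /mconv (triangular_reindex (fun a b => A a *m B b) (N := N)) ?jk//=.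
rewrite (big_morph _ (@adjmxD R n) (_ : adjmx 0 = 0)); last by rewrite /adjmx map_mx0 trmx0.
rewrite mulmx_suml; apply: eq_bigr => m _.
by rewrite adjmxM mulmxA.
Qed.

Lemma dotc_mconv (A : nat -> 'M[C]_n) (F u : nat -> 'cV[C]_n) N :
  \sum_(k < N) dotc (u k) (mconv A F k) = \sum_(j < N) dotc (trunc_adj A u N j) (F j).
Proof.
under [RHS]eq_bigr do rewrite trunc_adjE dotc_suml.
rewrite [RHS](exchange_big_dep xpredT) //=; apply: eq_bigr => k _.
have := triangular_reindex (fun a b => A a *m F b) (j := 0) (ltn_ord k).
rewrite subn0 /= => e; rewrite /mconv e dotc_sumr.
by apply: eq_bigr => m _; rewrite subn0 dotc_adjmxl.
Qed.

(** In this form each term carries a pair of coefficients of indices l - j and k - j, to which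
    [kernel_identity] applies term by term. *)
Lemma dotc_trunc_adj (B D : nat -> 'M[C]_n) u N j :
  dotc (trunc_adj B u N j) (trunc_adj D u N j) =
  \sum_(k < N | (j <= k)%N) \sum_(l < N | (j <= l)%N)
    dotc (D (l - j)%N *m adjmx (B (k - j)%N) *m u k) (u l).
Proof.
rewrite !trunc_adjE dotc_suml; apply: eq_bigr => k _.
rewrite dotc_sumr; apply: eq_bigr => l _.
by rewrite -[in RHS]mulmxA [RHS]dotc_adjmx.
Qed.

End triangular_sums.

Section kernel_identity.
Context {R : realType} {n : nat}.
Local Notation C := R[i].
Local Notation circ := (borel_circle R).
Variable Om : mxmeasure (borel_circle R) R n.
Implicit Types f g h : circ -> 'cV[C]_n.
Let si := semi_inner_L2 Om.

(** The coordinates of int conj(zeta)^k Om(dzeta) f(zeta), written as inner products with zeta^k e_i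
    for the standard basis, so that the isometry [Zop] and its adjoint act on them directly. *)
Definition fourier f k : 'cV[C]_n := \col_i L2dot Om f (monom k (delta_mx i 0)).

Definition moment k : 'M[C]_n :=
  \matrix_(i, j) L2dot Om (cst (delta_mx j 0)) (monom k (delta_mx i 0)).

Lemma monom_sum k v : monom k v = \sum_i v i 0 *: monom k (delta_mx i 0) :> (circ -> 'cV[C]_n).
Proof.
apply/funext => x; rewrite fct_sumE.
transitivity (cval x ^+ k *: \sum_i v i 0 *: (delta_mx i 0 : 'cV[C]_n)).
  rewrite /monom /scal /=; congr (_ *: _); rewrite {1}(matrix_sum_delta v).
  by apply: eq_bigr => i _; rewrite big_ord1.
rewrite scaler_sumr; apply: eq_bigr => i _.
by rewrite [RHS](_ : _ = v i 0 *: (cval x ^+ k *: delta_mx i 0))// !scalerA mulrC.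
Qed.

Lemma L2dot_monom f k v : L2space Om f -> L2dot Om f (monom k v) = dotc (fourier f k) v.
Proof.
move=> Hf; rewrite monom_sum (ip_sumr si)//; last first.
  by move=> i; apply: (siZ si); exact: L2_monom.
rewrite /dotc; apply: eq_bigr => i _; rewrite mxE (ipZr si)//; last exact: L2_monom.
exact: mulrC.
Qed.

Lemma fourier_lin (a : C) f g k : L2space Om f -> L2space Om g ->
  fourier (a *: f + g) k = a *: fourier f k + fourier g k.
Proof.
move=> Hf Hg; apply/matrixP => i j; rewrite !mxE.
exact: (siPl si a Hf Hg (@L2_monom _ _ Om k (delta_mx i 0))).
Qed.

Lemma cst_monom v : cst v = monom 0 v :> (circ -> 'cV[C]_n).
Proof. by apply/funext => x; rewrite /monom /scal expr0 scale1r. Qed.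

Lemma fourier_cst v k : fourier (cst v) k = moment k *m v.
Proof.
apply/matrixP => i j; rewrite ord1 !mxE cst_monom monom_sum (ip_suml si)//; last first.
- exact: L2_monom.
- by move=> l; apply: (siZ si); exact: L2_monom.
apply: eq_bigr => l _; rewrite mxE (ipZl si); [|exact: L2_monom|exact: L2_monom].
by rewrite cst_monom mulrC.
Qed.

Lemma L2dot_monom_shift d j k u v :
  L2dot Om (monom (j + d)%N u) (monom (k + d)%N v) = L2dot Om (monom j u) (monom k v).
Proof.
elim: d => [|d IH]; first by rewrite !addn0.
by rewrite !addnS -!Zop_monom Zop_isometry.
Qed.

(** Multiplication by zeta is isometric, so the Gram matrix of monomials is block Toeplitz, with the
    moments as entries. *)
Lemma L2dot_monom2 j k u v : (j <= k)%N ->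
  L2dot Om (monom j u) (monom k v) = dotc (moment (k - j) *m u) v.
Proof.
move=> jk; transitivity (L2dot Om (monom (0 + j)%N u) (monom (k - j + j)%N v)).
  by rewrite add0n (subnK jk).
rewrite L2dot_monom_shift -cst_monom (L2dot_monom _ _ (@L2_cst _ _ Om u)).
by rewrite fourier_cst.
Qed.

Lemma moment0_adj : adjmx (moment 0) = moment 0.
Proof.
apply/matrixP => i j; rewrite !mxE.
have Hc k : L2space Om (cst (delta_mx k 0)) by exact: L2_cst.
by rewrite -!cst_monom -(siC si (Hc i) (Hc j)).
Qed.

Lemma power_series_of_evaluation f :
  L2space Om f -> power_series_on_disc (fourier f)
    (fun w => \col_i L2dot Om (scal (cauchy_kernel (dval w)) f) (cst (delta_mx i 0))).
Proof.
move=> Hf; apply/power_seriesP => w i j; rewrite mxE.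
have e : (fun k => fourier f k i j) = fun k => L2dot Om f (monom k (delta_mx i 0)).
  by apply/funext => k; rewrite mxE.
by rewrite e; exact: (@evaluation_series _ _ Om _ (delta_mx i 0) _ Hf (dval_lt1 w)).
Qed.

(** Coefficients of the integral of 2 / (1 - conj(zeta) z) - 1; the subtracted 1 removes one M_0
    from the constant term. *)
Definition herglotz_coef k : 'M[C]_n :=
  2 *: moment k + (if k == 0%N then - moment 0 else 0).

Lemma herglotz_kernelE (z : C) (x : circ) : `|z| < 1 ->
  (cval x + z) / (cval x - z) = 2 * cauchy_kernel z x - 1.
Proof.
move=> z1; have nz := kernel_denom_neq0 x z1.
have x0 : cval x != 0 by rewrite -normr_gt0 cval_norm.
have -> : cval x - z = cval x * (1 - (cval x)^* * z).
  by rewrite mulrBr mulr1 mulrA [_ * _^*]mulrC cval_conjK mul1r.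
have -> : cval x + z = cval x * (2 - (1 - (cval x)^* * z)).
  rewrite !mulrBr mulr1 mulrA [cval x * _^*]mulrC cval_conjK mul1r.
  ring.
by rewrite -mulf_div divff// mul1r mulrBl divff.
Qed.

Lemma herglotz_series : power_series_on_disc herglotz_coef
  (fun w => mxintegral Om (fun zeta => ((cval zeta + dval w) / (cval zeta - dval w))%:M)).
Proof.
pose Phi (w : disc R) : 'M[C]_n := \matrix_(i, j)
  L2dot Om (scal (cauchy_kernel (dval w)) (cst (delta_mx j 0))) (cst (delta_mx i 0)).
have hPhi : power_series_on_disc moment Phi.
  apply/power_seriesP => w i j; rewrite mxE.
  have e : (fun k => moment k i j) = fun k => L2dot Om (cst (delta_mx j 0)) (monom k (delta_mx i 0)).
    by apply/funext => k; rewrite mxE.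
  rewrite e; exact: (@evaluation_series _ _ Om _ (delta_mx i 0) _ (L2_cst Om _) (dval_lt1 w)).
have := @power_seriesP_lin _ _ _ 2 _ _ _ _ hPhi (@power_series_cst _ _ _ (- moment 0)).
congr (power_series_on_disc _ _); apply/funext => w; apply/matrixP => i j; rewrite !mxE.
set v := cst (delta_mx j 0); set u := cst (delta_mx i 0).
have Hv : L2space Om v by exact: L2_cst.
have Hu : L2space Om u by exact: L2_cst.
have z1 := dval_lt1 w.
have br : (complex.Re ((1 - `|dval w|)^-1))%:C%C = (1 - `|dval w|)^-1.
  by rewrite RRe_real// ger0_real// invr_ge0 subr_ge0 ltW.
have Hs : L2space Om (scal (cauchy_kernel (dval w)) v).
  apply: (proj1 (@L2_scal _ _ _ _ _ (complex.Re ((1 - `|dval w|)^-1)) (cmeas_kernel z1) Hv _)) => x.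
  by rewrite br; exact: cauchy_kernel_norm.
transitivity (L2dot Om (2 *: scal (cauchy_kernel (dval w)) v + (-1) *: v) u).
  rewrite (siPl si)//; last by apply: (siZ si).
  by rewrite (ipZl si)// -cst_monom mulN1r.
rewrite /L2dot; congr Cintegral; apply/funext => x.
have -> : (2 *: scal (cauchy_kernel (dval w)) v + (-1) *: v) x =
    ((cval x + dval w) / (cval x - dval w)) *: delta_mx j 0.
  rewrite herglotz_kernelE// scalerBl -scalerA scale1r.
  by rewrite [LHS](_ : _ = 2 *: (cauchy_kernel (dval w) x *: delta_mx j 0) + (-1) *: delta_mx j 0)// scaleN1r.
rewrite dotc_delta -scalemxAr -colE mul_mx_scalar !mxE//.
Qed.

Lemma Vop_series (Theta : disc R -> 'M[C]_n) A f : L2space Om f ->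
  power_series_on_disc A (fun w => 1%:M - Theta w) ->
  power_series_on_disc (mconv A (fourier f)) (Vop Om Theta f).
Proof.
move=> Hf hA; have := power_seriesM hA (power_series_of_evaluation Hf).
congr (power_series_on_disc _ _); apply/funext => w; congr (_ *m _).
apply/matrixP => i j; rewrite ord1 !mxE; congr Cintegral; apply/funext => x.
by rewrite dotc_delta.
Qed.

End kernel_identity.

Section herglotz_kernel.
Context {R : realType} {n : nat}.
Local Notation C := R[i].
Local Notation circ := (borel_circle R).
Variable Theta : disc R -> 'M[C]_n.
Hypothesis Theta_analytic : analytic Theta.
Hypothesis Theta_pc : purely_contractive Theta.
Variable Om : mxmeasure circ R n.
Hypothesis Om_Theta : is_herglotz_measure Om Theta.
Variable Th : nat -> 'M[C]_n.
Hypothesis ThE : power_series_on_disc Th Theta.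
Let si := semi_inner_L2 Om.

Let I0 k : 'M[C]_n := if k == 0%N then 1%:M else 0.
Definition one_sub_coef k : 'M[C]_n := (-1) *: Th k + I0 k.
Let A := one_sub_coef.
Let P := herglotz_coef Om.
Let G := mconv A P.

Lemma one_sub_series : power_series_on_disc A (fun w => 1%:M - Theta w).
Proof.
have := @power_seriesP_lin _ _ _ (-1) _ _ _ _ ThE (@power_series_cst _ _ _ 1%:M).
by congr (power_series_on_disc _ _); apply/funext => w; rewrite scaleN1r addrC.
Qed.

(** Let W = (1 + Theta) (1 - Theta)^-1 and denote adjoints by a prime. Since 1 + Theta commutes with
    A = 1 - Theta, one has A W = 1 + Theta, so A (W + W') A' = (1 + Theta) (1 - Theta)' + (1 -
    Theta) (1 + Theta)', where the mixed terms cancel. *)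
Lemma herglotz_identity w :
  let Aw := 1%:M - Theta w in
  let H := mxintegral Om (fun zeta => ((cval zeta + dval w) / (cval zeta - dval w))%:M) in
  Aw *m H *m adjmx Aw + Aw *m adjmx (Aw *m H) = 2 *: (1%:M - Theta w *m adjmx (Theta w)).
Proof.
move=> Aw H; have uA : Aw \in unitmx := unitmx_1_sub_contraction Theta_analytic Theta_pc w.
pose W := (1%:M + Theta w) *m invmx Aw.
have WA : Aw *m W = 1%:M + Theta w.
  have cA : Aw *m (1%:M + Theta w) = (1%:M + Theta w) *m Aw.
    by rewrite mulmxDr mulmxDl mulmx1 mul1mx mulmxBl mulmxBr mul1mx mulmx1.
  by rewrite /W mulmxA cA -mulmxA mulmxV// mulmx1.
have hW : W + adjmx W = H + adjmx H.
  have := Om_Theta w; rewrite /Re_mx => /scalerI; apply.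
  by rewrite invr_neq0// pnatr_eq0.
have -> : Aw *m H *m adjmx Aw + Aw *m adjmx (Aw *m H) = Aw *m (H + adjmx H) *m adjmx Aw.
  by rewrite adjmxM mulmxA mulmxDr mulmxDl.
rewrite -hW mulmxDr mulmxDl WA -[Aw *m adjmx W *m _]mulmxA -adjmxM WA.
rewrite /Aw adjmxD adjmxN adjmxD adjmx1.
set T := Theta w; set T' := adjmx T.
rewrite !mulmxBl !mulmxBr !mulmxDl !mulmxDr !mul1mx !mulmx1 scalerBr !scaler_nat !mulr2n.
by move: (T *m T') => TT; apply/matrixP => i j; rewrite !mxE; ring.
Qed.

Lemma kernel_identity j k :
  G j *m adjmx (A k) + A j *m adjmx (G k) =
  2 *: (I0 j *m adjmx (I0 k) - Th j *m adjmx (Th k)).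
Proof.
have hA := one_sub_series; have hG := @power_seriesM _ _ _ _ _ _ _ _ hA (@herglotz_series R n Om).
have hI := @power_series_cst R n n 1%:M.
have h2 (c : C) B F : power_series_on_disc B F ->
    power_series_on_disc (fun k => c *: B k : 'M[C]_n) (fun w => c *: F w).
  move=> hB; have := @power_seriesP_lin _ _ _ c _ _ _ _ hB (@power_series_cst _ _ _ 0).
  congr (power_series_on_disc _ _); apply/funext => l; last by rewrite addr0.
  by case: ifP => _; rewrite addr0.
(* Four blocks, one for each product in the identity with everything moved to the left; the factors
   2 and -2 are carried by [hX] only. *)
have hX := power_series_row_mx hG (power_series_row_mx hA
  (power_series_row_mx (h2 2 _ _ ThE) (h2 (-2) _ _ hI))).
have hY := power_series_row_mx hA (power_series_row_mx hG (power_series_row_mx ThE hI)).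
have e : forall a1 a2 a3 a4 b1 b2 b3 b4 : 'M[C]_n,
    row_mx a1 (row_mx a2 (row_mx a3 a4)) *m
      (map_mx Num.conj (row_mx b1 (row_mx b2 (row_mx b3 b4))))^T =
    a1 *m adjmx b1 + (a2 *m adjmx b2 + (a3 *m adjmx b3 + a4 *m adjmx b4)).
  by move=> *; rewrite !map_row_mx !tr_row_mx !mul_row_col.
have h w : (row_mx ((1%:M - Theta w) *m mxintegral Om
      (fun zeta => ((cval zeta + dval w) / (cval zeta - dval w))%:M))
    (row_mx (1%:M - Theta w) (row_mx (2 *: Theta w) (-2 *: 1%:M)))) *m
    (map_mx Num.conj (row_mx (1%:M - Theta w) (row_mx ((1%:M - Theta w) *m mxintegral Om
      (fun zeta => ((cval zeta + dval w) / (cval zeta - dval w))%:M)) (row_mx (Theta w) 1%:M))))^T = 0.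
  rewrite e addrA herglotz_identity -!scalemxAl adjmx1 mulmx1 scaleNr scalerBr.
  by rewrite addrA subrK subrr.
have := sesqui_power_series_uniq hX hY h j k; rewrite e addrA -!scalemxAl scaleNr => /eqP.
rewrite addrA subr_eq0 -/(G j) -/(G k) => /eqP e2.
by rewrite scalerBr -e2 addrK.
Qed.

Variable f : circ -> 'cV[C]_n.
Hypothesis f_L2 : L2space Om f.

Let q (u : nat -> 'cV[C]_n) N : circ -> 'cV[C]_n := \sum_(j < N) monom j (trunc_adj A u N j).

Let q_L2 u N : L2space Om (q u N).
Proof. by apply: (si_sum si) => j; exact: L2_monom. Qed.

Lemma dotc_Vop_coef (u : nat -> 'cV[C]_n) N :
  \sum_(k < N) dotc (u k) (mconv A (fourier Om f) k) = L2dot Om (q u N) f.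
Proof.
rewrite dotc_mconv [RHS](siC si f_L2 (q_L2 u N)) (ip_sumr si)//; last first.
  by move=> j; exact: L2_monom.
rewrite rmorph_sum; apply: eq_bigr => j _.
by rewrite (L2dot_monom _ _ f_L2) -[RHS]dotcC.
Qed.

(** Put a = T_A^* u. Pairing a_j with coefficient j of T_G^* u = T_P^* a gives the entries of the
    Gram matrix of q with k >= j, doubled off the diagonal and single on it, because P_0 = M_0 and
    P_k = 2 M_k. Adding the conjugate fills the other triangle and yields twice the full Gram
    sum. *)
Lemma sqn_trunc (u : nat -> 'cV[C]_n) N : L2dot Om (q u N) (q u N) =
  \sum_(j < N) (dotc (u j) (u j) - dotc (trunc_adj Th u N j) (trunc_adj Th u N j)).
Proof.
pose a j := trunc_adj A u N j.
pose D j k : C := L2dot Om (monom j (a j)) (monom k (a k)).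
have qD : L2dot Om (q u N) (q u N) = \sum_(j < N) \sum_(k < N) D j k.
  rewrite {1}/q (ip_suml si)//; last by move=> j; exact: L2_monom.
  apply: eq_bigr => j _; rewrite (ip_sumr si)//; last exact: L2_monom.
  by move=> k; exact: L2_monom.
have gE j : trunc_adj G u N j = trunc_adj P a N j by exact: trunc_adj_mconv.
have gD (j : 'I_N) : dotc (a j) (trunc_adj G u N j) = \sum_(k < N | (j <= k)%N)
    (2 * D j k - (k == j)%:R * D j k).
  rewrite gE trunc_adjE dotc_sumr; apply: eq_bigr => k jk.
  rewrite -dotc_adjmx /D L2dot_monom2// /P /herglotz_coef subn_eq0.
  rewrite mulmxDl (ipDl semi_inner_dotc)// -scalemxAl (ipZl semi_inner_dotc)//.
  congr (_ + _); case: (k =P j) => [->|/eqP kj].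
    by rewrite leqnn mul1r subnn mulNmx (ipNl semi_inner_dotc).
  rewrite ifN ?mul0mx ?mul0r ?oppr0 ?(ip0l semi_inner_dotc)//.
  by rewrite -ltnNge ltn_neqAle jk andbT eq_sym.
have id j : dotc (trunc_adj G u N j) (a j) + dotc (a j) (trunc_adj G u N j) =
    2 * (dotc (trunc_adj I0 u N j) (trunc_adj I0 u N j)
       - dotc (trunc_adj Th u N j) (trunc_adj Th u N j)).
  rewrite !dotc_trunc_adj -sumrB mulr_sumr -big_split; apply: eq_bigr => k _ /=.
  rewrite -sumrB mulr_sumr -big_split; apply: eq_bigr => l _ /=.
  rewrite -(ipDl semi_inner_dotc)// -mulmxDl addrC kernel_identity.
  by rewrite -scalemxAl (ipZl semi_inner_dotc)// mulmxBl (ipBl semi_inner_dotc).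
have iE (j : 'I_N) : trunc_adj I0 u N j = u j.
  rewrite trunc_adjE (bigD1 j)//= subnn adjmx1 mul1mx big1 ?addr0// => k /andP[jk kj].
  rewrite /I0 ifN; first by rewrite /adjmx map_mx0 trmx0 mul0mx.
  by rewrite subn_eq0 -ltnNge ltn_neqAle jk andbT eq_sym.
have DC j k : D j k = (D k j)^*.
  exact: (siC si (@L2_monom _ _ Om k (a k)) (@L2_monom _ _ Om j (a j))).
have tri : 2 * \sum_(j < N) \sum_(k < N) D j k =
    \sum_(j < N) (dotc (trunc_adj G u N j) (a j) + dotc (a j) (trunc_adj G u N j)).
  pose D' (j k : nat) := 2 * D j k - (k == j)%:R * D j k.
  have D'C j k : (D' j k)^* = D' k j.
    by rewrite rmorphB !rmorphM/= !conjC_nat -!DC eq_sym.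
  rewrite [RHS](eq_bigr (fun j : 'I_N => \sum_(k < N | (j <= k)%N) D' k j +
      \sum_(k < N | (j <= k)%N) D' j k)); last first.
    move=> j _; rewrite [X in X + _]dotcC gD rmorph_sum; congr (_ + _).
    by apply: eq_bigr => k _; rewrite -D'C.
  rewrite [RHS]big_split /= [X in _ = X + _](exchange_big_dep xpredT)//= -big_split mulr_sumr /=.
  apply: eq_bigr => j _; rewrite [X in _ = X + _]big_mkcond [X in _ = _ + X]big_mkcond -big_split mulr_sumr /=.
  apply: eq_bigr => k _; rewrite /D'.
  by case: (ltngtP (j : nat) k) => jk; rewrite /= ?mulr0n ?mulr1n ?mul0r ?mul1r; ring.
apply: (mulfI (_ : 2 != 0 :> C)); first by rewrite pnatr_eq0.
rewrite qD tri mulr_sumr; apply: eq_bigr => j _.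
by rewrite id iE.
Qed.

Lemma Vop_dBR : hardy (Vop Om Theta f) /\ dBR Theta (Vop Om Theta f).
Proof.
apply: (@dBR_of_truncated_bound _ _ Theta Theta_analytic Theta_pc Th ThE (Vop Om Theta f)
  (mconv A (fourier Om f)) (sqn (L2dot Om) f)).
- exact: (@Vop_series _ _ Om Theta A f f_L2 one_sub_series).
- exact: (sqn_ge0 si f_L2).
move=> u N; rewrite dotc_Vop_coef mulrC.
rewrite [X in (X * _)%:C%C](_ : _ = sqn (L2dot Om) (q u N)).
  exact: (cauchy_schwarz si (q_L2 u N) f_L2).
rewrite -sumrB [RHS]sqn_def sqn_trunc [RHS]raddf_sum; apply: eq_bigr => j _.
by rewrite [RHS]raddfB.
Qed.

Lemma one_sub_coef0 : A 0 = 1%:M - Theta disc0.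
Proof. by rewrite (power_series_disc0 one_sub_series). Qed.

(** M_0 is eliminated between the two entries of the kernel identity, using that G_0 = A_0 M_0 and
    that M_0 is Hermitian. What is left shows that the sum is - A_(k+1) A_0^-1. *)
Lemma moment_sum k :
  (\sum_(j < k.+1) A j *m moment Om (k - j).+1) *m A 0 = - A k.+1.
Proof.
set K := \sum_(j < _) _; pose M0 := moment Om 0.
have uA : A 0 \in unitmx by rewrite one_sub_coef0 unitmx_1_sub_contraction.
have P0 : P 0 = M0 by rewrite /P /herglotz_coef eqxx scaler_nat mulr2n addrK.
have G0 : G 0 = A 0 *m M0 by rewrite /G /mconv big_ord1 P0.
have GS : G k.+1 = 2 *: K + A k.+1 *m M0.
  rewrite /G /mconv big_ord_recr /= subnn P0; congr (_ + _).
  rewrite scaler_sumr; apply: eq_bigr => j _.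
  have jk : (j <= k)%N by rewrite -ltnS.
  by rewrite (subSn jk) /P /herglotz_coef /= addr0 scalemxAr.
have AS : A k.+1 = - Th k.+1 by rewrite /A /one_sub_coef /I0 /= addr0 scaleN1r.
have A0 : A 0 = 1%:M - Th 0 by rewrite /A /one_sub_coef /I0 /= scaleN1r addrC.
have two (X Y : 'M[C]_n) : 2 *: X = 2 *: Y -> X = Y.
  by apply: scalerI; rewrite pnatr_eq0.
have M0A : adjmx (A 0 *m M0) = M0 *m adjmx (A 0) by rewrite adjmxM moment0_adj.
have e1 : K *m adjmx (A 0) + A k.+1 *m (M0 *m adjmx (A 0)) = A k.+1 *m adjmx (Th 0).
  apply: two; have := kernel_identity k.+1 0; rewrite GS G0 M0A.
  rewrite {2}/I0 /= mul0mx sub0r -[in X in _ = X -> _]mulNmx -AS => <-.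
  rewrite [in RHS]mulmxDl -scalemxAl -[A k.+1 *m M0 *m _]mulmxA scalerDr.
  by rewrite [2 *: (A k.+1 *m _)]scaler_nat mulr2n addrA.
have e0 : A 0 *m (M0 *m adjmx (A 0)) = 1%:M - Th 0 *m adjmx (Th 0).
  apply: two; have := kernel_identity 0 0; rewrite G0 M0A /I0 /= adjmx1 mulmx1 => <-.
  by rewrite scaler_nat mulr2n mulmxA.
(* Multiplied by A_0 on the left, the terms in Th_0 times its adjoint cancel and only minus the
   adjoint of A_0 remains. *)
have e2 : adjmx (Th 0) - M0 *m adjmx (A 0) = - (invmx (A 0) *m adjmx (A 0)).
  apply: (can_inj (mulKmx uA)).
  rewrite mulmxBr e0 mulmxN mulmxA (mulmxV uA) mul1mx A0 adjmxD adjmxN adjmx1.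
  by rewrite mulmxBl mul1mx !opprB addrA subrK.
have -> : K = - (A k.+1 *m invmx (A 0)).
  apply: (can_inj (mulmxK (adjmx_unit uA))).
  rewrite mulNmx -mulmxA -mulmxN -e2 mulmxBr; apply/eqP; rewrite eq_sym subr_eq; apply/eqP.
  by rewrite e1.
by rewrite mulNmx -mulmxA (mulVmx uA) mulmx1.
Qed.

End herglotz_kernel.

Theorem proposition3p2p3 (R : realType) (n : nat)
  (e : 'I_n -> 'cV[R[i]]_n) (e_onb : orthonormal_basis e)
  (Theta : disc R -> 'M[R[i]]_n)
  (Theta_analytic : analytic Theta) (Theta_pc : purely_contractive Theta)
  (Omega : mxmeasure (borel_circle R) R n)
  (Omega_Theta : is_herglotz_measure Omega Theta)
  (f : borel_circle R -> 'cV[R[i]]_n) (f_H2 : H2space Omega f) :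
  let b : 'I_n -> borel_circle R -> 'cV[R[i]]_n := fun i => cst (e i) in
  let g : 'I_n -> borel_circle R -> 'cV[R[i]]_n :=
    fun i => cst ((1%:M - Theta disc0) *m e i) in
  Xop Theta (Vop Omega Theta f) =
  Vop Omega Theta
    (Yadj Omega (f - \sum_(i < n) L2dot Omega f (b i) *: g i)).
Proof.
move=> b g; have [Th ThE] := Theta_analytic.
have f_L2 := H2_L2 f_H2; pose A := one_sub_coef Th.
have A0 : 1%:M - Theta disc0 = A 0 by rewrite -(one_sub_coef0 ThE).
have hA : power_series_on_disc A (fun w => 1%:M - Theta w) by exact: one_sub_series.
have [hV dV] := Vop_dBR Theta_analytic Theta_pc Omega_Theta ThE f_L2.
have fV := @Vop_series _ _ Omega Theta A f f_L2 hA.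
pose c := A 0 *m fourier Omega f 0.
(* (f, b_i) is the coordinate of F_0(f) along e_i, and g_i has the value A_0 e_i: the sum expands
   F_0(f) in the given basis and applies A_0. *)
have -> : \sum_(i < n) L2dot Omega f (b i) *: g i = cst c.
  rewrite /c -[X in A 0 *m X](orthonormal_expansion _ e_onb) mulmx_sumr.
  apply/funext => x; rewrite fct_sumE [RHS]/=; apply: eq_bigr => i _.
  by rewrite -scalemxAr /b cst_monom (L2dot_monom _ _ f_L2) /g A0.
have cH : H2space Omega (cst c).
  by rewrite cst_monom; apply: H2_vpolynomial; exact: vpolynomial_monom.
have hH : H2space Omega (f - cst c) by exact: (siB (semi_inner_H2 Omega) f_H2 cH).
have [yH yE] := Yadj_spec hH.
(* Coefficients are inner products with monomials, which lie in H^2, so the adjoint relation raises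
   the index by one. *)
have yF k : fourier Omega (Yadj Omega (f - cst c)) k =
    fourier Omega f k.+1 - moment Omega k.+1 *m c.
  have -> : fourier Omega f k.+1 - moment Omega k.+1 *m c = fourier Omega (f - cst c) k.+1.
    have -> : f - cst c = (-1) *: cst c + f by rewrite scaleN1r addrC.
    rewrite (fourier_lin _ _ (H2_L2 cH) f_L2) fourier_cst scaleN1r; exact: addrC.
  apply/matrixP => i j; rewrite [LHS]mxE [RHS]mxE.
  have si := semi_inner_H2 Omega.
  have mH := H2_vpolynomial Omega (vpolynomial_monom k (delta_mx i 0)).
  have mH1 := H2_vpolynomial Omega (vpolynomial_monom k.+1 (delta_mx i 0)).
  by rewrite (siC si mH yH) -yE// Zop_monom -(siC si mH1 hH).
have [a [ha1 ha2]] := (hardyP _).1 hV.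
rewrite (power_series_coef_uniq ha1 fV) in ha2.
have [sV _] := shift_adj_coefs (conj fV ha2).
(* Membership in [dBR] enters here: [Xop] is 0 off that space. *)
have -> : Xop Theta (Vop Omega Theta f) = shift_adj (Vop Omega Theta f).
  by rewrite /Xop patchT// inE.
apply: (power_series_uniq sV).
have := @Vop_series _ _ Omega Theta A _ (H2_L2 yH) hA.
congr (power_series_on_disc _ _); apply/funext => k.
(* The Cauchy product of index k + 1 has one term more, A_(k+1) F_0(f); the constant subtracted from
   f supplies it through [moment_sum]. *)
rewrite /mconv [RHS]big_ord_recr /= subnn.
transitivity (\sum_(j < k.+1) (A j *m fourier Omega f (k.+1 - j)%N -
    A j *m moment Omega (k - j).+1 *m c)).
  apply: eq_bigr => j _; have jk : (j <= k)%N by rewrite -ltnS.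
  by rewrite yF mulmxBr mulmxA (subSn jk).
rewrite sumrB; congr (_ + _); rewrite -mulmx_suml /c mulmxA.
by rewrite (moment_sum Theta_analytic Theta_pc Omega_Theta ThE) mulNmx opprK.
Qed.
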